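(* Let $\mathbf{k}$ be a field of characteristic $0$, $H$ a cocommutative Hopf algebra over $\mathbf{k}$, and let $L$ and $M$ be two Lie $H$-pseudoalgebras. Let $\mathfrak{g}$ be the differential graded Lie algebra $\big(C^{\bullet+1}_{>}(L\oplus M,M),[\cdot,\cdot]_{\mathrm{NR}},d\big)$ associated with $L$ and $M$, let $\mathcal{MC}(\mathfrak{g})=MC(\mathfrak{g})/\!\sim$ be the set of connected components of its Deligne groupoid (Maurer–Cartan elements of $\mathfrak{g}$ modulo equivalence), and let $H^2_{nab}(L,M)$ be the set of equivalence classes of non-abelian $2$-cocycles of $L$ with values in $M$. Then there is a bijection $$H^2_{nab}(L,M)\cong\mathcal{MC}(\mathfrak{g}).$$
   Context: **Basic conventions.** $\otimes=\otimes_{\mathbf k}$; $\Delta(h)=h_{(1)}\otimes h_{(2)}$ (Sweedler). $H^{\otimes n}$ is a left $H^{\otimes n}$-module by multiplication and a right $H$-module via the iterated comultiplication. Since $H$ is cocommutative, permutations of the tensor factors of $H^{\otimes n}$ are right $H$-linear and induce maps on $H^{\otimes n}\otimes_H Z$ for every left $H$-module $Z$. Here $\sigma_{12}$ interchanges the first two tensor factors, and $\sigma_{1\to 3}(h_3\otimes h_1\otimes h_2)=h_1\otimes h_2\otimes h_3$ on $H^{\otimes 3}$. For left $H$-modules $X,Y,Z$, a $\mathbf k$-linear map $A:X\otimes Y\to H^{\otimes 2}\otimes_H Z$ is $H^{\otimes 2}$-linear if $A(fx,gy)=((f\otimes g)\otimes_H 1)A(x,y)$; $\mathrm{Hom}_{H^{\otimes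 2}}(X\otimes Y,H^{\otimes 2}\otimes_H Z)$ is the set of such maps (similarly $H^{\otimes n}$-linear maps of $n$ arguments). If $X=Y$, $A$ is skew-symmetric if $A(y,x)=-(\sigma_{12}\otimes_H 1)A(x,y)$. Compositions: for $w=\sum_i(f_i\otimes g_i)\otimes_H e_i\in H^{\otimes 2}\otimes_H X$ and $A(e_i,z)=\sum_j(f_{ij}\otimes g_{ij})\otimes_H e_{ij}$ put $A(w,z)=\sum_{i,j}(f_if_{ij(1)}\otimes g_if_{ij(2)}\otimes g_{ij})\otimes_H e_{ij}$. For $w=\sum_i(h_i\otimes l_i)\otimes_H d_i\in H^{\otimes 2}\otimes_H Y$ and $A(x,d_i)=\sum_j(h_{ij}\otimes l_{ij})\otimes_H d_{ij}$ put $A(x,w)=\sum_{i,j}(h_{ij}\otimes h_il_{ij(1)}\otimes l_il_{ij(2)})\otimes_H d_{ij}$. Both lie in $H^{\otimes 3}\otimes_H Z$. **Lie $H$-pseudoalgebra.** A left $H$-module $L$ with a skew-symmetric $H^{\otimes 2}$-linear map $[\cdot*\cdot]_L:L\otimes L\to H^{\otimes 2}\otimes_H L$ satisfying $[[x*y]_L*z]_L=[x*[y*z]_L]_L-(\sigma_{12}\otimes_H 1)[y*[x*z]_L]_L$. **Non-abelian $2$-cocycles.** A non-abelian $2$-cocycle of $L$ with values in $M$ is a pair $(\chi,\psi)$ with $\chi\in\mathrm{Hom}_{H^{\otimes 2}}(L\otimes L,H^{\otimes 2}\otimes_H M)$ skew-symmetric and $\psi\in\mathrm{Hom}_{H^{\otimes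 2}}(L\otimes M,H^{\otimes 2}\otimes_H M)$ such that for all $x,y,z\in L$, $u,v\in M$: 1. $[\psi(x,u)*v]_M=\psi(x,[u*v]_M)-(\sigma_{12}\otimes_H 1)[u*\psi(x,v)]_M$; 2. $\psi(x,\psi(y,u))-(\sigma_{12}\otimes_H 1)\psi(y,\psi(x,u))-\psi([x*y]_L,u)=[\chi(x,y)*u]_M$; 3. $\psi(x,\chi(y,z))-(\sigma_{12}\otimes_H 1)\psi(y,\chi(x,z))+(\sigma_{1\to 3}\otimes_H 1)\psi(z,\chi(x,y))+\chi(x,[y*z]_L)-(\sigma_{12}\otimes_H 1)\chi(y,[x*z]_L)+(\sigma_{1\to 3}\otimes_H 1)\chi(z,[x*y]_L)=0$. Two cocycles $(\chi,\psi)$, $(\chi',\psi')$ are equivalent if there is an $H$-linear map $\varphi:L\to M$ such that for all $x,y\in L$, $u\in M$: $\psi(x,u)-\psi'(x,u)=[\varphi(x)*u]_M$ and $\chi(x,y)-\chi'(x,y)=\psi'(x,\varphi(y))-(\sigma_{12}\otimes_H 1)\psi'(y,\varphi(x))-(\mathrm{id}_{H^{\otimes 2}}\otimes_H\varphi)[x*y]_L+[\varphi(x)*\varphi(y)]_M$. **The graded Lie algebra of a left $H$-module $V$.** For $n\ge1$, $C^n(V,V)$ is the space of $H^{\otimes n}$-linear maps $\theta:V^{\otimes n}\to H^{\otimes n}\otimes_H V$ that are skew-symmetric: interchanging the arguments $x_i,x_{i+1}$ multiplies the value by $-1$ and interchanges the $i$-th and $(i+1)$-st tensor factors of $H^{\otimes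 n}$. Elements of $C^{m+1}(V,V)$ have degree $m$. For $P\in C^{m+1}(V,V)$, $Q\in C^{n+1}(V,V)$, define the composition: if $P(x_1,\dots,x_{m+1})=\sum_iF_i\otimes_H e_i$ with $F_i\in H^{\otimes m+1}$ and $Q(e_i,y_1,\dots,y_n)=\sum_j(f_{ij}\otimes G_{ij})\otimes_H e_{ij}$ with $f_{ij}\in H$, $G_{ij}\in H^{\otimes n}$, then $Q(P(x_1,\dots,x_{m+1}),y_1,\dots,y_n)=\sum_{i,j}(F_i\,\Delta^{(m)}(f_{ij})\otimes G_{ij})\otimes_H e_{ij}$, where $\Delta^{(m)}:H\to H^{\otimes m+1}$ is the iterated comultiplication. Set $$(i_PQ)(x_1,\dots,x_{m+n+1})=\sum_{\sigma\in\mathrm{Sh}(m+1,n)}(-1)^\sigma(\sigma_{i\to\sigma(i)}\otimes_H 1)\,Q\big(P(x_{\sigma(1)},\dots,x_{\sigma(m+1)}),x_{\sigma(m+2)},\dots,x_{\sigma(m+n+1)}\big),$$ where $\mathrm{Sh}(m+1,n)$ is the set of $(m+1,n)$-shuffles and $\sigma_{i\to\sigma(i)}(h_{\sigma(1)}\otimes\cdots\otimes h_{\sigma(m+n+1)})=h_1\otimes\cdots\otimes h_{m+n+1}$. The bracket $[P,Q]_{\mathrm{NR}}=i_PQ-(-1)^{mn}i_QP$ makes $C^{\bullet+1}(V,V)$ a graded Lie algebra. **The dg Lie algebra $\mathfrak g$.** Take $V=L\oplus M$. Let $\rho_L,\rho_M\in C^2(V,V)$ be given by $[\cdot*\cdot]_L$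 and $[\cdot*\cdot]_M$, extended by zero. Let $d=[\rho_L+\rho_M,-]_{\mathrm{NR}}$. For $m\ge1,n\ge0$ let $C^{m,n}\subset C^{m+n}(V,V)$ be the subspace of those $\theta$ with values in $H^{\otimes m+n}\otimes_H M$ that vanish on tuples of elements of $L\cup M$ unless exactly $m$ of the arguments are from $L$ and $n$ from $M$; such $\theta$ is identified with its restriction to $L^{\otimes m}\otimes M^{\otimes n}$. Put $C^k_>(L\oplus M,M)=\bigoplus_{m+n=k,\,m\ge1,\,n\ge0}C^{m,n}$. Then $\mathfrak g=C^{\bullet+1}_>(L\oplus M,M)$, with $\mathfrak g^k=C^{k+1}_>(L\oplus M,M)$, is a dg Lie subalgebra of $(C^{\bullet+1}(V,V),[\cdot,\cdot]_{\mathrm{NR}},d)$. Here $\mathfrak g^0=\mathrm{Hom}_H(L,M)$ is abelian and consists of ad-nilpotent elements ($\beta$ is ad-nilpotent if for each $x\in\mathfrak g$ some power of $ad_\beta=[\beta,-]_{\mathrm{NR}}$ kills $x$), and $\mathfrak g^1=C^{2,0}\oplus C^{1,1}$. **Maurer–Cartan elements.** $MC(\mathfrak g)=\{c\in\mathfrak g^1: dc+\tfrac12[c,c]_{\mathrm{NR}}=0\}$. Two elements $c,c'\in MC(\mathfrak g)$ are equivalent, $c\sim c'$, if there is an ad-nilpotent $\beta\in\mathfrak g^0$ with $c'=e^{ad_\beta}c+g_\beta$, where $g_\beta=-\sum_{n\ge0}\frac{1}{(n+1)!}(ad_\beta)^n d\beta$; this is an equivalence relation. The Deligne groupoid has object set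 $MC(\mathfrak g)$, exactly one morphism between equivalent objects, and none between non-equivalent ones. *)

(* Defs.v *)
(* Tensor products are quotients of free vector spaces by the defining
   relations. Such submodules are not decidable, whence [boolp], which also
   makes functions into a vector space a vector space. *)
From HB Require Import structures.
From mathcomp Require Import all_boot all_order all_fingroup all_algebra.
From mathcomp Require Import generic_quotient ring_quotient.
From mathcomp Require Import boolp classical_sets functions fsbigop.
From mathcomp Require Import finmap monalg.

Set Implicit Arguments.
Unset Strict Implicit.
Unset Printing Implicit Defensive.
Import GRing.Theory.
Local Open Scope ring_scope.

(** * Vector spaces presented by generators and relations *)

Section LinearExtension.
Variables (k : fieldType) (B : choiceType) (W : lmodType k).

Definition lin_ext (g : B -> W) (u : {malg k[B]}) : W :=
  \sum_(b <- msupp u) u@_b *: g b.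

Lemma lin_ext_is_linear (g : B -> W) : linear (lin_ext g).
Proof.
have ext (d : {fset B}) (u : {malg k[B]}) : fsubset (msupp u) d ->
    lin_ext g u = \sum_(b <- d) u@_b *: g b.
  move=> sub; rewrite /lin_ext.
  apply: (big_fset_incl _ sub) => b _ /mcoeff_outdom ->; exact: scale0r.
move=> a u v.
pose d := fsetU (msupp (a *: u + v)) (fsetU (msupp u) (msupp v)).
rewrite !(ext d) ?fsubsetUl //; last 2 first.
- exact: fsubset_trans (fsubsetUr _ _) (fsubsetUr _ _).
- exact: fsubset_trans (fsubsetUl _ _) (fsubsetUr _ _).
rewrite scaler_sumr -big_split; apply: eq_bigr => b _ /=.
by rewrite mcoeffD mcoeffZ scalerDl scalerA.
Qed.

Lemma lin_extU (g : B -> W) b : lin_ext g << b >> = g b.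
Proof. by rewrite /lin_ext msuppU oner_eq0 big_seq_fset1 mcoeffUU scale1r. Qed.

End LinearExtension.

Section PresentedModule.
Variables (k : fieldType) (B : choiceType) (rel : set {malg k[B]}).

Inductive rel_span : {malg k[B]} -> Prop :=
| rel_span0 : rel_span 0
| rel_spanZD a r u : rel r -> rel_span u -> rel_span (a *: r + u).

Definition in_span : {pred {malg k[B]}} := fun u => `[< rel_span u >].

Lemma rel_spanD u v : rel_span u -> rel_span v -> rel_span (u + v).
Proof.
elim=> [|a r {}u rr _ IH] sv; first by rewrite add0r.
by rewrite -addrA; apply: rel_spanZD => //; apply: IH.
Qed.

Lemma rel_spanZ a u : rel_span u -> rel_span (a *: u).
Proof.
elim=> [|b r {}u rr _ IH]; first by rewrite scaler0; exact: rel_span0.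
by rewrite scalerDr scalerA; exact: rel_spanZD.
Qed.

Lemma in_span_zmod_closed : zmod_closed in_span.
Proof.
split=> [|u v]; first by apply/asboolP; exact: rel_span0.
move=> /asboolP su /asboolP sv; apply/asboolP.
by apply: rel_spanD => //; rewrite -scaleN1r; exact: rel_spanZ.
Qed.

HB.instance Definition _ :=
  GRing.isZmodClosed.Build {malg k[B]} in_span in_span_zmod_closed.

Definition presented : Type := Quotient.quot in_span.
HB.instance Definition _ := GRing.Zmodule.on presented.
HB.instance Definition _ := Quotient.on presented.

Local Open Scope quotient_scope.

Lemma in_spanP u : (u \in in_span) <-> rel_span u.
Proof. exact: iff_sym (rwP (asboolP (rel_span u))). Qed.

Lemma presented_eq (u v : {malg k[B]}) :
  (\pi_presented u = \pi_presented v) <-> rel_span (u - v).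
Proof.
apply: iff_trans (in_spanP _); rewrite (Quotient.idealrBE in_span).
exact: (rwP eqP).
Qed.

Definition presented_scale (a : k) (w : presented) : presented :=
  \pi_presented (a *: (repr w : {malg k[B]})).

Lemma presented_scaleE a u :
  presented_scale a (\pi_presented u) = \pi_presented (a *: u).
Proof.
apply/presented_eq; rewrite -scalerBr; apply: rel_spanZ.
by apply/presented_eq; rewrite reprK.
Qed.

Lemma presented_piD (u v : {malg k[B]}) :
  \pi_presented (u + v) = \pi_presented u + \pi_presented v.
Proof. exact: (raddfD \pi_presented). Qed.

Lemma presented_scaleA a b w :
  presented_scale a (presented_scale b w) = presented_scale (a * b) w.
Proof. by rewrite -[w]reprK (presented_scaleE b) !presented_scaleE scalerA. Qed.

Lemma presented_scale1 : left_id 1 presented_scale.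
Proof. by move=> w; rewrite -[w]reprK presented_scaleE scale1r. Qed.

Lemma presented_scaleDr : right_distributive presented_scale +%R.
Proof.
move=> a v w; rewrite -[v]reprK -[w]reprK.
by rewrite -presented_piD !presented_scaleE scalerDr presented_piD.
Qed.

Lemma presented_scaleDl w : {morph presented_scale^~ w : a b / a + b}.
Proof.
by move=> a b; rewrite -[w]reprK !presented_scaleE scalerDl presented_piD.
Qed.

HB.instance Definition _ := GRing.Zmodule_isLmodule.Build k presented
  presented_scaleA presented_scale1 presented_scaleDr presented_scaleDl.

Definition pgen (b : B) : presented := \pi_presented << b >>.

(* [pext g] is the linear map with value [g b] on the generator [b], provided
   [g] respects the relations (see [pext_gen] and [pext_is_linear]); otherwise
   its value depends on the representative chosen by [repr]. *)
Definition pext (W : lmodType k) (g : B -> W) (w : presented) : W :=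
  lin_ext g (repr w).

Section PextTheory.
Variables (W : lmodType k) (g : B -> W).
Hypothesis g_rel : forall r, rel r -> lin_ext g r = 0.

Lemma lin_ext_span u : rel_span u -> lin_ext g u = 0.
Proof.
elim=> [|a r {}u rr _ IH]; last by rewrite lin_ext_is_linear g_rel // IH scaler0 addr0.
by rewrite /lin_ext msupp0 big_seq_fset0.
Qed.

Lemma pext_pi u : pext g (\pi_presented u) = lin_ext g u.
Proof.
rewrite /pext -[in LHS](subrK u (repr _)) -[_ - u]scale1r lin_ext_is_linear.
rewrite lin_ext_span ?scaler0 ?add0r //.
by apply/presented_eq; rewrite reprK.
Qed.

Lemma pext_gen b : pext g (pgen b) = g b.
Proof. by rewrite pext_pi lin_extU. Qed.

Lemma pext_is_linear : linear (pext g).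
Proof.
move=> a v w; rewrite -[v]reprK -[w]reprK; move: (repr v) (repr w) => x y.
rewrite -[a *: _]/(presented_scale a _) presented_scaleE -presented_piD !pext_pi.
exact: lin_ext_is_linear.
Qed.

End PextTheory.
End PresentedModule.

(** * Tensor powers *)

Section TensorPower.
Variables (k : fieldType) (A : lmodType k).

Definition ffupd (I : finType) (T : Type) (x : {ffun I -> T}) (i : I) (t : T) :
  {ffun I -> T} := [ffun j => if j == i then t else x j].

Inductive tpow_rel n : {malg k[{ffun 'I_n -> A}]} -> Prop :=
| TpowLin (f : {ffun 'I_n -> A}) (i : 'I_n) (a : k) (x y : A) :
    tpow_rel (<< ffupd f i (a *: x + y) >> -
              (a *: << ffupd f i x >> + << ffupd f i y >>)).

Definition tpow n : Type := presented (@tpow_rel n).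
HB.instance Definition _ n := GRing.Lmodule.on (tpow n).

Definition tpure n (f : {ffun 'I_n -> A}) : tpow n := pgen (@tpow_rel n) f.

Definition textend n (W : lmodType k) (g : {ffun 'I_n -> A} -> W) :
  tpow n -> W := pext (rel := @tpow_rel n) g.

Definition tpure1 (x : A) : tpow 1 := tpure [ffun=> x].

(* [tcat F G] is F (x) G in A^{(x)(m + n)}. *)
Definition tcat m n (F : tpow m) (G : tpow n) : tpow (m + n) :=
  textend (fun f => textend (fun g => tpure
    [ffun i => match fintype.split i with inl a => f a | inr b => g b end]) G) F.

(* The i-th factor of the result is the (s i)-th factor of the argument. *)
Definition treindex n (s : 'I_n -> 'I_n) : tpow n -> tpow n :=
  textend (fun f => tpure [ffun i => f (s i)]).

End TensorPower.

Definition tmul (k : fieldType) (H : algType k) n (F G : tpow H n) : tpow H n :=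
  textend (fun f => textend (fun g => tpure [ffun i => f i * g i]) G) F.

(** * Cocommutative Hopf algebras *)

HB.mixin Record isCocommHopf (k : fieldType) H of GRing.Algebra k H := {
  comul : H -> tpow H 2;
  counit : H -> k;
  antipode : H -> H;
  comul_linear : linear comul;
  comul1 : comul 1 = tpure [ffun=> 1];
  comulM : forall g h, comul (g * h) = tmul (comul g) (comul h);
  counit_linear : linear (counit : H -> k^o);
  counit1 : counit 1 = 1;
  counitM : forall g h, counit (g * h) = counit g * counit h;
  antipode_linear : linear antipode;
  comulA : forall h,
    textend (fun f => tcat (comul (f 0)) (tpure1 (f 1)) : tpow H 3) (comul h) =
    textend (fun f => tcat (tpure1 (f 0)) (comul (f 1)) : tpow H 3) (comul h);
  counitl : forall h, textend (fun f => counit (f 0) *: f 1) (comul h) = h;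
  counitr : forall h, textend (fun f => counit (f 1) *: f 0) (comul h) = h;
  antipodel : forall h,
    textend (fun f => antipode (f 0) * f 1) (comul h) = (counit h)%:A;
  antipoder : forall h,
    textend (fun f => f 0 * antipode (f 1)) (comul h) = (counit h)%:A;
  comulC : forall h, treindex (tperm 0 1) (comul h) = comul h
}.

#[short(type="cocommHopfType")]
HB.structure Definition CocommHopf (k : fieldType) :=
  { H of GRing.Algebra k H & isCocommHopf k H }.

Section TensorOverH.
Variables (k : fieldType) (H : cocommHopfType k).

(* [icomul n] is the iterated comultiplication H -> H^{(x) n}: the identity for
   n = 1 and the comultiplication for n = 2, with the counit as the n = 0
   case. *)
Fixpoint icomul n : H -> tpow H n :=
  match n with
  | 0 => fun h => counit h *: tpure [ffun=> 1]
  | S n' =>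
    match n' return (H -> tpow H n') -> H -> tpow H n'.+1 with
    | 0 => fun _ h => tpure1 h
    | S _ => fun ic h =>
        textend (fun f => tcat (tpure1 (f 0)) (ic (f 1))) (comul h)
    end (icomul n')
  end.

Section OneModule.
Variable Z : lmodType H.

Inductive htens_rel n : {malg k[(tpow H n * Z)%type]} -> Prop :=
| HtensLinl a F G z :
    htens_rel (<< (a *: F + G, z) >> - (a *: << (F, z) >> + << (G, z) >>))
| HtensAddr F y z :
    htens_rel (<< (F, y + z) >> - (<< (F, y) >> + << (F, z) >>))
| HtensBal F h z :
    htens_rel (<< (tmul F (icomul n h), z) >> - << (F, h *: z) >>).

(* H^{(x) n} (x)_H Z, a vector space over k; k acts on Z through k -> H. *)
Definition htens n : Type := presented (@htens_rel n).
HB.instance Definition _ n := GRing.Lmodule.on (htens n).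

Definition hpure n (F : tpow H n) (z : Z) : htens n :=
  pgen (@htens_rel n) (F, z).

Definition hextend n (W : lmodType k) (g : tpow H n -> Z -> W) : htens n -> W :=
  pext (rel := @htens_rel n) (fun Fz => g Fz.1 Fz.2).

(* (F (x)_H 1) w *)
Definition hact n (F : tpow H n) : htens n -> htens n :=
  hextend (fun G z => hpure (tmul F G) z).

(* treindex s (x)_H 1 *)
Definition hreindex n (s : 'I_n -> 'I_n) : htens n -> htens n :=
  hextend (fun G z => hpure (treindex s G) z).

Definition sigma12 n : htens n.+2 -> htens n.+2 :=
  hreindex (tperm (0 : 'I_n.+2) 1).

(* h3 (x) h1 (x) h2 is sent to h1 (x) h2 (x) h3. *)
Definition sigma1to3 : htens 3 -> htens 3 := hreindex (@ordS 3).

(* (f (x) G) (x)_H e is sent to (F Delta^{(m)}(f) (x) G) (x)_H e. *)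
Definition insl m n (F : tpow H m.+1) : htens n.+1 -> htens (m.+1 + n) :=
  hextend (fun K e => hpure (textend (fun t : {ffun 'I_n.+1 -> H} =>
    tcat (tmul F (icomul m.+1 (t ord0))) (tpure [ffun i => t (lift ord0 i)])) K)
    e).

(* (f (x) g) (x)_H e is sent to (f (x) F Delta(g)) (x)_H e. *)
Definition insr (F : tpow H 2) : htens 2 -> htens 3 :=
  hextend (fun K e => hpure (textend (fun t : {ffun 'I_2 -> H} =>
    tcat (tpure1 (t 0)) (tmul F (comul (t 1)))) K) e).

End OneModule.

(* id (x)_H phi *)
Definition hmap (Y Z : lmodType H) n (phi : Y -> Z) : htens Y n -> htens Z n :=
  hextend (fun F y => hpure F (phi y)).

Definition pair2 (f g : H) : {ffun 'I_2 -> H} :=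
  [ffun i => if i == 0 then f else g].

Section Bilinear.
Variables (X Y Z : lmodType H).

Record pseudobilinear (A : X -> Y -> htens Z 2) : Prop := PseudoBilinear {
  pseudobilinearl : forall (a : k) x x' y,
    A (a%:A *: x + x') y = a *: A x y + A x' y;
  pseudobilinearr : forall (a : k) x y y',
    A x (a%:A *: y + y') = a *: A x y + A x y';
  pseudobilinearH : forall f g x y,
    A (f *: x) (g *: y) = hact (tpure (pair2 f g)) (A x y)
}.

(* A(w, z) *)
Definition pcompl (A : X -> Y -> htens Z 2) (w : htens X 2) (z : Y) : htens Z 3 :=
  hextend (fun F e => @insl Z 1 1 F (A e z)) w.

(* A(x, w) *)
Definition pcompr (A : X -> Y -> htens Z 2) (x : X) (w : htens Y 2) : htens Z 3 :=
  hextend (fun F d => insr F (A x d)) w.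

End Bilinear.

Definition pseudoskew (X Z : lmodType H) (A : X -> X -> htens Z 2) : Prop :=
  forall x y, A y x = - sigma12 (A x y).

(** * Lie pseudoalgebras and non-abelian 2-cocycles *)

Structure liePseudoalg := LiePseudoalg {
  lie_sort :> lmodType H;
  pbr : lie_sort -> lie_sort -> htens lie_sort 2;
  pbr_bilinear : pseudobilinear pbr;
  pbr_skew : pseudoskew pbr;
  pbr_jacobi : forall x y z,
    pcompl pbr (pbr x y) z =
    pcompr pbr x (pbr y z) - sigma12 (pcompr pbr y (pbr x z))
}.

Section Cocycles.
Variables L M : liePseudoalg.

Definition cocycle_data : Type :=
  ((L -> L -> htens M 2) * (L -> M -> htens M 2))%type.

Record is_nab_cocycle (p : cocycle_data) : Prop := IsNabCocycle {
  nab_chi_bilinear : pseudobilinear p.1;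
  nab_chi_skew : pseudoskew p.1;
  nab_psi_bilinear : pseudobilinear p.2;
  nab_derivation : forall x u v,
    pcompl (@pbr M) (p.2 x u) v =
    pcompr p.2 x (pbr u v) - sigma12 (pcompr (@pbr M) u (p.2 x v));
  nab_curvature : forall x y u,
    pcompr p.2 x (p.2 y u) - sigma12 (pcompr p.2 y (p.2 x u))
      - pcompl p.2 (pbr x y) u =
    pcompl (@pbr M) (p.1 x y) u;
  nab_cocycle : forall x y z,
    pcompr p.2 x (p.1 y z) - sigma12 (pcompr p.2 y (p.1 x z))
      + sigma1to3 (pcompr p.2 z (p.1 x y))
      + pcompr p.1 x (pbr y z) - sigma12 (pcompr p.1 y (pbr x z))
      + sigma1to3 (pcompr p.1 z (pbr x y)) = 0
}.

Definition nab_equiv (p q : cocycle_data) : Prop :=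
  exists phi : {linear L -> M},
    (forall x u, p.2 x u - q.2 x u = pbr (phi x) u) /\
    (forall x y, p.1 x y - q.1 x y =
       q.2 x (phi y) - sigma12 (q.2 y (phi x)) - hmap phi (pbr x y)
         + pbr (phi x) (phi y)).

End Cocycles.

(** * The Nijenhuis-Richardson bracket *)

Section NijenhuisRichardson.
Variable V : lmodType H.

(* Arbitrary V^{m+1} -> H^{(x) m+1} (x)_H V; the elements of C^{m+1}(V, V), of
   degree m, are those satisfying [is_cochain]. *)
Definition precochain m : Type := {ffun 'I_m.+1 -> V} -> htens V m.+1.
HB.instance Definition _ m := GRing.Lmodule.on (precochain m).

Record is_cochain m (P : precochain m) : Prop := IsCochain {
  cochain_linear : forall (x : {ffun 'I_m.+1 -> V}) i (a : k) u v,
    P (ffupd x i (a%:A *: u + v)) = a *: P (ffupd x i u) + P (ffupd x i v);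
  cochain_H : forall (f : {ffun 'I_m.+1 -> H}) (x : {ffun 'I_m.+1 -> V}),
    P [ffun i => f i *: x i] = hact (tpure f) (P x);
  cochain_skew : forall (x : {ffun 'I_m.+1 -> V}) (i j : 'I_m.+1),
    j = i.+1 :> nat ->
    P [ffun l => x (tperm i j l)] = - hreindex (tperm i j) (P x)
}.

Definition shuffles p q : {set 'S_(p + q)} :=
  [set s : 'S_(p + q) |
    [forall i : 'I_p, forall j : 'I_p, (i < j)%N ==>
       (s (lshift q i) < s (lshift q j))%N] &&
    [forall i : 'I_q, forall j : 'I_q, (i < j)%N ==>
       (s (rshift p i) < s (rshift p j))%N]].

(* Q(w, y_1, ..., y_n) *)
Definition nr_comp m n (Q : precochain n) (w : htens V m.+1) (y : {ffun 'I_n -> V}) :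
    htens V (m.+1 + n) :=
  hextend (fun F e => insl F
    (Q [ffun i => if unlift ord0 i is Some j then y j else e])) w.

(* sigma_{i -> sigma(i)} puts the i-th factor in position sigma(i), so the j-th
   factor of its value is the (sigma^-1 j)-th factor of its argument. *)
Definition nr_ins m n (P : precochain m) (Q : precochain n) : precochain (m + n) :=
  fun x : {ffun 'I_(m.+1 + n) -> V} =>
    \sum_(s in shuffles m.+1 n)
      (-1) ^+ s *: hreindex (s^-1)%g
        (nr_comp Q (P [ffun i => x (s (lshift n i))])
           [ffun j => x (s (rshift m.+1 j))]).

Definition nr m n (P : precochain m) (Q : precochain n) : precochain (m + n) :=
  nr_ins P Q
    - (-1) ^+ (m * n) *: ecast N (precochain N) (addnC n m) (nr_ins Q P).

End NijenhuisRichardson.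

(** * The dg Lie algebra of a pair of Lie pseudoalgebras *)

Section DGLie.
Variables L M : liePseudoalg.

Definition LM : lmodType H := (L * M)%type.
Definition inL (x : L) : LM := (x, 0).
Definition inM (u : M) : LM := (0, u).

Definition rhoL : precochain LM 1 :=
  fun x => hmap inL (pbr (x 0).1 (x 1).1).
Definition rhoM : precochain LM 1 :=
  fun x => hmap inM (pbr (x 0).2 (x 1).2).

Definition dgla_diff n (P : precochain LM n) : precochain LM n.+1 := nr (rhoL + rhoM) P.

(* C^{m,n} inside C^{N+1}(V, V), where n = N + 1 - m. *)
Record bidegree N m (P : precochain LM N) : Prop := Bidegree {
  bidegree_cochain : is_cochain P;
  bidegree_val : forall x, exists w : htens M N.+1, P x = hmap inM w;
  bidegree_vanish : forall (S : {set 'I_N.+1}) (x : {ffun 'I_N.+1 -> LM}),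
    (forall i, if i \in S then exists a, x i = inL a
               else exists u, x i = inM u) ->
    #|S| != m -> P x = 0
}.

(* The degree N part of the dg Lie algebra. *)
Definition dgla N : set (precochain LM N) :=
  [set P | exists2 c : nat -> precochain LM N,
     forall m, (1 <= m <= N.+1)%N -> bidegree m (c m) &
     P = \sum_(1 <= m < N.+2) c m].

Definition ad (b : precochain LM 0) n (P : precochain LM n) : precochain LM n := nr b P.

Definition ad_nilpotent (b : precochain LM 0) : Prop :=
  forall x : (forall n, precochain LM n),
    (forall n, dgla (x n)) -> (exists K, forall n, (K <= n)%N -> x n = 0) ->
    exists r, forall n, iter r (@ad b n) (x n) = 0.

(* The sums below are finitely supported when b is ad-nilpotent. *)
Definition exp_ad (b : precochain LM 0) n (P : precochain LM n) : precochain LM n :=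
  \sum_(r \in [set: nat]) (r`!%:R^-1 : k) *: iter r (@ad b n) P.

Definition gauge_term (b : precochain LM 0) : precochain LM 1 :=
  - \sum_(r \in [set: nat]) (r.+1`!%:R^-1 : k) *: iter r (@ad b 1) (dgla_diff b).

Definition MC : set (precochain LM 1) :=
  [set c | dgla c /\ dgla_diff c + 2%:R^-1 *: (@nr LM 1 1 c c : precochain LM 2) = 0].

Definition gauge_equiv (c c' : precochain LM 1) : Prop :=
  exists b, [/\ dgla b, ad_nilpotent b & c' = exp_ad b c + gauge_term b].

End DGLie.

End TensorOverH.

Definition quotient_set (T : Type) (A : set T) (R : T -> T -> Prop) :
  set (set T) := [set C | exists2 x, A x & C = [set y | A y /\ R x y]%classic]%classic.

Definition H2nab (k : fieldType) (H : cocommHopfType k) (L M : liePseudoalg H) :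
    set (set (cocycle_data L M)) :=
  quotient_set [set p | is_nab_cocycle p]%classic (@nab_equiv k H L M).

Definition MCclasses (k : fieldType) (H : cocommHopfType k)
    (L M : liePseudoalg H) : set (set (precochain (LM L M) 1)) :=
  quotient_set (@MC k H L M) (@gauge_equiv k H L M).

Arguments H2nab {k H} L M.
Arguments MCclasses {k H} L M.

(* Main.v *)
(* Write [rho = rho_L + rho_M].  A pair [(chi, psi)] is encoded by the degree 1 cochain
   [c(x + u, y + v) = chi(x, y) + psi(x, v) - sigma12 psi(y, u)], and the elements of degree 1
   of the dg Lie algebra are exactly the cochains of this form.  Since [rho] satisfies the
   Jacobi identity, [c] is Maurer-Cartan if and only if [rho + c] does; the Jacobiator of
   [rho + c] is skew-symmetric, and its components with 3, 2, 1 and 0 arguments in L are the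
   cocycle identities (3), (2), (1) and the Jacobi identity of M.  An element of degree 0 is
   a map [beta] induced by an H-linear [phi : L -> M], and
   [c' = e^(ad beta) (rho + c) - rho].  As [beta] has square zero, this series stops at order
   two and gives the relation of equivalence of cocycles.  Finally [ad beta] is nilpotent
   because it replaces an argument in L by one in M. *)
Require Import Defs.
From HB Require Import structures.
From mathcomp Require Import all_boot all_fingroup all_algebra.
From mathcomp Require Import generic_quotient.
From mathcomp Require Import boolp classical_sets functions fsbigop.
From mathcomp Require Import finmap monalg.
From mathcomp Require Import zify.
Set Implicit Arguments.
Unset Strict Implicit.
Unset Printing Implicit Defensive.
Import GRing.Theory.
Local Open Scope ring_scope.

(** * Linear maps and presented modules *)

(** Operations on [tpow] and [htens] are evaluated on representatives, so each of them must first be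
    shown to respect the relations: [multilin] and [balanced] are these conditions, and identities
    are then checked on pure tensors. Over H they rest on two properties of the iterated
    comultiplication: coassociativity in blocks ([licomul_cat]) lets insertions descend to [htens],
    invariance under permutations ([licomul_reindex]) does the same for permutations of factors. A
    right composition A(x, w) is a left composition up to permutations of the factors. This turns
    the Jacobi identity of a pseudoalgebra into the shuffle sum of the bracket. Since beta kills M
    and has values in M, its bracket with the cochain of (chi, psi) discards chi and moves psi to
    the chi component. Its bracket with rho has both components, and bracketing this once more
    yields [phi x, phi y] twice, which absorbs the coefficient 1/2 of the exponential. The encoding
    is a bijection of cocycles onto Maurer-Cartan elements before passing to classes, and it matches
    the two relations up to their order; the map on classes is therefore a direct image. *)

Section LinearMaps.
Variables (k : fieldType) (U W : lmodType k) (f : U -> W).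
Hypothesis lf : linear f.

(** Linearity is kept as a predicate because an extension from generators is linear only under a
    side condition on the function extended. *)
Lemma linD x y : f (x + y) = f x + f y.
Proof. by rewrite -[x in LHS]scale1r lf scale1r. Qed.
Lemma lin0 : f 0 = 0.
Proof. by apply: (addrI (f 0)); rewrite -linD !addr0. Qed.
Lemma linZ a x : f (a *: x) = a *: f x.
Proof. by rewrite -[a *: x]addr0 lf lin0 addr0. Qed.
Lemma linN x : f (- x) = - f x.
Proof. by rewrite -scaleN1r linZ scaleN1r. Qed.
Lemma linB x y : f (x - y) = f x - f y.
Proof. by rewrite linD linN. Qed.
Lemma lin_sum I r (P : pred I) F :
  f (\sum_(i <- r | P i) F i) = \sum_(i <- r | P i) f (F i).
Proof. by apply: big_morph; [exact: linD | exact: lin0]. Qed.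
End LinearMaps.

Section LinearClosure.
Variables (k : fieldType) (U V W : lmodType k).

Lemma linear_id : linear (id : U -> U). Proof. by []. Qed.
Lemma linear_comp (f : V -> W) (g : U -> V) :
  linear f -> linear g -> linear (fun x => f (g x)).
Proof. by move=> lf lg a x y; rewrite lg lf. Qed.
Lemma linear_opp (f : U -> V) : linear f -> linear (fun x => - f x).
Proof. by move=> lf a x y; rewrite lf opprD scalerN. Qed.
Lemma linear_add (f g : U -> V) : linear f -> linear g -> linear (fun x => f x + g x).
Proof. by move=> lf lg a x y; rewrite lf lg scalerDr addrACA. Qed.
Lemma linear_scale (c : k) (f : U -> V) : linear f -> linear (fun x => c *: f x).
Proof. by move=> lf a x y; rewrite lf scalerDr !scalerA mulrC. Qed.
End LinearClosure.

Section Presented.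
Variables (k : fieldType) (B : choiceType) (rel : set {malg k[B]}).

(** A representative is the finite sum over its support, so the induction runs along that
    support. *)
Lemma presented_ind (P : presented rel -> Prop) :
  P 0 -> (forall a b w, P w -> P (a *: pgen rel b + w)) -> forall w, P w.
Proof.
move=> P0 PS w; rewrite -[w]reprK.
rewrite [repr w]monalgE; elim: (enum_fset _) => [|b r IH].
  rewrite big_nil.
  suff -> : \pi_(presented rel)%qT 0 = 0 :> presented rel by [].
  exact: (raddf0 (\pi_(presented rel)%qT)).
rewrite big_cons presented_piD.
have -> : << (repr w)@_b *g b >> = (repr w)@_b *: (<< b >> : {malg k[B]}).
  by apply/malgP => c; rewrite mcoeffZ !mcoeffU mulr_natr.
rewrite -presented_scaleE; exact: PS.
Qed.

Lemma presented_ext (W : lmodType k) (f g : presented rel -> W) :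
  linear f -> linear g -> (forall b, f (pgen rel b) = g (pgen rel b)) -> f =1 g.
Proof.
move=> lf lg fg; elim/presented_ind => [|a b w IH]; first by rewrite !lin0.
by rewrite lf lg fg IH.
Qed.

End Presented.

(** * Tensor powers *)

Section PresentedRelations.
Variables (k : fieldType) (B : choiceType) (rel : set {malg k[B]}).

Lemma presented_pi_linear :
  linear (fun u : {malg k[B]} => \pi_(presented rel)%qT u : presented rel).
Proof. by move=> a u v; rewrite presented_piD -presented_scaleE. Qed.

(** Extending the generator map linearly gives back the projection, which is how [pgen_rel] turns
    each relator into an identity between generators. *)
Lemma lin_ext_pgen u : lin_ext (pgen rel) u = \pi_(presented rel)%qT u.
Proof.
rewrite [u in RHS]monalgE (lin_sum presented_pi_linear) /lin_ext.
apply: eq_bigr => b _; rewrite /pgen -(linZ presented_pi_linear); congr (\pi_(_)%qT _).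
by apply/malgP => c; rewrite mcoeffZ !mcoeffU mulr_natr.
Qed.

Lemma pgen_rel r : rel r -> lin_ext (pgen rel) r = 0.
Proof.
move=> rr; rewrite lin_ext_pgen -(lin0 presented_pi_linear).
by apply/presented_eq; rewrite subr0 -[r]addr0 -[r]scale1r; do 2?constructor.
Qed.

Section Relators.
Variables (W : lmodType k) (g : B -> W).
Let lg := lin_ext_is_linear g.

Lemma lin_ext_combination a b c d :
  lin_ext g (<< b >> - (a *: << c >> + << d >>)) = g b - (a *: g c + g d).
Proof. by rewrite (linB lg) lg !lin_extU. Qed.

Lemma lin_ext_sum b c d : lin_ext g (<< b >> - (<< c >> + << d >>)) = g b - (g c + g d).
Proof. by rewrite (linB lg) (linD lg) !lin_extU. Qed.

Lemma lin_ext_difference b c : lin_ext g (<< b >> - << c >>) = g b - g c.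
Proof. by rewrite (linB lg) !lin_extU. Qed.
End Relators.
End PresentedRelations.

Section TensorPowers.
Variables (k : fieldType) (A : lmodType k).

(** Exactly the condition that [g] respects the relations [tpow_rel], so that [textend g] does not
    depend on representatives. *)
Definition multilin n (W : lmodType k) (g : {ffun 'I_n -> A} -> W) :=
  forall f i (a : k) x y,
    g (ffupd f i (a *: x + y)) = a *: g (ffupd f i x) + g (ffupd f i y).

Section Extension.
Variables (n : nat) (W : lmodType k) (g : {ffun 'I_n -> A} -> W).
Hypothesis mg : multilin g.

Let g_rel r : @tpow_rel k A n r -> lin_ext g r = 0.
Proof. by case=> f i a x y; rewrite lin_ext_combination mg subrr. Qed.

Lemma textend_pure f : textend g (tpure f) = g f.
Proof. exact: pext_gen g_rel f. Qed.

Lemma textend_linear : linear (textend g).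
Proof. exact: pext_is_linear g_rel. Qed.
End Extension.

Lemma tpure_multilin n : multilin (@tpure k A n).
Proof.
move=> f i a x y; apply/eqP; rewrite -subr_eq0; apply/eqP.
by have := pgen_rel (TpowLin f i a x y); rewrite lin_ext_combination.
Qed.

End TensorPowers.

(* The operations on tensors are rebuilt on locked copies of [tpure] and [textend]:
   without the locks a failing conversion test between two tensors unfolds the
   quotient construction and does not terminate in reasonable time. *)
HB.lock Definition ltpure (k : fieldType) (A : lmodType k) n (f : {ffun 'I_n -> A}) :
  tpow A n := tpure f.
HB.lock Definition ltextend (k : fieldType) (A : lmodType k) n (W : lmodType k)
  (g : {ffun 'I_n -> A} -> W) : tpow A n -> W := textend g.

Section LockedOperations.
Variables (k : fieldType) (A : lmodType k).

Definition ltpure1 (x : A) : tpow A 1 := ltpure [ffun=> x].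

Definition catf m n (f : {ffun 'I_m -> A}) (g : {ffun 'I_n -> A}) : {ffun 'I_(m + n) -> A} :=
  [ffun i => match fintype.split i with inl a => f a | inr b => g b end].

Definition ltcat m n (F : tpow A m) (G : tpow A n) : tpow A (m + n) :=
  ltextend (fun f => ltextend (fun g => ltpure (catf f g)) G) F.

Definition ltreindex n (s : 'I_n -> 'I_n) : tpow A n -> tpow A n :=
  ltextend (fun f => ltpure [ffun i => f (s i)]).

Lemma tpureE n : @tpure k A n = @ltpure k A n.
Proof. by apply/funext => f; rewrite ltpure.unlock. Qed.
Lemma textendE n (W : lmodType k) : @textend k A n W = @ltextend k A n W.
Proof. by apply/funext => g; rewrite ltextend.unlock. Qed.
Lemma tpure1E : @tpure1 k A = ltpure1.
Proof. by apply/funext => x; rewrite /ltpure1 -tpureE. Qed.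
Lemma tcatE m n : @tcat k A m n = @ltcat m n.
Proof.
apply/funext => F; apply/funext => G.
by rewrite /ltcat -!textendE -tpureE.
Qed.
Lemma treindexE n : @treindex k A n = @ltreindex n.
Proof. by apply/funext => s; rewrite /ltreindex -textendE -tpureE. Qed.

Section Extension.
Variables (n : nat) (W : lmodType k) (g : {ffun 'I_n -> A} -> W).
Hypothesis mg : multilin g.

Lemma ltextend_pure f : ltextend g (ltpure f) = g f.
Proof. by rewrite -textendE -tpureE textend_pure. Qed.

Lemma ltextend_linear : linear (ltextend g).
Proof. by rewrite -textendE; exact: textend_linear. Qed.
End Extension.

Lemma ltpure_multilin n : multilin (@ltpure k A n).
Proof. by rewrite -tpureE; exact: tpure_multilin. Qed.

(** Pure tensors span. Identities in several tensors are reduced to pure ones by applying this to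
    one argument at a time. *)
Lemma tpow_ext n (W : lmodType k) (f g : tpow A n -> W) :
  linear f -> linear g -> (forall t, f (ltpure t) = g (ltpure t)) -> f =1 g.
Proof. by rewrite -tpureE; exact: presented_ext. Qed.

Lemma ffupd_id (I : finType) (T : Type) (f : {ffun I -> T}) i : ffupd f i (f i) = f.
Proof. by apply/ffunP => j; rewrite ffunE; case: eqP => [->|]. Qed.

Lemma multilinP n (W : lmodType k) (g : {ffun 'I_n -> A} -> W) :
  (forall f i, linear (fun x => g (ffupd f i x))) <-> multilin g.
Proof. by split. Qed.

Lemma multilin_comp n (W W' : lmodType k) (l : W -> W') (g : {ffun 'I_n -> A} -> W) :
  linear l -> multilin g -> multilin (fun f => l (g f)).
Proof. by move=> ll mg f i a x y; rewrite mg ll. Qed.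

(** Reindexing, concatenation and slotwise multiplication all turn a change of one slot into a
    linear change of one slot, so they preserve multilinearity. *)
Lemma multilin_slot n n' (W : lmodType k) (g : {ffun 'I_n' -> A} -> W)
    (Phi : {ffun 'I_n -> A} -> {ffun 'I_n' -> A}) :
  multilin g ->
  (forall f i, exists j, exists2 l : A -> A, linear l &
     forall x, Phi (ffupd f i x) = ffupd (Phi f) j (l x)) ->
  multilin (fun f => g (Phi f)).
Proof. by move=> mg H f i a x y; have [j [l ll E]] := H f i; rewrite !E ll mg. Qed.

Lemma multilin_textend n n' (W : lmodType k)
    (g : {ffun 'I_n -> A} -> {ffun 'I_n' -> A} -> W) (G : tpow A n') :
  (forall f, multilin (g f)) -> (forall t, multilin (g^~ t)) ->
  multilin (fun f => ltextend (g f) G).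
Proof.
move=> m1 m2 f i a x y.
apply: (tpow_ext (f := ltextend (g (ffupd f i (a *: x + y))))
  (g := fun G => a *: ltextend (g (ffupd f i x)) G + ltextend (g (ffupd f i y)) G)).
- exact: ltextend_linear.
- by apply: linear_add; [apply: linear_scale|]; exact: ltextend_linear.
- by move=> t; rewrite !ltextend_pure // m2.
Qed.

Lemma ltextend_addZ n (W : lmodType k) (a : k) (g h : {ffun 'I_n -> A} -> W) F :
  multilin g -> multilin h ->
  ltextend (fun f => a *: g f + h f) F = a *: ltextend g F + ltextend h F.
Proof.
move=> mg mh.
have m : multilin (fun f => a *: g f + h f).
  move=> f i b x y; rewrite mg mh !scalerDr !scalerA mulrC -!addrA; congr (_ + _).
  by rewrite addrCA.
apply: (tpow_ext (f := ltextend _) (g := fun F => a *: ltextend g F + ltextend h F)).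
- exact: ltextend_linear.
- by apply: linear_add; [apply: linear_scale|]; exact: ltextend_linear.
- by move=> t; rewrite !ltextend_pure.
Qed.

Lemma eq_ltextend n (W : lmodType k) (g h : {ffun 'I_n -> A} -> W) :
  g =1 h -> ltextend g =1 ltextend h.
Proof. by move=> /funext ->. Qed.

Lemma ltextend_comp n (W W' : lmodType k) (l : W -> W') (g : {ffun 'I_n -> A} -> W) F :
  linear l -> multilin g -> l (ltextend g F) = ltextend (fun f => l (g f)) F.
Proof.
move=> ll mg.
have mlg : multilin (fun f => l (g f)) by apply: multilin_comp.
apply: (tpow_ext (f := fun F => l (ltextend g F)) (g := ltextend _)).
- by apply: linear_comp => //; exact: ltextend_linear.
- exact: ltextend_linear.
- by move=> t; rewrite !ltextend_pure.
Qed.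

Lemma catfl m n (f : {ffun 'I_m -> A}) (g : {ffun 'I_n -> A}) i :
  catf f g (lshift n i) = f i.
Proof. by rewrite ffunE -[lshift _ _]/(unsplit (inl _)) unsplitK. Qed.

Lemma catfr m n (f : {ffun 'I_m -> A}) (g : {ffun 'I_n -> A}) i :
  catf f g (rshift m i) = g i.
Proof. by rewrite ffunE -[rshift _ _]/(unsplit (inr _)) unsplitK. Qed.

Lemma catfP m n (f : {ffun 'I_m -> A}) (g : {ffun 'I_n -> A}) (h : {ffun 'I_(m + n) -> A}) :
  (forall i, h (lshift n i) = f i) -> (forall i, h (rshift m i) = g i) -> h = catf f g.
Proof.
move=> hl hr; apply/ffunP => i; rewrite -[i]splitK /unsplit.
by case: (fintype.split i) => j; rewrite ?catfl ?catfr ?hl ?hr.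
Qed.

Section CatMultilin.
Variables (m n : nat) (W : lmodType k) (T : {ffun 'I_(m + n) -> A} -> W).
Hypothesis mT : multilin T.

Lemma multilin_catl (g : {ffun 'I_n -> A}) :
  multilin (fun f : {ffun 'I_m -> A} => T (catf f g)).
Proof.
apply: (multilin_slot (g := T)) => // f i.
exists (lshift n i), id => // x; apply/esym/catfP => j.
  by rewrite !ffunE (inj_eq (@lshift_inj _ _)) -[lshift _ _]/(unsplit (inl _)) unsplitK.
by rewrite !ffunE eq_rlshift -[rshift _ _]/(unsplit (inr _)) unsplitK.
Qed.

Lemma multilin_catr (f : {ffun 'I_m -> A}) :
  multilin (fun g : {ffun 'I_n -> A} => T (catf f g)).
Proof.
apply: (multilin_slot (g := T)) => // g i.
exists (rshift m i), id => // x; apply/esym/catfP => j.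
  by rewrite !ffunE eq_lrshift -[lshift _ _]/(unsplit (inl _)) unsplitK.
by rewrite !ffunE (inj_eq (@rshift_inj _ _)) -[rshift _ _]/(unsplit (inr _)) unsplitK.
Qed.
End CatMultilin.

Lemma catf_multilin_l m n (g : {ffun 'I_n -> A}) : multilin (fun f : {ffun 'I_m -> A} => ltpure (catf f g)).
Proof. exact: multilin_catl (@ltpure_multilin (m + n)) g. Qed.

Lemma catf_multilin_r m n (f : {ffun 'I_m -> A}) : multilin (fun g : {ffun 'I_n -> A} => ltpure (catf f g)).
Proof. exact: multilin_catr (@ltpure_multilin (m + n)) f. Qed.

Lemma ltcat_linear_l m n (G : tpow A n) : linear (fun F : tpow A m => ltcat F G).
Proof.
apply: ltextend_linear; apply: multilin_textend => f.
  exact: catf_multilin_r.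
exact: catf_multilin_l.
Qed.

Lemma ltcat_linear_r m n (F : tpow A m) : linear (fun G : tpow A n => ltcat F G).
Proof.
move=> a x y; rewrite /ltcat -ltextend_addZ; first last.
- apply: multilin_textend => f; [exact: catf_multilin_r|exact: catf_multilin_l].
- apply: multilin_textend => f; [exact: catf_multilin_r|exact: catf_multilin_l].
by apply: eq_ltextend => f; rewrite (ltextend_linear (@catf_multilin_r m n f)).
Qed.

Lemma ltcat_pure m n (f : {ffun 'I_m -> A}) (g : {ffun 'I_n -> A}) :
  ltcat (ltpure f) (ltpure g) = ltpure (catf f g).
Proof.
rewrite /ltcat ltextend_pure.
  by rewrite ltextend_pure //; exact: catf_multilin_r.
apply: multilin_textend => t; [exact: catf_multilin_r|exact: catf_multilin_l].
Qed.

Lemma ltextend_catl m n (W : lmodType k) (T : {ffun 'I_(m + n) -> A} -> W)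
    (F : tpow A m) (g : {ffun 'I_n -> A}) :
  multilin T -> ltextend T (ltcat F (ltpure g)) = ltextend (fun f => T (catf f g)) F.
Proof.
move=> mT; move: F; apply: tpow_ext.
- by apply: linear_comp; [exact: ltextend_linear|exact: ltcat_linear_l].
- exact: ltextend_linear (multilin_catl mT g).
- by move=> f; rewrite ltcat_pure !ltextend_pure //; exact: multilin_catl.
Qed.

Lemma ltextend_catr m n (W : lmodType k) (T : {ffun 'I_(m + n) -> A} -> W)
    (f : {ffun 'I_m -> A}) (G : tpow A n) :
  multilin T -> ltextend T (ltcat (ltpure f) G) = ltextend (fun g => T (catf f g)) G.
Proof.
move=> mT; move: G; apply: tpow_ext.
- by apply: linear_comp; [exact: ltextend_linear|exact: ltcat_linear_r].
- exact: ltextend_linear (multilin_catr mT f).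
- by move=> g; rewrite ltcat_pure !ltextend_pure //; exact: multilin_catr.
Qed.

Lemma ltpure1_linear : linear (ltpure1).
Proof.
have E x : ltpure1 x = ltpure (ffupd [ffun=> 0] (0 : 'I_1) x).
  by congr ltpure; apply/ffunP => i; rewrite !ffunE ord1.
by move=> a x y; rewrite !E ltpure_multilin.
Qed.

Section Reindex.
Variables (n : nat) (s : 'I_n -> 'I_n).
Hypothesis s_inj : injective s.

(** By injectivity slot [i] of the argument is read in exactly one slot of the result, the preimage
    of [i]; a slot read twice would destroy linearity. *)
Lemma reindex_multilin : multilin (fun f : {ffun 'I_n -> A} => ltpure [ffun i => f (s i)]).
Proof.
apply: (multilin_slot (g := @ltpure k A _)); first exact: ltpure_multilin.
move=> f i; exists (invF s_inj i), id => // x; apply/ffunP => j; rewrite !ffunE.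
by rewrite -(inj_eq s_inj j) f_invF.
Qed.

Lemma ltreindex_pure f : ltreindex s (ltpure f) = ltpure [ffun i => f (s i)] :> tpow A n.
Proof. exact: ltextend_pure reindex_multilin _. Qed.

Lemma ltreindex_linear : linear (@ltreindex n s).
Proof. exact: ltextend_linear reindex_multilin. Qed.
End Reindex.

Lemma eq_ltreindex n (s t : 'I_n -> 'I_n) (F : tpow A n) : s =1 t -> ltreindex s F = ltreindex t F.
Proof. by move=> /funext ->. Qed.

(** Reindexing is contravariant: position [i] is read at [s i], which in turn is read at
    [t (s i)]. *)
Lemma ltreindex_comp n (s t : 'I_n -> 'I_n) : injective s -> injective t ->
  forall F : tpow A n, ltreindex s (ltreindex t F) = ltreindex (t \o s) F.
Proof.
move=> si ti; apply: (@tpow_ext n (tpow A n)).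
- by apply: linear_comp; apply: ltreindex_linear.
- by apply: ltreindex_linear; exact: inj_comp.
move=> f; rewrite !ltreindex_pure //; last exact: inj_comp.
by congr ltpure; apply/ffunP => i; rewrite !ffunE.
Qed.

Lemma ltreindex_id n (F : tpow A n) : ltreindex id F = F.
Proof.
apply: (@tpow_ext n (tpow A n) (ltreindex id) id) => //; first exact: ltreindex_linear.
by move=> f; rewrite ltreindex_pure //; congr ltpure; apply/ffunP => i; rewrite ffunE.
Qed.

End LockedOperations.

(** * The algebra structure on tensor powers of H *)

Section TensorAlgebra.
Variables (k : fieldType) (H : cocommHopfType k).

Definition ltmul n (F G : tpow H n) : tpow H n :=
  ltextend (fun f => ltextend (fun g => ltpure [ffun i => f i * g i]) G) F.

Lemma tmulE n (F G : tpow H n) : tmul F G = ltmul F G.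
Proof. by rewrite /ltmul -!textendE -tpureE. Qed.

Lemma ltmul_multilin_r n (f : {ffun 'I_n -> H}) :
  multilin (fun g : {ffun 'I_n -> H} => ltpure [ffun i => f i * g i]).
Proof.
apply: (multilin_slot (g := @ltpure k H _)); first exact: ltpure_multilin.
move=> g i; exists i, (fun x => f i * x); first by move=> a x y; rewrite mulrDr scalerAr.
by move=> x; apply/ffunP => j; rewrite !ffunE; case: eqP => [->|].
Qed.

Lemma ltmul_multilin_l n (g : {ffun 'I_n -> H}) :
  multilin (fun f : {ffun 'I_n -> H} => ltpure [ffun i => f i * g i]).
Proof.
apply: (multilin_slot (g := @ltpure k H _)); first exact: ltpure_multilin.
move=> f i; exists i, (fun x => x * g i); first by move=> a x y; rewrite mulrDl scalerAl.
by move=> x; apply/ffunP => j; rewrite !ffunE; case: eqP => [->|].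
Qed.

Lemma ltmul_linear_l n (G : tpow H n) : linear (fun F : tpow H n => ltmul F G : tpow H n).
Proof.
apply: ltextend_linear; apply: multilin_textend => f.
  exact: ltmul_multilin_r.
exact: ltmul_multilin_l.
Qed.

Lemma ltmul_linear_r n (F : tpow H n) : linear (ltmul F : tpow H n -> tpow H n).
Proof.
move=> a x y; rewrite /ltmul -ltextend_addZ; first last.
- apply: multilin_textend => f; [exact: ltmul_multilin_r|exact: ltmul_multilin_l].
- apply: multilin_textend => f; [exact: ltmul_multilin_r|exact: ltmul_multilin_l].
by apply: eq_ltextend => f; rewrite (ltextend_linear (@ltmul_multilin_r n f)).
Qed.

Lemma ltmul_pure n (f g : {ffun 'I_n -> H}) :
  ltmul (ltpure f) (ltpure g) = ltpure [ffun i => f i * g i] :> tpow H n.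
Proof.
rewrite /ltmul ltextend_pure.
  by rewrite ltextend_pure //; exact: ltmul_multilin_r.
apply: multilin_textend => t; [exact: ltmul_multilin_r|exact: ltmul_multilin_l].
Qed.

Lemma ltmulZl n a (F G : tpow H n) : ltmul (a *: F) G = a *: (ltmul F G : tpow H n) :> tpow H n.
Proof. exact: linZ (ltmul_linear_l G) a F. Qed.

Lemma ltmulZr n a (F G : tpow H n) : ltmul F (a *: G) = a *: (ltmul F G : tpow H n) :> tpow H n.
Proof. exact: linZ (ltmul_linear_r F) a G. Qed.

Lemma ltmulA n (F G K : tpow H n) : ltmul F (ltmul G K) = ltmul (ltmul F G) K :> tpow H n.
Proof.
move: K; apply: (@tpow_ext k H n (tpow H n)); [|exact: ltmul_linear_r|].
  by apply: linear_comp; exact: ltmul_linear_r.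
move=> c; move: G; apply: (@tpow_ext k H n (tpow H n)).
- by apply: linear_comp; [exact: ltmul_linear_r|exact: ltmul_linear_l].
- by apply: (linear_comp (f := fun F => ltmul F _)); [exact: ltmul_linear_l|exact: ltmul_linear_r].
move=> b; move: F; apply: (@tpow_ext k H n (tpow H n)); first exact: ltmul_linear_l.
  by apply: (linear_comp (f := fun F => ltmul F _)); exact: ltmul_linear_l.
move=> a; rewrite !ltmul_pure; congr ltpure.
by apply/ffunP => i; rewrite !ffunE mulrA.
Qed.

Lemma ltmul1 n (F : tpow H n) : ltmul F (ltpure [ffun=> 1]) = F :> tpow H n.
Proof.
move: F; apply: (@tpow_ext k H n (tpow H n)) => //; first exact: ltmul_linear_l.
by move=> f; rewrite ltmul_pure; congr ltpure; apply/ffunP => i; rewrite !ffunE mulr1.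
Qed.

Lemma ltmul1l n (F : tpow H n) : ltmul (ltpure [ffun=> 1]) F = F :> tpow H n.
Proof.
move: F; apply: (@tpow_ext k H n (tpow H n)) => //; first exact: ltmul_linear_r.
by move=> f; rewrite ltmul_pure; congr ltpure; apply/ffunP => i; rewrite !ffunE mul1r.
Qed.

Lemma ltreindexM n (s : 'I_n -> 'I_n) : injective s ->
  forall F G : tpow H n, ltreindex s (ltmul F G : tpow H n) = ltmul (ltreindex s F) (ltreindex s G) :> tpow H n.
Proof.
move=> si F G; move: G; apply: (@tpow_ext k H n (tpow H n)).
- by apply: linear_comp; [exact: ltreindex_linear|exact: ltmul_linear_r].
- by apply: linear_comp; [exact: ltmul_linear_r|exact: ltreindex_linear].
move=> g; move: F; apply: (@tpow_ext k H n (tpow H n)).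
- by apply: linear_comp; [exact: ltreindex_linear|exact: ltmul_linear_l].
- by apply: (linear_comp (f := fun F => ltmul F _)); [exact: ltmul_linear_l|exact: ltreindex_linear].
move=> f; rewrite !ltmul_pure !ltreindex_pure // ltmul_pure; congr ltpure.
by apply/ffunP => i; rewrite !ffunE.
Qed.

Lemma ltmul_tcat m n (F F' : tpow H m) (G G' : tpow H n) :
  ltmul (ltcat F G) (ltcat F' G') = ltcat (ltmul F F' : tpow H m) (ltmul G G' : tpow H n) :> tpow H (m + n).
Proof.
move: F; apply: (@tpow_ext k H m (tpow H _)).
- by apply: (linear_comp (f := fun F => ltmul F _)); [exact: ltmul_linear_l|exact: ltcat_linear_l].
- by apply: (linear_comp (f := fun F => ltcat F _)); [exact: ltcat_linear_l|exact: ltmul_linear_l].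
move=> f; move: F'; apply: (@tpow_ext k H m (tpow H _)).
- by apply: linear_comp; [exact: ltmul_linear_r|exact: ltcat_linear_l].
- by apply: (linear_comp (f := fun F => ltcat F _)); [exact: ltcat_linear_l|exact: ltmul_linear_r].
move=> f'; move: G; apply: (@tpow_ext k H n (tpow H _)).
- by apply: (linear_comp (f := fun F => ltmul F _)); [exact: ltmul_linear_l|exact: ltcat_linear_r].
- by apply: linear_comp; [exact: ltcat_linear_r|exact: ltmul_linear_l].
move=> g; move: G'; apply: (@tpow_ext k H n (tpow H _)).
- by apply: linear_comp; [exact: ltmul_linear_r|exact: ltcat_linear_r].
- by apply: linear_comp; [exact: ltcat_linear_r|exact: ltmul_linear_r].
move=> g'; rewrite !(ltcat_pure, ltmul_pure); congr ltpure.
by apply: catfP => i; rewrite ffunE !(catfl, catfr) ffunE.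
Qed.

End TensorAlgebra.

(** * Iterated comultiplication *)

Section Reindexing.
Variables (k : fieldType) (A : lmodType k).

(** With a first block of length 1 the two bracketings of the total length are convertible, so
    associativity can be stated without a cast. *)
Lemma catfA1 n p (f : {ffun 'I_1 -> A}) (g : {ffun 'I_n -> A}) (h : {ffun 'I_p -> A}) :
  catf f (catf g h) = catf (catf f g) h :> {ffun 'I_(1 + n + p) -> A}.
Proof.
apply: catfP => i; last first.
  have -> : rshift (1 + n) i = rshift 1 (rshift n i) by exact: val_inj.
  by rewrite (catfr (m := 1)) catfr.
rewrite -[i]splitK /unsplit; case: (fintype.split i) => j; rewrite ?catfl ?catfr.
  have -> : lshift p (lshift n j) = lshift (n + p) j by exact: val_inj.
  by rewrite (catfl (m := 1)).
have -> : lshift p (rshift 1 j) = rshift 1 (lshift p j) by exact: val_inj.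
by rewrite (catfr (m := 1)) catfl.
Qed.

Lemma ltcatA1 n p (F : tpow A 1) (G : tpow A n) (K : tpow A p) :
  ltcat F (ltcat G K) = ltcat (ltcat F G) K :> tpow A (1 + n + p).
Proof.
move: F; apply: (@tpow_ext k A 1 (tpow A (1 + n + p))).
- exact: (@ltcat_linear_l k A 1 (n + p)).
- by apply: (linear_comp (f := fun F => ltcat F _)); exact: ltcat_linear_l.
move=> f; move: G; apply: (@tpow_ext k A n (tpow A (1 + n + p))).
- apply: (linear_comp (f := fun G : tpow A (n + p) => ltcat (ltpure f) G : tpow A (1 + n + p))).
    exact: (@ltcat_linear_r k A 1 (n + p)).
  exact: ltcat_linear_l.
- by apply: (linear_comp (f := fun F => ltcat F _)); [exact: ltcat_linear_l|exact: ltcat_linear_r].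
move=> g; move: K; apply: (@tpow_ext k A p (tpow A (1 + n + p))).
- apply: (linear_comp (f := fun G : tpow A (n + p) => ltcat (ltpure f) G : tpow A (1 + n + p))).
    exact: (@ltcat_linear_r k A 1 (n + p)).
  exact: ltcat_linear_r.
- exact: ltcat_linear_r.
by move=> h; rewrite !ltcat_pure catfA1.
Qed.

Lemma ltreindex_tcat m n (s : 'I_(m + n) -> 'I_(m + n)) (s1 : 'I_m -> 'I_m) (s2 : 'I_n -> 'I_n) :
  injective s -> injective s1 -> injective s2 ->
  (forall i, s (lshift n i) = lshift n (s1 i)) ->
  (forall i, s (rshift m i) = rshift m (s2 i)) ->
  forall (F : tpow A m) (G : tpow A n),
    ltreindex s (ltcat F G) = ltcat (ltreindex s1 F) (ltreindex s2 G).
Proof.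
move=> si s1i s2i sl sr F G.
move: F; apply: (@tpow_ext k A m (tpow A _)).
- by apply: linear_comp; [exact: ltreindex_linear|exact: ltcat_linear_l].
- by apply: (linear_comp (f := fun F => ltcat F _)); [exact: ltcat_linear_l|exact: ltreindex_linear].
move=> f; move: G; apply: (@tpow_ext k A n (tpow A _)).
- by apply: linear_comp; [exact: ltreindex_linear|exact: ltcat_linear_r].
- by apply: linear_comp; [exact: ltcat_linear_r|exact: ltreindex_linear].
move=> g; rewrite !(ltcat_pure, ltreindex_pure) //; congr ltpure.
by apply: catfP => i; rewrite ffunE ?sl ?sr ?catfl ?catfr ffunE.
Qed.
End Reindexing.

Section Comultiplication.
Variables (k : fieldType) (H : cocommHopfType k).

Lemma comul1E : comul (1 : H) = ltpure [ffun=> 1].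
Proof. by rewrite comul1 tpureE. Qed.
Lemma comulME (g h : H) : comul (g * h) = ltmul (comul g) (comul h).
Proof. by rewrite comulM tmulE. Qed.
Lemma comulAE (h : H) :
  ltextend (fun f => ltcat (comul (f 0)) (ltpure1 (f 1)) : tpow H 3) (comul h) =
  ltextend (fun f => ltcat (ltpure1 (f 0)) (comul (f 1)) : tpow H 3) (comul h).
Proof. by have := comulA h; rewrite textendE !tcatE tpure1E. Qed.
Lemma counitrE (h : H) : ltextend (fun f => counit (f 1) *: f 0) (comul h) = h.
Proof. by rewrite -textendE counitr. Qed.
Lemma comulCE (h : H) : ltreindex (tperm 0 1) (comul h) = comul h.
Proof. by rewrite -treindexE comulC. Qed.

Definition bilin (W : lmodType k) (B : H -> H -> W) :=
  (forall y, linear (B^~ y)) /\ (forall x, linear (B x)).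

Fixpoint licomul n : H -> tpow H n :=
  match n with
  | 0 => fun h => counit h *: ltpure [ffun=> 1]
  | S n' =>
    match n' return (H -> tpow H n') -> H -> tpow H n'.+1 with
    | 0 => fun _ h => ltpure1 h
    | S _ => fun ic h =>
        ltextend (fun f => ltcat (ltpure1 (f 0)) (ic (f 1))) (comul h)
    end (licomul n')
  end.

Lemma icomulE n : @icomul k H n = licomul n.
Proof.
elim: n => [|[_|n IH]]; apply/funext => h.
- by rewrite /= tpureE.
- by rewrite /= tpure1E.
- rewrite -[LHS]/(textend (fun f => tcat (tpure1 (f 0)) (icomul n.+1 (f 1))) (comul h)).
  by rewrite IH textendE tcatE tpure1E.
Qed.

(* [sweedler B h] is the value B(h_(1), h_(2)). *)
Definition sweedler (W : lmodType k) (B : H -> H -> W) (h : H) : W :=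
  ltextend (fun f => B (f 0) (f 1)) (comul h).

Lemma bilin_multilin (W : lmodType k) (B : H -> H -> W) :
  bilin B -> multilin (fun f : {ffun 'I_2 -> H} => B (f 0) (f 1)).
Proof.
by case=> Bl Br f [[|[|//]] p] a x y; rewrite !ffunE /= ?(Bl _ a) ?(Br _ a).
Qed.

Lemma sweedler_linear (W : lmodType k) (B : H -> H -> W) :
  bilin B -> linear (sweedler B).
Proof.
move=> bB; apply: linear_comp; last exact: comul_linear.
by apply: ltextend_linear; exact: bilin_multilin.
Qed.

Lemma sweedler_comp (W W' : lmodType k) (l : W -> W') (B : H -> H -> W) h :
  linear l -> bilin B -> l (sweedler B h) = sweedler (fun a b => l (B a b)) h.
Proof. by move=> ll bB; apply: ltextend_comp => //; exact: bilin_multilin. Qed.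

Lemma eq_sweedler (W : lmodType k) (B B' : H -> H -> W) h :
  (forall a b, B a b = B' a b) -> sweedler B h = sweedler B' h.
Proof. by move=> e; apply: eq_ltextend. Qed.

Lemma ltcat_bilin m n (F : H -> tpow H m) (G : H -> tpow H n) :
  linear F -> linear G -> bilin (fun a b => ltcat (F a) (G b)).
Proof.
move=> lF lG; split=> [y|x].
  by apply: (linear_comp (f := fun F => ltcat F _)) => //; exact: ltcat_linear_l.
by apply: linear_comp => //; exact: ltcat_linear_r.
Qed.

(** Both sides are the values of the linear extension of [T] to [tpow H 3] on the two sides of the
    coassociativity axiom. *)
Lemma sweedlerA (W : lmodType k) (T : H -> H -> H -> W) h :
  (forall c d, linear (fun a => T a c d)) -> (forall a d, linear (fun c => T a c d)) ->
  (forall a c, linear (T a c)) ->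
  sweedler (fun a b => sweedler (fun c d => T c d b) a) h =
  sweedler (fun a b => sweedler (fun c d => T a c d) b) h.
Proof.
move=> T1 T2 T3.
pose T' (f : {ffun 'I_3 -> H}) := T (f 0) (f 1) (f ord_max).
have mT : multilin T'.
  by move=> f [[|[|[|//]]] p] a x y; rewrite /T' !ffunE /= ?(T1 _ _ a) ?(T2 _ _ a) ?(T3 _ _ a).
have El (F : tpow H 2) b :
    ltextend T' (ltcat F (ltpure1 b) : tpow H 3) = ltextend (fun f => T (f 0) (f 1) b) F.
  apply: etrans (ltextend_catl (m := 2) (n := 1) F _ mT) _.
  apply: eq_ltextend => f; rewrite /T'.
  have -> : (0 : 'I_3) = lshift 1 (0 : 'I_2) by exact: val_inj.
  have -> : (1 : 'I_3) = lshift 1 (1 : 'I_2) by exact: val_inj.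
  have -> : (ord_max : 'I_3) = rshift 2 (0 : 'I_1) by exact: val_inj.
  by rewrite !(catfl (m := 2)) (catfr (m := 2)) ffunE.
have Er (F : tpow H 2) b :
    ltextend T' (ltcat (ltpure1 b) F : tpow H 3) = ltextend (fun f => T b (f 0) (f 1)) F.
  apply: etrans (ltextend_catr (m := 1) (n := 2) _ F mT) _.
  apply: eq_ltextend => f; rewrite /T'.
  have -> : (0 : 'I_3) = lshift 2 (0 : 'I_1) by exact: val_inj.
  have -> : (1 : 'I_3) = rshift 1 (0 : 'I_2) by exact: val_inj.
  have -> : (ord_max : 'I_3) = rshift 1 (1 : 'I_2) by exact: val_inj.
  by rewrite (catfl (m := 1)) !(catfr (m := 1)) ffunE.
have ll := ltextend_linear mT.
have bl : bilin (fun a b => ltcat (comul a) (ltpure1 b) : tpow H 3).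
  by apply: (@ltcat_bilin 2 1); [exact: comul_linear|exact: ltpure1_linear].
have br : bilin (fun a b => ltcat (ltpure1 a) (comul b) : tpow H 3).
  by apply: (@ltcat_bilin 1 2); [exact: ltpure1_linear|exact: comul_linear].
transitivity (ltextend T' (sweedler (fun a b => ltcat (comul a) (ltpure1 b) : tpow H 3) h)).
  by rewrite (sweedler_comp h ll bl); apply: eq_sweedler => a b; rewrite El.
rewrite {1}/sweedler comulAE -[ltextend _ (comul h)]/(sweedler (fun a b => ltcat (ltpure1 a) (comul b) : tpow H 3) h).
by rewrite (sweedler_comp h ll br); apply: eq_sweedler => a b; rewrite Er.
Qed.

Lemma licomul_linear n : linear (@licomul n).
Proof.
elim: n => [|[_|n IH]].
- by move=> a x y; rewrite /= counit_linear scalerDl scalerA.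
- exact: ltpure1_linear.
apply: (sweedler_linear (B := fun a b => ltcat (ltpure1 a) (licomul n.+1 b))); split.
- by move=> y; apply: (linear_comp (f := fun F => ltcat F _)); [exact: ltcat_linear_l|exact: ltpure1_linear].
- by move=> x; apply: linear_comp; [exact: ltcat_linear_r|exact: IH].
Qed.

(** Coassociativity in blocks, by induction on the first block: [sweedlerA] moves the factor split
    off by the definition past the cut between the blocks. A first block of length 1 with an empty
    second block is the counit axiom. *)
Lemma licomul_cat m n (h : H) :
  licomul (m.+1 + n) h = sweedler (fun a b => ltcat (licomul m.+1 a) (licomul n b)) h.
Proof.
elim: m h => [h|m IH h].
  case: n => [|n] //.
  rewrite -[licomul _ h]/(ltpure1 h) -{1}[h]counitrE.
  rewrite -/(sweedler (fun a b => counit b *: a) h) sweedler_comp.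
  - apply: eq_sweedler => a b /=; rewrite (linZ (@ltpure1_linear k H)) (linZ (@ltcat_linear_r k H 1 0 _)).
    congr (_ *: _); rewrite (ltcat_pure (m := 1) (n := 0)); congr ltpure; apply: (catfP (m := 1)) => [i|[]//].
    by rewrite !ffunE.
  - exact: ltpure1_linear.
  - split=> [y|x]; first by move=> u a b; rewrite scalerDr !scalerA mulrC.
    by move=> u a b; rewrite counit_linear scalerDl scalerA.
rewrite -[LHS]/(sweedler (fun a b => ltcat (ltpure1 a) (licomul (m.+1 + n) b)) h).
have bT := @ltcat_bilin 1 m.+1 _ _ (@ltpure1_linear k H) (@licomul_linear m.+1).
have L1 a : linear (fun G : tpow H (m.+1 + n) => ltcat (ltpure1 a) G : tpow H (m.+2 + n)).
  exact: (@ltcat_linear_r k H 1 (m.+1 + n)).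
transitivity (sweedler (fun a b => sweedler (fun c d =>
    ltcat (ltcat (ltpure1 a) (licomul m.+1 c) : tpow H m.+2) (licomul n d)) b) h).
  apply: eq_sweedler => a b; rewrite IH (sweedler_comp _ (L1 a)).
    by apply: eq_sweedler => c d; rewrite (ltcatA1 (n := m.+1)).
  by apply: ltcat_bilin; exact: licomul_linear.
rewrite -(sweedlerA (T := fun a c d => ltcat (ltcat (ltpure1 a) (licomul m.+1 c) : tpow H m.+2) (licomul n d))).
- apply: eq_sweedler => a b.
  rewrite -(sweedler_comp (l := fun F : tpow H m.+2 => ltcat F (licomul n b))) //.
  exact: ltcat_linear_l.
- by move=> c d; apply: (linear_comp (f := fun F : tpow H m.+2 => ltcat F _)); [exact: ltcat_linear_l|exact: (proj1 bT c)].
- by move=> a d; apply: (linear_comp (f := fun F : tpow H m.+2 => ltcat F _)); [exact: ltcat_linear_l|exact: (proj2 bT a)].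
- by move=> a c; apply: linear_comp; [exact: ltcat_linear_r|exact: licomul_linear].
Qed.

Lemma licomul2 (h : H) : licomul 2 h = comul h.
Proof.
have m2 := bilin_multilin (@ltcat_bilin 1 1 _ _ (@ltpure1_linear k H) (@ltpure1_linear k H)).
rewrite -[LHS]/(ltextend (fun f : {ffun 'I_2 -> H} => ltcat (ltpure1 (f 0)) (ltpure1 (f 1)) : tpow H 2) (comul h)).
move: (comul h); apply: (@tpow_ext k H 2 (tpow H 2)) => //.
  exact: ltextend_linear.
move=> t; rewrite ltextend_pure // (ltcat_pure (m := 1) (n := 1)); congr ltpure.
by apply/esym/(catfP (m := 1) (n := 1)) => i; rewrite !ffunE ord1; congr (t _); exact: val_inj.
Qed.

Lemma licomul1E n : licomul n (1 : H) = ltpure [ffun=> 1].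
Proof.
elim: n => [|[_|n IH]] //; first by rewrite /= counit1 scale1r.
have bB : bilin (fun a b : H => ltcat (ltpure1 a) (licomul n.+1 b)).
  exact: (@ltcat_bilin 1 n.+1 _ _ (@ltpure1_linear k H) (@licomul_linear n.+1)).
rewrite -[LHS]/(sweedler (fun a b => ltcat (ltpure1 a) (licomul n.+1 b)) 1) /sweedler comul1E.
rewrite (ltextend_pure (bilin_multilin bB)) !ffunE IH (ltcat_pure (m := 1)); congr ltpure.
by apply/esym/(catfP (m := 1)) => i; rewrite !ffunE.
Qed.

Lemma ltextend_mul n (W : nat) (Phi : {ffun 'I_n -> H} -> tpow H W) (F G : tpow H n) :
  multilin Phi -> (forall f g : {ffun 'I_n -> H}, Phi [ffun i => f i * g i] = ltmul (Phi f) (Phi g)) ->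
  ltextend Phi (ltmul F G) = ltmul (ltextend Phi F) (ltextend Phi G).
Proof.
move=> mP PM; have lP := ltextend_linear mP.
move: F; apply: (@tpow_ext k H n (tpow H _)).
- by apply: linear_comp => //; exact: ltmul_linear_l.
- by apply: (linear_comp (f := fun F => ltmul F _)) => //; exact: ltmul_linear_l.
move=> f; move: G; apply: (@tpow_ext k H n (tpow H _)).
- by apply: linear_comp => //; exact: ltmul_linear_r.
- by apply: linear_comp => //; exact: ltmul_linear_r.
by move=> g; rewrite ltmul_pure !ltextend_pure.
Qed.

Lemma ltpure1M (a b : H) : ltpure1 (a * b) = ltmul (ltpure1 a) (ltpure1 b).
Proof. by rewrite ltmul_pure; congr ltpure; apply/ffunP => i; rewrite !ffunE. Qed.

Lemma licomulM n (g h : H) : licomul n (g * h) = ltmul (licomul n g) (licomul n h).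
Proof.
elim: n g h => [g h|[_ g h|n IH g h]].
- have E x : licomul 0 x = counit x *: ltpure [ffun=> 1] :> tpow H 0 by [].
  by rewrite !E counitM ltmulZl ltmulZr ltmul1 scalerA.
- exact: ltpure1M.
have bB := @ltcat_bilin 1 n.+1 _ _ (@ltpure1_linear k H) (@licomul_linear n.+1).
pose Phi (f : {ffun 'I_2 -> H}) : tpow H n.+2 := ltcat (ltpure1 (f 0)) (licomul n.+1 (f 1)).
have E x : licomul n.+2 x = ltextend Phi (comul x) by [].
rewrite !E comulME ltextend_mul //; first exact: (bilin_multilin bB).
by move=> f f'; rewrite /Phi !ffunE ltpure1M IH (ltmul_tcat (m := 1)).
Qed.

(** * Invariance of the iterated comultiplication under permutations *)

Section Cocommutativity.

Let fixes n (s : 'S_n) := forall h : H, ltreindex s (licomul n h) = licomul n h.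

Let fixesM n (s t : 'S_n) : fixes s -> fixes t -> fixes (s * t)%g.
Proof.
move=> fs ft h; rewrite -[RHS]fs -[in RHS]ft ltreindex_comp; try exact: perm_inj.
by apply: eq_ltreindex => i; rewrite permM.
Qed.

(** At position 0 the first two factors split off as a single comultiplication, to which
    cocommutativity applies. At a later position the first factor splits off unchanged and induction
    handles the rest. *)
Let fixes_adj n (i j : 'I_n) : j = i.+1 :> nat -> fixes (tperm i j).
Proof.
elim: n i j => [[]//|[_ i j|n IH i j] ij h]; first by move: ij; rewrite !ord1.
have [i0|i0] := posnP i.
  have bB := @ltcat_bilin 2 n _ _ (@licomul_linear 2) (@licomul_linear n).
  rewrite (@licomul_cat 1 n) (sweedler_comp _ (ltreindex_linear (@perm_inj _ (tperm i j))) bB).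
  apply: eq_sweedler => a b.
  have ei : i = lshift n (0 : 'I_2) by exact: val_inj.
  have ej : j = lshift n (1 : 'I_2) by apply: val_inj; rewrite /= ij i0.
  have Hl (l : 'I_2) : tperm i j (lshift n l) = lshift n (tperm 0 1 l).
    by rewrite ei ej (inj_tperm _ _ _ (@lshift_inj 2 n)).
  have Hr (l : 'I_n) : tperm i j (rshift 2 l) = rshift 2 l by rewrite ei ej tpermD // eq_lrshift.
  apply: etrans.
    exact: (@ltreindex_tcat k H 2 n _ _ id (@perm_inj _ _) (@perm_inj _ _) (@inj_id _) Hl Hr).
  by rewrite ltreindex_id licomul2 comulCE.
have pos (l : 'I_n.+2) : (0 < l)%N -> exists l', l = rshift 1 l' :> 'I_n.+2.
  by case: l => [[|l] Hl] // _; exists (Ordinal (Hl : (l < n.+1)%N)); exact: val_inj.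
have [i' ei] := pos i i0.
have [j' ej] : exists j', j = rshift 1 j' :> 'I_n.+2 by apply: pos; rewrite ij.
have ij' : j' = i'.+1 :> nat by move: ij; rewrite ei ej /=; lia.
have bB := @ltcat_bilin 1 n.+1 _ _ (@licomul_linear 1) (@licomul_linear n.+1).
rewrite (@licomul_cat 0 n.+1) (sweedler_comp _ (ltreindex_linear (@perm_inj _ (tperm i j))) bB).
have Hl (l : 'I_1) : tperm i j (lshift n.+1 l) = lshift n.+1 l by rewrite ei ej tpermD // (eq_rlshift (m := 1)).
have Hr (l : 'I_n.+1) : tperm i j (rshift 1 l) = rshift 1 (tperm i' j' l).
  by rewrite ei ej (inj_tperm _ _ _ (@rshift_inj 1 n.+1)).
apply: (@eq_sweedler (tpow H n.+2)) => a b; apply: etrans.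
  exact: (@ltreindex_tcat k H 1 n.+1 _ id _ (@perm_inj _ _) (@inj_id _) (@perm_inj _ _) Hl Hr).
by rewrite ltreindex_id IH.
Qed.

(** Induction on the distance: the transposition of [i] and [j] is that of [i] and [j - 1]
    conjugated by an adjacent one. *)
Let fixes_tperm n (i j : 'I_n) : fixes (tperm i j).
Proof.
wlog ij : i j / (i < j)%N.
  move=> W; have [|ji|/val_inj ->] := ltngtP i j; first exact: W.
    by rewrite tpermC; exact: W.
  by rewrite tperm1 => h; rewrite -[RHS]ltreindex_id; apply: eq_ltreindex => l; rewrite perm1.
have [d] : exists d, j = (i + d).+1 :> nat by exists (j - i).-1; rewrite -addnS prednK ?subn_gt0 // subnKC // ltnW.
elim: d j {ij} => [|d IH] j jE; first by apply: fixes_adj; rewrite jE addn0.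
have Hj : (j.-1 < n)%N by apply: leq_ltn_trans (ltn_ord j); exact: leq_pred.
pose j' := Ordinal Hj.
have jj' : j = j'.+1 :> nat by rewrite /= jE.
have f1 := fixes_adj jj'.
have f2 : fixes (tperm i j') by apply: IH; rewrite /= jE addnS.
have -> : tperm i j = (tperm j' j * (tperm i j' * tperm j' j))%g.
  rewrite -[X in (X * _)%g]tpermV -/((tperm i j') ^ (tperm j' j))%g tpermJ tpermL tpermD //.
    by rewrite -val_eqE /= jE /=; apply/eqP; lia.
  by rewrite -val_eqE /= jE /=; apply/eqP; lia.
exact: fixesM f1 (fixesM f2 f1).
Qed.

(** Transpositions generate the symmetric group. This invariance is the balance condition that lets
    permutations of factors act on [htens], see [lhreindex_balanced]. *)
Lemma licomul_reindex n (s : 'I_n -> 'I_n) : injective s ->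
  forall h : H, ltreindex s (licomul n h) = licomul n h.
Proof.
move=> si h; have -> : s = perm si by apply/funext => i; rewrite permE.
move: h; have [ts -> _] := prod_tpermP (perm si).
elim: ts => [|t ts IH].
  rewrite big_nil => h; rewrite -[RHS]ltreindex_id; apply: eq_ltreindex => l.
  by rewrite perm1.
by rewrite big_cons; exact: fixesM (fixes_tperm _ _) IH.
Qed.
End Cocommutativity.
End Comultiplication.

(** * Tensor products over H *)

Section LinExt.
Variables (k : fieldType) (B : choiceType) (rel : set {malg k[B]}).
Implicit Types W : lmodType k.

(** The value is a finite sum over one fixed representative, hence linear in the function being
    extended, whether or not this function respects the relations. *)
Lemma pextDZ W a (g h : B -> W) (w : presented rel) :
  pext (fun b => a *: g b + h b) w = a *: pext g w + pext h w.
Proof.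
rewrite /pext /lin_ext scaler_sumr -big_split; apply: eq_bigr => b _ /=.
by rewrite scalerDr !scalerA mulrC.
Qed.

Lemma pext_comp W W' (l : W -> W') (g : B -> W) (w : presented rel) :
  linear l -> l (pext g w) = pext (fun b => l (g b)) w.
Proof.
move=> ll; rewrite /pext /lin_ext (lin_sum ll).
by apply: eq_bigr => b _; rewrite (linZ ll).
Qed.
End LinExt.

Section Balanced.
Variables (k : fieldType) (H : cocommHopfType k) (Z : lmodType H) (n : nat).

(** The counterpart of [multilin] for [htens]: one field for each constructor of [htens_rel]. *)
Record balanced (W : lmodType k) (g : tpow H n -> Z -> W) : Prop := Balanced {
  balancedl : forall z, linear (g^~ z);
  balancedr : forall F y z, g F (y + z) = g F y + g F z;
  balancedH : forall F h z, g (ltmul F (licomul n h)) z = g F (h *: z)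
}.

Section Extension.
Variables (W : lmodType k) (g : tpow H n -> Z -> W).
Hypothesis bg : balanced g.

Let g_rel r : @htens_rel k H Z n r -> lin_ext (fun Fz => g Fz.1 Fz.2) r = 0.
Proof.
case=> [a F G z|F y z|F h z].
- by rewrite lin_ext_combination; apply/eqP; rewrite subr_eq0; apply/eqP; exact: balancedl.
- by rewrite lin_ext_sum; apply/eqP; rewrite subr_eq0; apply/eqP; exact: balancedr.
- rewrite lin_ext_difference; apply/eqP; rewrite subr_eq0; apply/eqP.
  by rewrite tmulE icomulE; exact: balancedH.
Qed.

Lemma hextend_pure F z : hextend g (hpure F z) = g F z.
Proof. exact: pext_gen g_rel (F, z). Qed.

Lemma hextend_linear : linear (hextend g).
Proof. exact: pext_is_linear g_rel. Qed.
End Extension.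

Lemma hpure_balanced : balanced (@hpure k H Z n).
Proof.
split=> [z a F G|F y z|F h z]; apply/eqP; rewrite -subr_eq0; apply/eqP.
- by have := pgen_rel (HtensLinl a F G z); rewrite lin_ext_combination.
- by have := pgen_rel (HtensAddr F y z); rewrite lin_ext_sum.
- by have := pgen_rel (HtensBal F h z); rewrite lin_ext_difference tmulE icomulE.
Qed.
End Balanced.

HB.lock Definition lhpure (k : fieldType) (H : cocommHopfType k) (Z : lmodType H) n
  (F : tpow H n) (z : Z) : htens Z n := hpure F z.
HB.lock Definition lhextend (k : fieldType) (H : cocommHopfType k) (Z : lmodType H) n
  (W : lmodType k) (g : tpow H n -> Z -> W) : htens Z n -> W := hextend g.

Section HTens.
Variables (k : fieldType) (H : cocommHopfType k).

Lemma licomul_scalar n (a : k) : licomul n (a%:A : H) = a *: ltpure [ffun=> 1].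
Proof. by rewrite (linZ (@licomul_linear k H n)) licomul1E. Qed.

Section OneModule.
Variables (Z : lmodType H) (n : nat).

Lemma hpureE : @hpure k H Z n = @lhpure k H Z n.
Proof. by apply/funext => F; apply/funext => z; rewrite lhpure.unlock. Qed.
Lemma hextendE (W : lmodType k) : @hextend k H Z n W = @lhextend k H Z n W.
Proof. by apply/funext => g; rewrite lhextend.unlock. Qed.

Lemma lhpure_balanced : balanced (@lhpure k H Z n).
Proof. by rewrite -hpureE; exact: hpure_balanced. Qed.

Section Extension.
Variables (W : lmodType k) (g : tpow H n -> Z -> W).
Hypothesis bg : balanced g.

Lemma lhextend_pure F z : lhextend g (lhpure F z) = g F z.
Proof. by rewrite -hextendE -hpureE hextend_pure. Qed.

Lemma lhextend_linear : linear (lhextend g).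
Proof. by rewrite -hextendE; exact: hextend_linear. Qed.

(** The scalar [a] acts on Z through H, and its iterated coproduct is [a] times the unit tensor, so
    it can be moved to the other factor. *)
Lemma balanced_scalar F (a : k) z : g F (a%:A *: z) = a *: g F z.
Proof. by rewrite -(balancedH bg) licomul_scalar ltmulZr ltmul1 (linZ (balancedl bg z)). Qed.
End Extension.

Lemma lhpure_linear z : linear (fun F : tpow H n => lhpure F z : htens Z n).
Proof. exact: balancedl lhpure_balanced z. Qed.

Lemma lhpureDr (F : tpow H n) (y z : Z) : lhpure F (y + z) = lhpure F y + lhpure F z :> htens Z n.
Proof. exact: balancedr lhpure_balanced F y z. Qed.

Lemma lhpureH (F : tpow H n) h (z : Z) :
  lhpure (ltmul F (licomul n h)) z = lhpure F (h *: z) :> htens Z n.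
Proof. exact: balancedH lhpure_balanced F h z. Qed.

Lemma htens_ext (W : lmodType k) (f g : htens Z n -> W) :
  linear f -> linear g -> (forall t z, f (lhpure (ltpure t) z) = g (lhpure (ltpure t) z)) -> f =1 g.
Proof.
move=> lf lg fg; apply: presented_ext => // -[F z].
rewrite -[pgen _ _]/(hpure F z) hpureE.
move: F; apply: (@tpow_ext k H n W (fun F => f (lhpure F z)) (fun F => g (lhpure F z))) => //.
- exact: (linear_comp lf (lhpure_linear z)).
- exact: (linear_comp lg (lhpure_linear z)).
Qed.

Lemma eq_lhextend (W : lmodType k) (g h : tpow H n -> Z -> W) w :
  (forall F z, g F z = h F z) -> lhextend g w = lhextend h w.
Proof. by move=> e; congr (lhextend _ w); apply/funext => F; apply/funext. Qed.

Lemma lhextendDZ (W : lmodType k) a (g h : tpow H n -> Z -> W) w :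
  lhextend (fun F z => a *: g F z + h F z) w = a *: lhextend g w + lhextend h w.
Proof. by rewrite -hextendE; exact: pextDZ. Qed.

Lemma lhextendD (W : lmodType k) (g h : tpow H n -> Z -> W) w :
  lhextend (fun F z => g F z + h F z) w = lhextend g w + lhextend h w.
Proof. by rewrite -[lhextend g w]scale1r -lhextendDZ; apply: eq_lhextend => F z; rewrite scale1r. Qed.

Lemma lhextend_comp (W W' : lmodType k) (l : W -> W') (g : tpow H n -> Z -> W) w :
  linear l -> l (lhextend g w) = lhextend (fun F z => l (g F z)) w.
Proof. by move=> ll; rewrite -!hextendE /hextend (pext_comp _ _ ll). Qed.

Lemma lhextend0 (W : lmodType k) w : lhextend (fun (_ : tpow H n) (_ : Z) => 0 : W) w = 0.
Proof.
have l0 : linear (fun _ : W => 0 : W) by move=> ? ? ?; rewrite scaler0 addr0.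
exact: esym (lhextend_comp (fun _ _ => 0) w l0).
Qed.

Lemma lhextend_id (W : lmodType k) (l : htens Z n -> W) w :
  linear l -> lhextend (fun F z => l (lhpure F z)) w = l w.
Proof.
move=> ll; rewrite -lhextend_comp //; congr l.
move: w; apply: htens_ext => //; first exact: lhextend_linear lhpure_balanced.
by move=> t z; rewrite (lhextend_pure lhpure_balanced).
Qed.

End OneModule.

Section OneModuleMaps.
Variables (Z : lmodType H) (n : nat).

Definition lhact (F : tpow H n) : htens Z n -> htens Z n :=
  lhextend (fun G z => lhpure (ltmul F G) z).
Definition lhreindex (s : 'I_n -> 'I_n) : htens Z n -> htens Z n :=
  lhextend (fun G z => lhpure (ltreindex s G) z).

Lemma hactE : @hact k H Z n = lhact.
Proof.
apply/funext => F; rewrite /hact hextendE; congr lhextend.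
by apply/funext => G; apply/funext => z; rewrite tmulE hpureE.
Qed.

Lemma hreindexE : @hreindex k H Z n = lhreindex.
Proof.
apply/funext => s; rewrite /hreindex hextendE; congr lhextend.
by apply/funext => G; apply/funext => z; rewrite treindexE hpureE.
Qed.

Lemma lhact_balanced (F : tpow H n) : balanced (fun G z => lhpure (ltmul F G) z : htens Z n).
Proof.
split=> [z|G y z|G h z].
- exact: (linear_comp (@lhpure_linear Z n z) (ltmul_linear_r F)).
- by rewrite lhpureDr.
- by rewrite ltmulA lhpureH.
Qed.

Lemma lhact_linear F : linear (lhact F).
Proof. exact: lhextend_linear (lhact_balanced F). Qed.

Lemma lhact_pure F G z : lhact F (lhpure G z) = lhpure (ltmul F G) z :> htens Z n.
Proof. exact: lhextend_pure (lhact_balanced F) _ _. Qed.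

Lemma lhreindex_balanced (s : 'I_n -> 'I_n) : injective s ->
  balanced (fun G z => lhpure (ltreindex s G) z : htens Z n).
Proof.
move=> si; split=> [z|G y z|G h z].
- exact: (linear_comp (@lhpure_linear Z n z) (ltreindex_linear si)).
- by rewrite lhpureDr.
- by rewrite ltreindexM // licomul_reindex // lhpureH.
Qed.

Lemma lhreindex_linear (s : 'I_n -> 'I_n) : injective s -> linear (@lhreindex s).
Proof. by move=> si; exact: lhextend_linear (lhreindex_balanced si). Qed.

Lemma lhreindex_pure (s : 'I_n -> 'I_n) F z : injective s ->
  lhreindex s (lhpure F z) = lhpure (ltreindex s F) z :> htens Z n.
Proof. by move=> si; exact: lhextend_pure (lhreindex_balanced si) _ _. Qed.

Lemma eq_lhreindex (s t : 'I_n -> 'I_n) : s =1 t -> @lhreindex s =1 lhreindex t.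
Proof. by move=> /funext ->. Qed.

Lemma lhreindex_comp (s t : 'I_n -> 'I_n) w : injective s -> injective t ->
  lhreindex s (lhreindex t w) = lhreindex (t \o s) w :> htens Z n.
Proof.
move=> si ti; have sti := inj_comp ti si.
move: w; apply: (@htens_ext Z n (htens Z n)); [|exact: lhreindex_linear|].
  by apply: linear_comp; exact: lhreindex_linear.
by move=> f z; rewrite !lhreindex_pure // ltreindex_comp.
Qed.

Lemma lhreindex_id w : lhreindex id w = w :> htens Z n.
Proof.
move: w; apply: (@htens_ext Z n (htens Z n)) => //; first exact: lhreindex_linear.
by move=> f z; rewrite lhreindex_pure // ltreindex_id.
Qed.

Lemma lhreindex_hact (s : 'I_n -> 'I_n) F w : injective s ->
  lhreindex s (lhact F w) = lhact (ltreindex s F) (lhreindex s w) :> htens Z n.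
Proof.
move=> si; move: w; apply: (@htens_ext Z n (htens Z n)).
- by apply: linear_comp; [exact: lhreindex_linear|exact: lhact_linear].
- by apply: linear_comp; [exact: lhact_linear|exact: lhreindex_linear].
by move=> f z; rewrite !(lhreindex_pure, lhact_pure) // ltreindexM.
Qed.

End OneModuleMaps.

Section Hmap.
Variables (Y Z : lmodType H) (n : nat).

Definition lhmap (phi : Y -> Z) : htens Y n -> htens Z n :=
  lhextend (fun F y => lhpure F (phi y)).

Lemma hmapE : @hmap k H Y Z n = lhmap.
Proof.
apply/funext => phi; rewrite /hmap hextendE; congr lhextend.
by apply/funext => F; rewrite hpureE.
Qed.

Lemma lhmap_balanced (phi : {linear Y -> Z}) : balanced (fun F y => lhpure F (phi y) : htens Z n).
Proof.
split=> [y|F x y|F h y].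
- exact: lhpure_linear.
- by rewrite linearD lhpureDr.
- by rewrite linearZ lhpureH.
Qed.

Lemma lhmap_linear (phi : {linear Y -> Z}) : linear (lhmap phi).
Proof. exact: lhextend_linear (lhmap_balanced phi). Qed.

Lemma lhmap_pure (phi : {linear Y -> Z}) F y : lhmap phi (lhpure F y) = lhpure F (phi y) :> htens Z n.
Proof. exact: lhextend_pure (lhmap_balanced phi) _ _. Qed.

Lemma lhmap_hact (phi : {linear Y -> Z}) F (w : htens Y n) :
  lhmap phi (lhact F w) = lhact F (lhmap phi w).
Proof.
move: w; apply: (@htens_ext Y n (htens Z n)).
- by apply: linear_comp; [exact: lhmap_linear|exact: lhact_linear].
- by apply: linear_comp; [exact: lhact_linear|exact: lhmap_linear].
by move=> f z; rewrite !(lhmap_pure, lhact_pure).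
Qed.

Lemma lhmap_hreindex (phi : {linear Y -> Z}) (s : 'I_n -> 'I_n) (w : htens Y n) : injective s ->
  lhmap phi (lhreindex s w) = lhreindex s (lhmap phi w).
Proof.
move=> si; move: w; apply: (@htens_ext Y n (htens Z n)).
- by apply: linear_comp; [exact: lhmap_linear|exact: lhreindex_linear].
- by apply: linear_comp; [exact: lhreindex_linear|exact: lhmap_linear].
by move=> f z; rewrite !(lhmap_pure, lhreindex_pure).
Qed.

Lemma eq_lhmap (phi psi : Y -> Z) (w : htens Y n) : phi =1 psi -> lhmap phi w = lhmap psi w.
Proof. by move=> /funext ->. Qed.
End Hmap.

Lemma lhmap_comp (X Y Z : lmodType H) n (psi : {linear Y -> Z}) (phi : {linear X -> Y}) (w : htens X n) :
  lhmap psi (lhmap phi w) = lhmap (psi \o phi) w.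
Proof.
move: w; apply: (@htens_ext X n (htens Z n)); [|exact: (lhmap_linear (psi \o phi)%R)|].
  by apply: linear_comp; exact: lhmap_linear.
by move=> f z; rewrite !lhmap_pure.
Qed.

Lemma lhmap_id (Z : lmodType H) n (w : htens Z n) : lhmap id w = w.
Proof.
move: w; apply: (@htens_ext Z n (htens Z n)) => //; first exact: (lhmap_linear idfun).
by move=> f z; exact: (lhmap_pure idfun).
Qed.

(** * Expanding the first factor of a tensor by the comultiplication *)

Section Insertion.
Variables (Z : lmodType H) (m n : nat).
Implicit Types F : tpow H m.+1.

Let ins F (t : {ffun 'I_n.+1 -> H}) : tpow H (m.+1 + n) :=
  ltcat (ltmul F (licomul m.+1 (t ord0))) (ltpure [ffun i => t (lift ord0 i)]).

Let ins_multilin F : multilin (ins F).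
Proof.
apply/multilinP => t i; have [j ->|->] := unliftP ord0 i.
  have E x : ins F (ffupd t (lift ord0 j) x) =
      ltcat (ltmul F (licomul m.+1 (t ord0))) (ltpure (ffupd [ffun i => t (lift ord0 i)] j x)).
    rewrite /ins ffunE eq_sym; congr (ltcat _ (ltpure _)).
    by apply/ffunP => l; rewrite !ffunE (inj_eq (@lift_inj _ _)).
  by move=> a x y; rewrite !E ltpure_multilin ltcat_linear_r.
have E x : ins F (ffupd t ord0 x) =
    ltcat (ltmul F (licomul m.+1 x)) (ltpure [ffun i => t (lift ord0 i)]).
  rewrite /ins ffunE eqxx; congr (ltcat _ (ltpure _)).
  by apply/ffunP => l; rewrite !ffunE.
by move=> a x y; rewrite !E licomul_linear ltmul_linear_r ltcat_linear_l.
Qed.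

(** Expanding the first factor of an iterated coproduct yields a longer iterated coproduct, by
    [licomul_cat]. With [ins_tmul] this makes insertion balanced over H. *)
Let ins_icomul (h : H) : ltextend (ins (ltpure [ffun=> 1])) (licomul n.+1 h) = licomul (m.+1 + n) h.
Proof.
have le := ltextend_linear (ins_multilin (ltpure [ffun=> 1])).
have bB := @ltcat_bilin k H 1 n _ _ (@licomul_linear k H 1) (@licomul_linear k H n).
rewrite -[licomul n.+1 h]/(licomul (1 + n) h) licomul_cat (sweedler_comp h le bB) licomul_cat.
apply: eq_sweedler => a b; move: (licomul n b).
apply: (@tpow_ext k H n (tpow H (m.+1 + n)) (fun G => ltextend _ (ltcat (ltpure1 a) G : tpow H (1 + n)))).
- by apply: linear_comp => //; exact: (@ltcat_linear_r k H 1 n).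
- exact: ltcat_linear_r.
move=> g; rewrite (@ltcat_pure k H 1 n) ltextend_pure // /ins; congr (ltcat _ (ltpure _)).
  have -> : (ord0 : 'I_n.+1) = lshift n (0 : 'I_1) by exact: val_inj.
  by rewrite (@catfl _ _ 1 n) ffunE ltmul1l.
apply/ffunP => i; rewrite ffunE.
have -> : lift ord0 i = rshift 1 i :> 'I_(1 + n) by exact: val_inj.
by rewrite (@catfr _ _ 1 n).
Qed.

(** The iterated comultiplication is multiplicative, so the right factor [L] comes out with the unit
    inserted and [F] stays with [K]. *)
Let ins_tmul F K L :
  ltextend (ins F) (ltmul K L) = ltmul (ltextend (ins F) K) (ltextend (ins (ltpure [ffun=> 1])) L).
Proof.
have lF := ltextend_linear (ins_multilin F).
have l1 := ltextend_linear (ins_multilin (ltpure [ffun=> 1])).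
move: K; apply: (@tpow_ext k H n.+1 (tpow H _)).
- exact: (linear_comp lF (ltmul_linear_l L)).
- exact: (linear_comp (ltmul_linear_l _) lF).
move=> f; move: L; apply: (@tpow_ext k H n.+1 (tpow H _)).
- exact: (linear_comp lF (ltmul_linear_r _)).
- exact: (linear_comp (ltmul_linear_r _) l1).
move=> g; rewrite ltmul_pure !ltextend_pure // /ins ltmul_tcat ltmul_pure.
rewrite ltmul1l ffunE licomulM ltmulA; congr (ltcat _ (ltpure _)).
by apply/ffunP => i; rewrite !ffunE.
Qed.

Definition linsl F : htens Z n.+1 -> htens Z (m.+1 + n) :=
  lhextend (fun K e => lhpure (ltextend (ins F) K) e).

Lemma inslE F : @insl k H Z m n F = linsl F.
Proof.
rewrite /insl hextendE; congr lhextend; apply/funext => K; apply/funext => e.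
rewrite hpureE textendE; congr (lhpure (ltextend _ _) _); apply/funext => t.
by rewrite tcatE tmulE icomulE tpureE.
Qed.

Lemma linsl_balanced F : balanced (fun K e => lhpure (ltextend (ins F) K) e : htens Z (m.+1 + n)).
Proof.
have lF := ltextend_linear (ins_multilin F).
split=> [z|K y z|K h z].
- exact: (linear_comp (@lhpure_linear Z _ z) lF).
- by rewrite lhpureDr.
- by rewrite ins_tmul ins_icomul lhpureH.
Qed.

Lemma linsl_linear F : linear (linsl F).
Proof. exact: lhextend_linear (linsl_balanced F). Qed.

Lemma linsl_pure F t z : linsl F (lhpure (ltpure t) z) =
  lhpure (ltcat (ltmul F (licomul m.+1 (t ord0))) (ltpure [ffun i => t (lift ord0 i)])) z
  :> htens Z (m.+1 + n).
Proof. by rewrite /linsl (lhextend_pure (linsl_balanced F)) ltextend_pure. Qed.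

Lemma linsl_linear_l (w : htens Z n.+1) : linear (fun F => linsl F w).
Proof.
move=> a F G; move: w; apply: (@htens_ext Z n.+1 (htens Z (m.+1 + n))).
- exact: linsl_linear.
- by apply: linear_add; [apply: linear_scale|]; exact: linsl_linear.
move=> t z; rewrite !linsl_pure ltmul_linear_l ltcat_linear_l.
exact: (balancedl (lhpure_balanced Z (m.+1 + n))).
Qed.

(** The factor of [f] in slot 0 is absorbed into [F] through the comultiplication, the other factors
    act from outside. This is the source of the balance condition for compositions of maps. *)
Lemma linsl_hact F (f : {ffun 'I_n.+1 -> H}) (w : htens Z n.+1) :
  linsl F (lhact (ltpure f) w) =
  lhact (ltcat (ltpure [ffun=> 1]) (ltpure [ffun i => f (lift ord0 i)]))
    (linsl (ltmul F (licomul m.+1 (f ord0))) w).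
Proof.
move: w; apply: (@htens_ext Z n.+1 (htens Z (m.+1 + n))).
- by apply: linear_comp; [exact: linsl_linear|exact: lhact_linear].
- by apply: linear_comp; [exact: lhact_linear|exact: linsl_linear].
move=> t z; rewrite lhact_pure ltmul_pure !linsl_pure lhact_pure ltmul_tcat ltmul1l ltmul_pure.
rewrite ffunE licomulM ltmulA; congr (lhpure (ltcat _ (ltpure _)) _).
by apply/ffunP => i; rewrite !ffunE.
Qed.

(** The iterated coproduct inserted in the first block is permutation invariant, so a permutation of
    that block falls entirely on [F]. *)
Lemma linsl_hreindex F (s : 'I_(m.+1 + n) -> 'I_(m.+1 + n)) (s' : 'I_m.+1 -> 'I_m.+1) (w : htens Z n.+1) :
  injective s -> injective s' ->
  (forall i, s (lshift n i) = lshift n (s' i)) ->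
  (forall i, s (rshift m.+1 i) = rshift m.+1 i) ->
  lhreindex s (linsl F w) = linsl (ltreindex s' F) w.
Proof.
move=> si si' sl sr; move: w; apply: (@htens_ext Z n.+1 (htens Z (m.+1 + n))).
- by apply: linear_comp; [exact: lhreindex_linear|exact: linsl_linear].
- exact: linsl_linear.
move=> t z; rewrite !linsl_pure lhreindex_pure // (ltreindex_tcat (s1 := s') (s2 := id)) //.
by rewrite ltreindex_id ltreindexM // licomul_reindex.
Qed.

End Insertion.
End HTens.

(** * Compositions of pseudobilinear maps *)

Section Pseudobilinear.
Variables (k : fieldType) (H : cocommHopfType k).

Lemma lhact1 (Z : lmodType H) n (w : htens Z n) : lhact (ltpure [ffun=> 1]) w = w.
Proof.
move: w; apply: (@htens_ext k H Z n (htens Z n)) => //; first exact: lhact_linear.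
by move=> f z; rewrite lhact_pure ltmul1l.
Qed.

Section Swap.
Variables (Z : lmodType H) (n : nat).

Lemma sigma12E : @sigma12 k H Z n = lhreindex (tperm 0 1).
Proof. by rewrite /sigma12 hreindexE. Qed.

Lemma lhreindexK (s t : 'I_n -> 'I_n) (w : htens Z n) : injective s -> injective t ->
  cancel s t -> lhreindex s (lhreindex t w) = w.
Proof.
by move=> si ti st; rewrite lhreindex_comp // -[RHS]lhreindex_id; apply: eq_lhreindex => i /=.
Qed.
End Swap.

Lemma swapK (Z : lmodType H) n (w : htens Z n.+2) :
  lhreindex (tperm 0 1) (lhreindex (tperm 0 1) w) = w.
Proof. by apply: lhreindexK; [exact: perm_inj|exact: perm_inj|exact: tpermK]. Qed.

Lemma swap_linear (Z : lmodType H) n : linear (@lhreindex k H Z n.+2 (tperm 0 1)).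
Proof. exact: lhreindex_linear (@perm_inj _ _). Qed.

Section InsertRight.
Variable Z : lmodType H.
Variable F : tpow H 2.

Let ins (t : {ffun 'I_2 -> H}) : tpow H 3 := ltcat (ltpure1 (t 0)) (ltmul F (comul (t 1))).

Definition linsr : htens Z 2 -> htens Z 3 := lhextend (fun K e => lhpure (ltextend ins K) e).

Lemma insrE : @insr k H Z F = linsr.
Proof.
rewrite /insr hextendE; congr lhextend; apply/funext => K; apply/funext => e.
rewrite hpureE textendE; congr (lhpure (ltextend _ _) _); apply/funext => t.
by rewrite tcatE tmulE tpure1E.
Qed.

Let ins_multilin : multilin ins.
Proof.
apply: (bilin_multilin (B := fun a b => ltcat (ltpure1 a) (ltmul F (comul b)) : tpow H 3)).
apply: (@ltcat_bilin k H 1 2); first exact: ltpure1_linear.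
exact: (linear_comp (ltmul_linear_r F) (@comul_linear k H)).
Qed.

Let ltcat_rotate (G : tpow H 2) (a : H) :
  ltreindex (@ord_pred 3) (ltcat G (ltpure1 a) : tpow H 3) = ltcat (ltpure1 a) G.
Proof.
move: G; apply: (@tpow_ext k H 2 (tpow H 3)).
- exact: (linear_comp (ltreindex_linear (@ord_pred_inj 3)) (@ltcat_linear_l _ _ 2 1 _)).
- exact: (@ltcat_linear_r _ _ 1 2).
move=> f; rewrite (@ltcat_pure _ _ 2 1) (@ltcat_pure _ _ 1 2) ltreindex_pure; last exact: ord_pred_inj.
congr ltpure; apply: (@catfP _ _ 1 2) => i; rewrite ffunE.
  have -> : ord_pred (lshift 2 i : 'I_3) = rshift 2 (0 : 'I_1) by apply: val_inj; rewrite /= ord1.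
  by rewrite (@catfr _ _ 2 1) !ffunE.
have -> : ord_pred (rshift 1 i : 'I_3) = lshift 1 i.
  by apply: val_inj; case: i => [[|[|//]] p].
by rewrite (@catfl _ _ 2 1).
Qed.

(** The swap brings the factor to be expanded to the front, where [linsl] expands it; the rotation
    then returns the untouched factor from the last to the first place. *)
Lemma linsr_insl (w : htens Z 2) :
  linsr w = lhreindex (@ord_pred 3) (@linsl k H Z 1 1 F (lhreindex (tperm 0 1) w) : htens Z 3).
Proof.
have ll : linear (fun w => lhreindex (@ord_pred 3) (@linsl k H Z 1 1 F (lhreindex (tperm 0 1) w) : htens Z 3)).
  apply: linear_comp; first exact: lhreindex_linear (@ord_pred_inj 3).
  by apply: (linear_comp (@linsl_linear k H Z 1 1 F)); exact: swap_linear.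
rewrite -(lhextend_id w ll); apply: eq_lhextend => K e; move: K.
apply: (@tpow_ext k H 2 (htens Z 3)).
- exact: (linear_comp (@lhpure_linear k H Z 3 e) (ltextend_linear ins_multilin)).
- exact: (linear_comp ll (@lhpure_linear k H Z 2 e)).
move=> t; rewrite ltextend_pure // lhreindex_pure; last exact: perm_inj.
rewrite ltreindex_pure; last exact: perm_inj.
rewrite (@linsl_pure k H Z 1 1) lhreindex_pure; last exact: ord_pred_inj.
congr lhpure; rewrite /ins -ltcat_rotate -[licomul 2 _]/(@licomul k H 2 _) licomul2 ffunE.
congr (ltreindex _ (ltcat (ltmul _ (comul (t _))) _)); first by rewrite tpermL.
congr ltpure; apply/ffunP => i; rewrite !ffunE ord1; congr (t _).
by rewrite (_ : lift _ _ = 1) ?tpermR //; exact: val_inj.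
Qed.

Lemma linsr_linear : linear linsr.
Proof.
move=> a x y; rewrite !linsr_insl (@swap_linear Z 0) (@linsl_linear k H Z 1 1 F).
exact: (lhreindex_linear (@ord_pred_inj 3)).
Qed.
End InsertRight.

Section Composition.
Variables (X Y Z : lmodType H) (A : X -> Y -> htens Z 2).

Definition lpcompl (w : htens X 2) (z : Y) : htens Z 3 :=
  lhextend (fun F e => @linsl k H Z 1 1 F (A e z) : htens Z 3) w.

Definition lpcompr (x : X) (w : htens Y 2) : htens Z 3 :=
  lhextend (fun F d => linsr F (A x d)) w.

Lemma pcomplE : pcompl A = lpcompl.
Proof.
apply/funext => w; apply/funext => z; rewrite /pcompl hextendE.
by congr (lhextend _ w); apply/funext => F; apply/funext => e; rewrite inslE.
Qed.

Lemma pcomprE : pcompr A = lpcompr.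
Proof.
apply/funext => x; apply/funext => w; rewrite /pcompr hextendE.
by congr (lhextend _ w); apply/funext => F; apply/funext => e; rewrite insrE.
Qed.

Hypothesis bA : pseudobilinear A.

Lemma pbDl x x' y : A (x + x') y = A x y + A x' y.
Proof. by have := pseudobilinearl bA 1 x x' y; rewrite !scale1r. Qed.
Lemma pbDr x y y' : A x (y + y') = A x y + A x y'.
Proof. by have := pseudobilinearr bA 1 x y y'; rewrite !scale1r. Qed.
Lemma pb0l y : A 0 y = 0.
Proof. by apply: (addrI (A 0 y)); rewrite -pbDl !addr0. Qed.
Lemma pb0r x : A x 0 = 0.
Proof. by apply: (addrI (A x 0)); rewrite -pbDr !addr0. Qed.
Lemma pbNl x y : A (- x) y = - A x y.
Proof. by apply: (addrI (A x y)); rewrite -pbDl !subrr pb0l. Qed.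
Lemma pbNr x y : A x (- y) = - A x y.
Proof. by apply: (addrI (A x y)); rewrite -pbDr !subrr pb0r. Qed.
Lemma pbH f g x y : A (f *: x) (g *: y) = lhact (ltpure (pair2 f g)) (A x y).
Proof. by rewrite (pseudobilinearH bA) hactE tpureE. Qed.

Lemma pcompl_balanced z : balanced (fun F e => @linsl k H Z 1 1 F (A e z) : htens Z 3).
Proof.
split=> [e|F x y|F h e].
- exact: (@linsl_linear_l k H Z 1 1).
- by rewrite pbDl (linD (@linsl_linear k H Z 1 1 F)).
(* Writing [z] as 1 times [z] makes linearity over the tensor square of H applicable; what remains
   outside is the action of a unit tensor. *)
rewrite -[in RHS](scale1r z) pbH (@linsl_hact k H Z 1 1) ffunE /=.
set G := ltcat _ _; suff -> : G = ltpure [ffun=> 1] by rewrite lhact1.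
rewrite /G (@ltcat_pure _ _ 2 1); congr ltpure; apply/esym/(@catfP _ _ 2 1) => i; by rewrite !ffunE.
Qed.

Lemma lpcompl_linear z : linear (lpcompl^~ z).
Proof. exact: lhextend_linear (pcompl_balanced z). Qed.

Lemma lpcompl_pure F e z : lpcompl (lhpure F e) z = @linsl k H Z 1 1 F (A e z).
Proof. exact: lhextend_pure (pcompl_balanced z) _ _. Qed.

Lemma lpcomplDr w z z' : lpcompl w (z + z') = lpcompl w z + lpcompl w z'.
Proof.
rewrite /lpcompl -lhextendD; apply: eq_lhextend => F e.
by rewrite pbDr (linD (@linsl_linear k H Z 1 1 F)).
Qed.

Lemma lpcompl_swap w z :
  lpcompl (lhreindex (tperm 0 1) w) z = lhreindex (tperm 0 1) (lpcompl w z).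
Proof.
move: w; apply: (@htens_ext k H X 2 (htens Z 3)).
- exact: (linear_comp (lpcompl_linear z) (@swap_linear X 0)).
- exact: (linear_comp (@swap_linear Z 1) (lpcompl_linear z)).
move=> t x; rewrite lhreindex_pure; last exact: perm_inj.
rewrite !lpcompl_pure; apply/esym.
have Hl (i : 'I_2) : tperm (0 : 'I_3) 1 (lshift 1 i) = lshift 1 (tperm 0 1 i).
  rewrite (inj_tperm _ _ _ (@lshift_inj 2 1)); congr (tperm _ _ _); exact: val_inj.
have Hr (i : 'I_1) : tperm (0 : 'I_3) 1 (rshift 2 i) = rshift 2 i.
  by rewrite tpermD.
exact: (@linsl_hreindex k H Z 1 1 _ _ _ _ (@perm_inj _ _) (@perm_inj _ _) Hl Hr).
Qed.
End Composition.

Lemma lpcomplD (X Y Z : lmodType H) (A B : X -> Y -> htens Z 2) w z :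
  lpcompl (fun x y => A x y + B x y) w z = lpcompl A w z + lpcompl B w z.
Proof.
rewrite /lpcompl -lhextendD; apply: eq_lhextend => F e.
by rewrite (linD (@linsl_linear k H Z 1 1 F)).
Qed.

(* Rotating the factors turns right insertion into left insertion, so that everything
   about [lpcompr] follows from the left-handed version. *)
Lemma lpcompr_compl (X Y Z : lmodType H) (A : X -> Y -> htens Z 2) (B : Y -> X -> htens Z 2) x w :
  (forall d, A x d = - lhreindex (tperm 0 1) (B d x)) ->
  lpcompr A x w = - lhreindex (@ord_pred 3) (lpcompl B w x).
Proof.
move=> AB; rewrite /lpcompr /lpcompl.
have ll := linear_opp (lhreindex_linear (Z := Z) (@ord_pred_inj 3)).
rewrite (lhextend_comp _ w ll); apply: eq_lhextend => F d.
rewrite linsr_insl AB (linN (@swap_linear Z 0)) swapK (linN (@linsl_linear k H Z 1 1 F)).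
by rewrite (linN (lhreindex_linear (Z := Z) (@ord_pred_inj 3))).
Qed.

Lemma linsl_hmap (Y Z : lmodType H) m n (phi : {linear Y -> Z}) (F : tpow H m.+1) (w : htens Y n.+1) :
  lhmap phi (linsl F w) = linsl F (lhmap phi w).
Proof.
move: w; apply: (@htens_ext k H Y n.+1 (htens Z (m.+1 + n))).
- exact: (linear_comp (@lhmap_linear k H Y Z (m.+1 + n) phi) (@linsl_linear k H Y m n F)).
- exact: (linear_comp (@linsl_linear k H Z m n F) (@lhmap_linear k H Y Z n.+1 phi)).
by move=> t z; rewrite linsl_pure !lhmap_pure linsl_pure.
Qed.

Lemma linsr_hmap (Y Z : lmodType H) (phi : {linear Y -> Z}) (F : tpow H 2) (w : htens Y 2) :
  lhmap phi (linsr F w) = linsr F (lhmap phi w).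
Proof.
rewrite !linsr_insl lhmap_hreindex; last exact: ord_pred_inj.
by rewrite (@linsl_hmap Y Z 1 1) lhmap_hreindex //; exact: perm_inj.
Qed.

Section CompositionMaps.
Variables (X X' Y Z : lmodType H) (A : X -> Y -> htens Z 2) (phi : {linear X' -> X}).
Hypothesis bA : pseudobilinear A.

Lemma lpcompl_hmap w y : lpcompl A (lhmap phi w) y = lpcompl (fun e => A (phi e)) w y.
Proof.
move: w; apply: (@htens_ext k H X' 2 (htens Z 3)) => [||t x].
- exact: (linear_comp (lpcompl_linear bA y) (@lhmap_linear k H X' X 2 phi)).
- apply: lhextend_linear; have bc := pcompl_balanced bA y.
  split=> [e|F x x'|F h e]; first exact: (balancedl bc).
    by rewrite linearD (balancedr bc).
  by rewrite linearZ (balancedH bc).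
rewrite lhmap_pure lpcompl_pure // /lpcompl lhextend_pure //.
have bc := pcompl_balanced bA y; split=> [e|F u x'|F h e]; first exact: (balancedl bc).
  by rewrite linearD (balancedr bc).
by rewrite linearZ (balancedH bc).
Qed.
End CompositionMaps.

End Pseudobilinear.

(** * The Jacobiator *)

Section PermutationsOfThree.
Variables (k : fieldType) (H : cocommHopfType k) (Z : lmodType H).
Implicit Types w : htens Z 3.

Notation sw := (lhreindex (tperm (0 : 'I_3) 1)).
Notation sw23 := (lhreindex (tperm (1 : 'I_3) ord_max)).
Notation sw13 := (lhreindex (tperm (0 : 'I_3) ord_max)).
Notation rot := (lhreindex (@ord_pred 3)).

Ltac cases_on_I3 := move=> [[|[|[|//]]] p]; apply: val_inj; rewrite /= ?permE.

(** These are the products in the symmetric group on three letters by which transpositions permute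
    the terms of the Jacobiator; [rot] puts the last factor first. *)
Lemma sw_rot w : sw (rot w) = sw23 w.
Proof.
rewrite lhreindex_comp; [|exact: perm_inj|exact: ord_pred_inj].
by apply: eq_lhreindex; cases_on_I3.
Qed.

Lemma sw_sw23 w : sw (sw23 w) = rot w.
Proof.
rewrite lhreindex_comp; [|exact: perm_inj|exact: perm_inj].
by apply: eq_lhreindex; cases_on_I3.
Qed.

Lemma sw23_rot w : sw23 (rot w) = sw13 w.
Proof.
rewrite lhreindex_comp; [|exact: perm_inj|exact: ord_pred_inj].
by apply: eq_lhreindex; cases_on_I3.
Qed.

Lemma rot_sw w : rot (sw w) = sw13 w.
Proof.
rewrite lhreindex_comp; [|exact: ord_pred_inj|exact: perm_inj].
by apply: eq_lhreindex; cases_on_I3.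
Qed.

Lemma sw23K w : sw23 (sw23 w) = w.
Proof. by apply: lhreindexK; [exact: perm_inj|exact: perm_inj|exact: tpermK]. Qed.

Lemma rotK w : lhreindex (@ordS 3) (rot w) = w.
Proof. by apply: lhreindexK; [exact: ordS_inj|exact: ord_pred_inj|exact: ordSK]. Qed.
End PermutationsOfThree.

Section PseudobilinearClosure.
Variables (k : fieldType) (H : cocommHopfType k).
Variables (X Y Z : lmodType H).

Lemma pseudobilinearP (A : X -> Y -> htens Z 2) :
  (forall a x x' y, A (a%:A *: x + x') y = a *: A x y + A x' y) ->
  (forall a x y y', A x (a%:A *: y + y') = a *: A x y + A x y') ->
  (forall f g x y, A (f *: x) (g *: y) = lhact (ltpure (pair2 f g)) (A x y)) ->
  pseudobilinear A.
Proof. by move=> Al Ar AH; split=> // f g x y; rewrite AH hactE tpureE. Qed.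

End PseudobilinearClosure.

Section PseudobilinearOperations.
Variables (k : fieldType) (H : cocommHopfType k).
Variables (X Y Z : lmodType H).
Notation sw := (lhreindex (tperm 0 1)).

Lemma pb_hmap (W : lmodType H) (phi : {linear Z -> W}) (A : X -> Y -> htens Z 2) :
  pseudobilinear A -> pseudobilinear (fun x y => lhmap phi (A x y)).
Proof.
move=> bA; have lp := @lhmap_linear k H Z W 2 phi.
apply: pseudobilinearP => [a x x' y|a x y y'|f g x y].
- by rewrite (pseudobilinearl bA) lp.
- by rewrite (pseudobilinearr bA) lp.
- by rewrite pbH // lhmap_hact.
Qed.

Lemma pb_add (A B : X -> Y -> htens Z 2) :
  pseudobilinear A -> pseudobilinear B -> pseudobilinear (fun x y => A x y + B x y).
Proof.
move=> bA bB; apply: pseudobilinearP => [a x x' y|a x y y'|f g x y].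
- by rewrite (pseudobilinearl bA) (pseudobilinearl bB) scalerDr addrACA.
- by rewrite (pseudobilinearr bA) (pseudobilinearr bB) scalerDr addrACA.
- by rewrite !pbH // (linD (@lhact_linear k H Z 2 _)).
Qed.

Lemma pb_opp (A : X -> Y -> htens Z 2) :
  pseudobilinear A -> pseudobilinear (fun x y => - A x y : htens Z 2).
Proof.
move=> bA; apply: pseudobilinearP => [a x x' y|a x y y'|f g x y].
- by rewrite (pseudobilinearl bA) opprD scalerN.
- by rewrite (pseudobilinearr bA) opprD scalerN.
- by rewrite pbH // (linN (@lhact_linear k H Z 2 _)).
Qed.

Lemma pb_zero : pseudobilinear (fun (x : X) (y : Y) => 0 : htens Z 2).
Proof.
apply: pseudobilinearP => [a x x' y|a x y y'|f g x y]; rewrite ?scaler0 ?addr0 //.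
by rewrite (lin0 (@lhact_linear k H Z 2 _)).
Qed.

Lemma pb_comp (X' Y' : lmodType H) (f : {linear X' -> X}) (g : {linear Y' -> Y})
    (A : X -> Y -> htens Z 2) :
  pseudobilinear A -> pseudobilinear (fun x y => A (f x) (g y)).
Proof.
move=> bA; apply: pseudobilinearP => [a x x' y|a x y y'|f' g' x y].
- by rewrite linearP (pseudobilinearl bA).
- by rewrite linearP (pseudobilinearr bA).
- by rewrite !linearZ pbH.
Qed.

Lemma swap_pair2 (f g : H) : ltreindex (tperm 0 1) (ltpure (pair2 f g)) = ltpure (pair2 g f).
Proof.
rewrite ltreindex_pure; last exact: perm_inj.
by congr ltpure; apply/ffunP => -[[|[|//]] p]; rewrite !ffunE permE.
Qed.

Lemma pb_flip (A : X -> Y -> htens Z 2) :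
  pseudobilinear A -> pseudobilinear (fun y x => sw (A x y)).
Proof.
move=> bA; have ls := @swap_linear k H Z 0.
apply: pseudobilinearP => [a x x' y|a x y y'|f g x y].
- by rewrite (pseudobilinearr bA) ls.
- by rewrite (pseudobilinearl bA) ls.
- by rewrite pbH // lhreindex_hact ?swap_pair2 //; exact: perm_inj.
Qed.

End PseudobilinearOperations.

Section Jacobiator.
Variables (k : fieldType) (H : cocommHopfType k) (V : lmodType H).
Implicit Types A B : V -> V -> htens V 2.

Notation sw := (lhreindex (tperm (0 : 'I_3) 1)).
Notation sw23 := (lhreindex (tperm (1 : 'I_3) ord_max)).
Notation rot := (lhreindex (@ord_pred 3)).
Let lsw := @swap_linear k H V 1.
Let lsw23 := lhreindex_linear (Z := V) (@perm_inj _ (tperm (1 : 'I_3) ord_max)).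
Let lrot := lhreindex_linear (Z := V) (@ord_pred_inj 3).

(* The three terms are indexed by the (2,1)-shuffles. *)
Definition shuffle_comp A B (x y z : V) : htens V 3 :=
  lpcompl B (A x y) z - sw23 (lpcompl B (A x z) y) + rot (lpcompl B (A y z) x).

(** The bracket of the cochain of [A] with itself is twice this, see [nr_cochain22]. *)
Definition jacobiator A := shuffle_comp A A.

Lemma shuffle_compDl A A' B x y z : pseudobilinear B ->
  shuffle_comp (fun x y => A x y + A' x y) B x y z = shuffle_comp A B x y z + shuffle_comp A' B x y z.
Proof.
move=> bB; have lB w := linD (lpcompl_linear bB w).
rewrite /shuffle_comp !lB (linD lsw23) (linD lrot) opprD.
by rewrite [X in X + _]addrACA [LHS]addrACA.
Qed.

Lemma shuffle_compDr A B B' x y z :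
  shuffle_comp A (fun x y => B x y + B' x y) x y z = shuffle_comp A B x y z + shuffle_comp A B' x y z.
Proof.
rewrite /shuffle_comp !lpcomplD (linD lsw23) (linD lrot) opprD.
by rewrite [X in X + _]addrACA [LHS]addrACA.
Qed.

Section Trilinear.
Variable A : V -> V -> htens V 2.
Hypotheses (bA : pseudobilinear A) (sA : forall x y, A y x = - lhreindex (tperm 0 1) (A x y)).

Let lA w := lpcompl_linear bA w.

Lemma jacobiatorDl x x' y z : jacobiator A (x + x') y z = jacobiator A x y z + jacobiator A x' y z.
Proof.
rewrite /jacobiator /shuffle_comp !pbDl // !(linD (lA _)) lpcomplDr // (linD lsw23) (linD lrot) opprD.
by rewrite [X in X + _]addrACA [LHS]addrACA.
Qed.

Lemma lpcompl_skew x y z : lpcompl A (A y x) z = - sw (lpcompl A (A x y) z).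
Proof. by rewrite (sA x y) (linN (lA z)) lpcompl_swap. Qed.

(** The first term changes sign by skew-symmetry of [A], and the other two terms are exchanged by
    [sw_sw23] and [sw_rot]. *)
Lemma jacobiator_swap12 x y z : jacobiator A y x z = - sw (jacobiator A x y z).
Proof.
rewrite /jacobiator /shuffle_comp (lpcompl_skew x y) (linD lsw) (linB lsw) sw_sw23 sw_rot.
by rewrite !opprD opprK addrAC.
Qed.

Lemma jacobiator_swap23 x y z : jacobiator A x z y = - sw23 (jacobiator A x y z).
Proof.
rewrite /jacobiator /shuffle_comp (lpcompl_skew y z) (linD lsw23) (linB lsw23) sw23K sw23_rot.
by rewrite (linN lrot) rot_sw !opprD opprK [X in X + _]addrC.
Qed.

Lemma lpcompr_skew x w : lpcompr A x w = - rot (lpcompl A w x).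
Proof. by apply: lpcompr_compl => d; exact: sA. Qed.

Lemma lpcompl_skewr x w : lpcompl A w x = - lhreindex (@ordS 3) (lpcompr A x w).
Proof.
have lS := lhreindex_linear (Z := V) (@ordS_inj 3).
by rewrite lpcompr_skew (linN lS) rotK opprK.
Qed.

Lemma jacobiatorE x y z : jacobiator A x y z =
  lpcompl A (A x y) z - lpcompr A x (A y z) + sw (lpcompr A y (A x z)).
Proof.
rewrite !lpcompr_skew (linN lsw) sw_rot opprK /jacobiator /shuffle_comp.
by rewrite addrAC.
Qed.

(** Like the third cocycle identity, this form consists of right compositions only; the two are
    compared in [jacobiator_LLL]. *)
Lemma jacobiator_cyclic x y z : jacobiator A x y z =
  - (lpcompr A x (A y z) - sw (lpcompr A y (A x z)) + lhreindex (@ordS 3) (lpcompr A z (A x y))).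
Proof. by rewrite jacobiatorE lpcompl_skewr !opprD opprK addrAC addrC addrA addrAC. Qed.

End Trilinear.
End Jacobiator.

(** * Cochains on the direct sum *)

Section Components.
Variables (k : fieldType) (H : cocommHopfType k) (L M : liePseudoalg H).
Local Notation V := (LM L M).

Definition outL (v : V) : L := v.1.
Definition outM (v : V) : M := v.2.

Lemma inL_is_linear : linear (@inL k H L M).
Proof. by move=> a x y; apply: injective_projections; rewrite /= ?scaler0 ?addr0. Qed.
Lemma inM_is_linear : linear (@inM k H L M).
Proof. by move=> a x y; apply: injective_projections; rewrite /= ?scaler0 ?addr0. Qed.
Lemma outL_is_linear : linear outL. Proof. by []. Qed.
Lemma outM_is_linear : linear outM. Proof. by []. Qed.
End Components.

HB.instance Definition _ (k : fieldType) (H : cocommHopfType k) (L M : liePseudoalg H) :=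
  GRing.isLinear.Build H L (LM L M) *:%R (@inL k H L M) (@inL_is_linear k H L M).
HB.instance Definition _ (k : fieldType) (H : cocommHopfType k) (L M : liePseudoalg H) :=
  GRing.isLinear.Build H M (LM L M) *:%R (@inM k H L M) (@inM_is_linear k H L M).
HB.instance Definition _ (k : fieldType) (H : cocommHopfType k) (L M : liePseudoalg H) :=
  GRing.isLinear.Build H (LM L M) L *:%R (@outL k H L M) (@outL_is_linear k H L M).
HB.instance Definition _ (k : fieldType) (H : cocommHopfType k) (L M : liePseudoalg H) :=
  GRing.isLinear.Build H (LM L M) M *:%R (@outM k H L M) (@outM_is_linear k H L M).

Section Structure.
Variables (k : fieldType) (H : cocommHopfType k) (L M : liePseudoalg H).
Local Notation V := (LM L M).
Local Notation iL := (@inL k H L M).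
Local Notation iM := (@inM k H L M).
Notation sw := (lhreindex (tperm 0 1)).
Notation hL := (lhmap iL).
Notation hM := (lhmap iM).
Implicit Types (x y z : L) (u v w : M) (p : cocycle_data L M).

Lemma split_LM (e : V) : e = iL e.1 + iM e.2.
Proof. by case: e => x u; apply: injective_projections; rewrite /= ?addr0 ?add0r. Qed.

Lemma lhmap_outMK n (w : htens M n) : lhmap (@outM k H L M) (hM w) = w.
Proof. by rewrite lhmap_comp -[RHS]lhmap_id; apply: eq_lhmap. Qed.
Lemma lhmap_zero (X Y : lmodType H) n (w : htens X n) : lhmap (fun _ => 0 : Y) w = 0.
Proof.
pose c : {linear X -> Y} := \0%R.
move: w; apply: (@htens_ext k H X n (htens Y n)) => [||t x].
- exact: (@lhmap_linear k H X Y n c).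
- by move=> a a' b; rewrite scaler0 addr0.
rewrite (@lhmap_pure k H X Y n c) /=.
by apply: (addrI (lhpure (ltpure t) 0)); rewrite -lhpureDr !addr0.
Qed.
Lemma lhmap_inM_inj n : injective (@lhmap k H M V n iM).
Proof. exact: can_inj (@lhmap_outMK n). Qed.

Lemma pbr_swap (P : liePseudoalg H) (a b : P) : pbr b a = - sw (pbr a b).
Proof. by rewrite (@pbr_skew k H P a b) sigma12E. Qed.

Definition lie_sum (a b : V) : htens V 2 := hL (pbr a.1 b.1) + hM (pbr a.2 b.2).

Definition cochain_of p (a b : V) : htens V 2 :=
  hM (p.1 a.1 b.1 + p.2 a.1 b.2 - sw (p.2 b.1 a.2)).

Definition total p (a b : V) : htens V 2 := lie_sum a b + cochain_of p a b.

(** The linearity and symmetry conditions on a cocycle, without its equations. By [dgla1_cochain_of]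
    and [dgla1P] such pairs describe all elements of degree 1 of the dg Lie algebra. *)
Definition admissible p :=
  [/\ pseudobilinear p.1, forall x y, p.1 y x = - sw (p.1 x y) & pseudobilinear p.2].

Lemma lie_sum_pb : pseudobilinear lie_sum.
Proof.
apply: pb_add.
  exact: pb_hmap (pb_comp (@outL k H L M) (@outL k H L M) (@pbr_bilinear k H L)).
exact: pb_hmap (pb_comp (@outM k H L M) (@outM k H L M) (@pbr_bilinear k H M)).
Qed.

Lemma lie_sum_skew a b : lie_sum b a = - sw (lie_sum a b).
Proof.
rewrite /lie_sum (linD (@swap_linear k H V 0)) -!lhmap_hreindex; [|exact: perm_inj|exact: perm_inj].
rewrite (pbr_swap a.1) (pbr_swap a.2) (linN (@lhmap_linear k H L V 2 iL)).
by rewrite (linN (@lhmap_linear k H M V 2 iM)) opprD.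
Qed.

Lemma cochain_of_pb p : admissible p -> pseudobilinear (cochain_of p).
Proof.
case=> b1 s1 b2; apply: pb_hmap; apply: pb_add.
  apply: pb_add; first exact: (pb_comp (@outL k H L M) (@outL k H L M) b1).
  exact: (pb_comp (@outL k H L M) (@outM k H L M) b2).
exact: pb_opp (pb_flip (pb_comp (@outL k H L M) (@outM k H L M) b2)).
Qed.

Lemma cochain_of_skew p : admissible p ->
  forall a b, cochain_of p b a = - sw (cochain_of p a b).
Proof.
case=> b1 s1 b2 a b; rewrite /cochain_of -lhmap_hreindex; last exact: perm_inj.
rewrite -(linN (@lhmap_linear k H M V 2 iM)) (linB (@swap_linear k H M 0)) swapK.
rewrite (linD (@swap_linear k H M 0)) (s1 a.1 b.1) opprB opprD; congr (hM _).
by rewrite addrCA addrA.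
Qed.

Lemma total_pb p : admissible p -> pseudobilinear (total p).
Proof. by move=> gp; apply: pb_add; [exact: lie_sum_pb|exact: cochain_of_pb]. Qed.

Lemma total_skew p : admissible p -> forall a b, total p b a = - sw (total p a b).
Proof.
move=> gp a b; rewrite /total (linD (@swap_linear k H V 0)) opprD.
by rewrite -lie_sum_skew -cochain_of_skew.
Qed.

Section Values.
Variable p : cocycle_data L M.
Hypothesis gp : admissible p.
Let b1 : pseudobilinear p.1. Proof. by case: gp. Qed.
Let b2 : pseudobilinear p.2. Proof. by case: gp. Qed.
Let bL := @pbr_bilinear k H L.
Let bM := @pbr_bilinear k H M.
Let lL := @lhmap_linear k H L V 2 iL.
Let lM := @lhmap_linear k H M V 2 iM.

Lemma total_LL x y : total p (inL M x) (inL M y) = hL (pbr x y) + hM (p.1 x y).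
Proof.
rewrite /total /lie_sum /cochain_of /= (pb0l bM) (pb0r b2) (pb0r b2).
by rewrite (lin0 lM) addr0 (lin0 (@swap_linear k H M 0)) subr0 addr0.
Qed.

Lemma total_LM x u : total p (inL M x) (inM L u) = hM (p.2 x u).
Proof.
rewrite /total /lie_sum /cochain_of /= (pb0l bM) (pb0r bL) (pb0r b1) (pb0l b2).
by rewrite (lin0 lM) (lin0 lL) (lin0 (@swap_linear k H M 0)) subr0 !add0r.
Qed.

Lemma total_MM u v : total p (inM L u) (inM L v) = hM (pbr u v).
Proof.
rewrite /total /lie_sum /cochain_of /= (pb0l bL) (pb0r b1) !(pb0l b2).
by rewrite (lin0 lL) (lin0 (@swap_linear k H M 0)) subr0 !add0r (lin0 lM) addr0.
Qed.
End Values.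
End Structure.

Section CompositionValues.
Variables (k : fieldType) (H : cocommHopfType k).

(** The composition sees its second argument only through the map sending [e] to [A e y], so
    [total p] can be compared with its components, whose sources differ. *)
Lemma eq_lpcompl (X Y Y' Z : lmodType H) (A : X -> Y -> htens Z 2) (A' : X -> Y' -> htens Z 2) w y y' :
  (forall e, A e y = A' e y') -> lpcompl A w y = lpcompl A' w y'.
Proof. by move=> e; apply: eq_lhextend => F x; rewrite e. Qed.

Lemma eq_lpcompr (X X' Y Z : lmodType H) (A : X -> Y -> htens Z 2) (A' : X' -> Y -> htens Z 2) w x x' :
  (forall d, A x d = A' x' d) -> lpcompr A x w = lpcompr A' x' w.
Proof. by move=> e; apply: eq_lhextend => F d; rewrite e. Qed.

Lemma lpcompl_post (X Y Z W : lmodType H) (phi : {linear Z -> W}) (A : X -> Y -> htens Z 2) w y :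
  lpcompl (fun e y => lhmap phi (A e y)) w y = lhmap phi (lpcompl A w y).
Proof.
rewrite /lpcompl (lhextend_comp _ w (@lhmap_linear k H Z W 3 phi)).
by apply: eq_lhextend => F e; rewrite (@linsl_hmap k H Z W 1 1).
Qed.

Lemma lpcompr_post (X Y Z W : lmodType H) (phi : {linear Z -> W}) (A : X -> Y -> htens Z 2) x w :
  lpcompr (fun x d => lhmap phi (A x d)) x w = lhmap phi (lpcompr A x w).
Proof.
rewrite /lpcompr (lhextend_comp _ w (@lhmap_linear k H Z W 3 phi)).
by apply: eq_lhextend => F e; rewrite linsr_hmap.
Qed.

Lemma lpcomprD (X Y Z : lmodType H) (A B : X -> Y -> htens Z 2) x w :
  lpcompr (fun x d => A x d + B x d) x w = lpcompr A x w + lpcompr B x w.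
Proof.
rewrite /lpcompr -lhextendD; apply: eq_lhextend => F d.
by rewrite (linD (linsr_linear F)).
Qed.

(** Here the reversed map is built from [A] itself, so right compositions of maps with two different
    sources, such as psi, also reduce to left ones. *)
Lemma lpcompr_flip (X Y Z : lmodType H) (A : X -> Y -> htens Z 2) x w :
  lpcompr A x w =
  - lhreindex (@ord_pred 3) (lpcompl (fun d x => - lhreindex (tperm 0 1) (A x d) : htens Z 2) w x).
Proof. by apply: lpcompr_compl => d; rewrite (linN (@swap_linear k H Z 0)) swapK opprK. Qed.

Lemma lpcompr_linear (X Y Z : lmodType H) (A : X -> Y -> htens Z 2) x :
  pseudobilinear A -> linear (lpcompr A x).
Proof.
move=> bA a w w'; rewrite !lpcompr_flip (lpcompl_linear (pb_opp (pb_flip bA)) x).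
by rewrite (lhreindex_linear (@ord_pred_inj 3)) opprD scalerN.
Qed.

Lemma lpcompr_hmap (X Y Y' Z : lmodType H) (A : X -> Y -> htens Z 2) (phi : {linear Y' -> Y}) x w :
  pseudobilinear A -> lpcompr A x (lhmap phi w) = lpcompr (fun x d => A x (phi d)) x w.
Proof.
by move=> bA; rewrite !lpcompr_flip lpcompl_hmap //; exact: pb_opp (pb_flip bA).
Qed.
End CompositionValues.

(** * The components of the Jacobiator are the cocycle identities *)

Section CocycleEquations.
Variables (k : fieldType) (H : cocommHopfType k) (L M : liePseudoalg H).
Local Notation V := (LM L M).
Local Notation iL := (@inL k H L M).
Local Notation iM := (@inM k H L M).
Notation sw := (lhreindex (tperm (0 : 'I_3) 1)).
Notation cyc := (lhreindex (@ordS 3)).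
Notation hL := (lhmap (@inL k H L M)).
Notation hM := (lhmap (@inM k H L M)).
Implicit Types (x y z : L) (u v w : M) (p : cocycle_data L M).

(** The three defects are the cocycle identities with all terms on one side; the first two are
    arranged in the shape of [jacobiatorE]. *)
Definition derivation_defect p x u v : htens M 3 :=
  lpcompl (@pbr _ _ M) (p.2 x u) v - lpcompr p.2 x (pbr u v) + sw (lpcompr (@pbr _ _ M) u (p.2 x v)).

Definition curvature_defect p x y u : htens M 3 :=
  lpcompl p.2 (pbr x y) u + lpcompl (@pbr _ _ M) (p.1 x y) u
  - lpcompr p.2 x (p.2 y u) + sw (lpcompr p.2 y (p.2 x u)).

Definition cocycle_defect p x y z : htens M 3 :=
  lpcompr p.2 x (p.1 y z) - sw (lpcompr p.2 y (p.1 x z)) + cyc (lpcompr p.2 z (p.1 x y))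
  + lpcompr p.1 x (pbr y z) - sw (lpcompr p.1 y (pbr x z)) + cyc (lpcompr p.1 z (pbr x y)).

Let eq_sub (G : zmodType) (a b c : G) : a = b - c <-> a - b + c = 0.
Proof.
have -> : a - b + c = a - (b - c) by rewrite opprB addrA addrAC.
by split=> [->|/eqP]; rewrite ?subrr // subr_eq0 => /eqP.
Qed.

Let eq_sub2 (G : zmodType) (a b c d : G) : b - c - a = d <-> a + d - b + c = 0.
Proof.
have -> : a + d - b + c = d - (b - c - a) by rewrite !opprB addrA addrA (addrC a) -!addrA; congr (d + (a + _)); rewrite addrC.
by split=> [->|/eqP]; rewrite ?subrr // subr_eq0 => /eqP.
Qed.

(** In [jacobiator_LLL] the [l] are the components in L, which cancel by the Jacobi identity of L,
    while the [a] come from applying chi and the [c] from applying psi. *)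
Let regroup (G : zmodType) (l1 l2 l3 a1 a2 a3 c1 c2 c3 : G) : l1 - l2 + l3 = 0 ->
  - (l1 + a1 + c1 - (l2 + a2 + c2) + (l3 + a3 + c3)) = - (c1 - c2 + c3 + a1 - a2 + a3).
Proof.
move=> l0; congr (- _); rewrite -[RHS]add0r -l0 !opprD !addrA.
by rewrite [LHS](ACl (1*4*7*3*6*9*2*5*8)).
Qed.

Lemma is_nab_cocycleP p : is_nab_cocycle p <->
  [/\ admissible p, forall x u v, derivation_defect p x u v = 0,
      forall x y u, curvature_defect p x y u = 0 &
      forall x y z, cocycle_defect p x y z = 0].
Proof.
split=> [[b1 s1 b2 e1 e2 e3]|[[b1 s1 b2] e1 e2 e3]]; split=> //.
- by split=> // x y; rewrite (s1 x y) sigma12E.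
- by move=> x u v; have := e1 x u v; rewrite !pcomplE !pcomprE sigma12E => /eq_sub.
- by move=> x y u; have := e2 x y u; rewrite !pcomplE !pcomprE sigma12E => /eq_sub2.
- by move=> x y z; have := e3 x y z; rewrite !pcomprE sigma12E /sigma1to3 hreindexE.
- by move=> x y; rewrite (s1 x y) sigma12E.
- by move=> x u v; have /eq_sub := e1 x u v; rewrite !pcomplE !pcomprE sigma12E.
- by move=> x y u; have /eq_sub2 := e2 x y u; rewrite !pcomplE !pcomprE sigma12E.
- by move=> x y z; have := e3 x y z; rewrite !pcomprE sigma12E /sigma1to3 hreindexE.
Qed.

Section Admissible.
Variable p : cocycle_data L M.
Hypothesis gp : admissible p.
Let bT : pseudobilinear (total p). Proof. exact: total_pb. Qed.
Let lL := @lhmap_linear k H L V 3 iL.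
Let lM := @lhmap_linear k H M V 3 iM.
Let lsw := @swap_linear k H V 1.

Let compl_LM t u : lpcompl (total p) (hL t) (iM u) = hM (lpcompl p.2 t u).
Proof. by rewrite lpcompl_hmap // -lpcompl_post; apply: eq_lpcompl => e; exact: total_LM. Qed.
Let compl_MM t u : lpcompl (total p) (hM t) (iM u) = hM (lpcompl (@pbr _ _ M) t u).
Proof. by rewrite lpcompl_hmap // -lpcompl_post; apply: eq_lpcompl => e; exact: total_MM. Qed.
Let compr_LL x t : lpcompr (total p) (iL x) (hL t) = hL (lpcompr (@pbr _ _ L) x t) + hM (lpcompr p.1 x t).
Proof.
rewrite lpcompr_hmap // -!lpcompr_post -lpcomprD; apply: eq_lpcompr => e; exact: total_LL.
Qed.
Let compr_LM x t : lpcompr (total p) (iL x) (hM t) = hM (lpcompr p.2 x t).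
Proof. by rewrite lpcompr_hmap // -lpcompr_post; apply: eq_lpcompr => e; exact: total_LM. Qed.
Let compr_MM u t : lpcompr (total p) (iM u) (hM t) = hM (lpcompr (@pbr _ _ M) u t).
Proof. by rewrite lpcompr_hmap // -lpcompr_post; apply: eq_lpcompr => e; exact: total_MM. Qed.
Let swM (w : htens M 3) : sw (hM w) = hM (sw w).
Proof. by rewrite lhmap_hreindex //; exact: perm_inj. Qed.
Let swL (w : htens L 3) : sw (hL w) = hL (sw w).
Proof. by rewrite lhmap_hreindex //; exact: perm_inj. Qed.

Lemma jacobiator_pbr (P : liePseudoalg H) (a b c : P) : jacobiator (@pbr _ _ P) a b c = 0.
Proof.
rewrite jacobiatorE; last exact: pbr_swap.
by have := pbr_jacobi a b c; rewrite pcomplE pcomprE sigma12E => /eq_sub.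
Qed.

Lemma jacobiator_LMM x u v :
  jacobiator (total p) (iL x) (iM u) (iM v) = hM (derivation_defect p x u v).
Proof.
rewrite jacobiatorE //; last exact: total_skew.
rewrite !total_LM // total_MM // compl_MM compr_LM compr_MM swM.
by rewrite -(linB lM) -(linD lM).
Qed.

Lemma jacobiator_LLM x y u :
  jacobiator (total p) (iL x) (iL y) (iM u) = hM (curvature_defect p x y u).
Proof.
rewrite jacobiatorE //; last exact: total_skew.
rewrite !total_LM // total_LL // (linD (lpcompl_linear bT _)) compl_LM compl_MM !compr_LM swM.
by rewrite -!(linD lM) -(linB lM) -(linD lM).
Qed.

Lemma jacobiator_MMM u v w : jacobiator (total p) (iM u) (iM v) (iM w) = 0.
Proof.
rewrite jacobiatorE //; last exact: total_skew.
rewrite !total_MM // compl_MM !compr_MM swM -(linB lM) -(linD lM) -[RHS](lin0 lM); congr hM.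
by rewrite -(jacobiator_pbr u v w) jacobiatorE //; exact: pbr_swap.
Qed.

Lemma jacobiator_LLL x y z :
  jacobiator (total p) (iL x) (iL y) (iL z) = - hM (cocycle_defect p x y z).
Proof.
have cycM (w : htens M 3) : cyc (hM w) = hM (cyc w) by rewrite lhmap_hreindex //; exact: ordS_inj.
have cycL (w : htens L 3) : cyc (hL w) = hL (cyc w) by rewrite lhmap_hreindex //; exact: ordS_inj.
have lcyc := lhreindex_linear (Z := V) (@ordS_inj 3).
have := jacobiator_pbr x y z; rewrite jacobiator_cyclic; last exact: pbr_swap.
move/(congr1 hL); rewrite (linN lL) (lin0 lL) (linD lL) (linB lL) => JL.
rewrite jacobiator_cyclic //; last exact: total_skew.
rewrite !total_LL // !(linD (lpcompr_linear _ bT)) !compr_LL !compr_LM.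
rewrite !(linD lsw) !(linD lcyc) !swM !swL !cycM !cycL.
rewrite /cocycle_defect !(linD lM) !(linN lM).
by apply: regroup; apply/eqP; rewrite -oppr_eq0; apply/eqP.
Qed.

Lemma total_jacobi : is_nab_cocycle p <-> forall a b c, jacobiator (total p) a b c = 0.
Proof.
have hM0 (w : htens M 3) : hM w = 0 -> w = 0.
  by rewrite -[RHS](lin0 lM); apply: lhmap_inM_inj.
have sT := total_skew gp.
split=> [/is_nab_cocycleP[_ e1 e2 e3] a b c|J]; last first.
  apply/is_nab_cocycleP; split=> // [x u v|x y u|x y z]; apply: hM0.
  - by rewrite -jacobiator_LMM.
  - by rewrite -jacobiator_LLM.
  - by apply/eqP; rewrite -oppr_eq0 -jacobiator_LLL; apply/eqP.
have lsw23 := lhreindex_linear (Z := V) (@perm_inj _ (tperm (1 : 'I_3) ord_max)).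
have s12 a' b' c' : jacobiator (total p) b' a' c' = 0 -> jacobiator (total p) a' b' c' = 0.
  by move=> E; rewrite (jacobiator_swap12 bT sT) E (lin0 lsw) oppr0.
have s23 a' b' c' : jacobiator (total p) a' c' b' = 0 -> jacobiator (total p) a' b' c' = 0.
  by move=> E; rewrite (jacobiator_swap23 bT sT) E (lin0 lsw23) oppr0.
have expand b' c' : (forall x, jacobiator (total p) (iL x) b' c' = 0) ->
    (forall u, jacobiator (total p) (iM u) b' c' = 0) ->
    forall a', jacobiator (total p) a' b' c' = 0.
  by move=> JL JM a'; rewrite [a']split_LM jacobiatorDl // JL JM addr0.
have LLL x y z : jacobiator (total p) (iL x) (iL y) (iL z) = 0.
  by rewrite jacobiator_LLL e3 (lin0 lM) oppr0.
have LLM x y u : jacobiator (total p) (iL x) (iL y) (iM u) = 0.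
  by rewrite jacobiator_LLM e2 (lin0 lM).
have LMM x u v : jacobiator (total p) (iL x) (iM u) (iM v) = 0.
  by rewrite jacobiator_LMM e1 (lin0 lM).
have MLM u x v : jacobiator (total p) (iM u) (iL x) (iM v) = 0 by exact: s12.
have LML x u y : jacobiator (total p) (iL x) (iM u) (iL y) = 0 by exact: s23.
have MLL u x y : jacobiator (total p) (iM u) (iL x) (iL y) = 0 by exact: s12.
have MML u v x : jacobiator (total p) (iM u) (iM v) (iL x) = 0 by exact: s23.
have MMM := jacobiator_MMM.
(* Transpositions bring each argument in turn to the front, where [expand] splits it into its L and
   M components. The last two restore the original order and leave the eight cases above. *)
by apply: (expand) => [x|u]; apply: (s12); apply: (expand) => [y|v]; apply: (s12); apply: (s23); apply: (s12);
  apply: (expand) => [z|w]; apply: (s12); apply: (s23).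
Qed.
End Admissible.
End CocycleEquations.

(** * The Nijenhuis-Richardson bracket in low degrees *)

Section LowShuffles.

Lemma I2P (i : 'I_2) : i = 0 \/ i = 1.
Proof. by case: i => [[|[|//]] p]; [left|right]; apply: val_inj. Qed.

Lemma lshift1_0 : lshift 1 (0 : 'I_2) = (0 : 'I_3). Proof. exact: val_inj. Qed.
Lemma lshift1_1 : lshift 1 (1 : 'I_2) = (1 : 'I_3). Proof. exact: val_inj. Qed.
Lemma lshift0_0 : lshift 0 (0 : 'I_2) = (0 : 'I_2). Proof. exact: val_inj. Qed.
Lemma lshift0_1 : lshift 0 (1 : 'I_2) = (1 : 'I_2). Proof. exact: val_inj. Qed.

Lemma perm3P (s t : 'S_3) : (s == t) = [&& s 0 == t 0, s 1 == t 1 & s ord_max == t ord_max].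
Proof.
apply/eqP/and3P => [->|[/eqP s0 /eqP s1 /eqP s2]]; first by rewrite !eqxx.
apply/permP => -[[|[|[|//]]] p].
- by rewrite (_ : Ordinal p = 0) //; exact: val_inj.
- by rewrite (_ : Ordinal p = 1) //; exact: val_inj.
- by rewrite (_ : Ordinal p = ord_max) //; exact: val_inj.
Qed.

(** The shuffle that feeds the last two arguments to the inner cochain and the first one to the
    outer. *)
Definition cycle3 : 'S_3 := perm (@ordS_inj 3).

Lemma odd_cycle3 : odd_perm cycle3 = false.
Proof.
have -> : cycle3 = (tperm (0%R : 'I_3) 1%R * tperm (0%R : 'I_3) ord_max)%g.
  by apply/eqP; rewrite perm3P !permM !permE.
by rewrite odd_permM !odd_tperm.
Qed.

Lemma mem_shuffles21 (s : 'S_(2 + 1)) :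
  (s \in shuffles 2 1) = (s \in [:: (1%g : 'S_3); tperm (1 : 'I_3) ord_max; cycle3]).
Proof.
rewrite !inE !perm3P !permE /=.
have -> : [forall i : 'I_1, forall j : 'I_1, (i < j)%N ==> (s (rshift 2 i) < s (rshift 2 j))%N].
  by apply/forallP => i; apply/forallP => j; rewrite !ord1.
have -> : [forall i : 'I_2, forall j : 'I_2, (i < j)%N ==> (s (lshift 1 i) < s (lshift 1 j))%N]
    = (s (0%R : 'I_3) < s (1%R : 'I_3))%N.
  apply/forallP/idP => [/(_ 0) /forallP /(_ 1) /=|lt01 i].
    by rewrite lshift1_0 lshift1_1.
  apply/forallP => j; apply/implyP; have [->|->] := I2P i; have [->|->] := I2P j => //.
  by rewrite lshift1_0 lshift1_1.
rewrite andbT.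
have n01 : s (0 : 'I_3) != s (1 : 'I_3) by rewrite (inj_eq perm_inj).
have n02 : s (0 : 'I_3) != s (ord_max : 'I_3) by rewrite (inj_eq perm_inj).
have n12 : s (1 : 'I_3) != s (ord_max : 'I_3) by rewrite (inj_eq perm_inj).
(* Both sides depend only on the three values of [s], so all 27 triples can be inspected. *)
move: n01 n02 n12; move: (s (0 : 'I_3)) (s (1 : 'I_3)) (s (ord_max : 'I_3)) => a b c.
by move: a b c => [[|[|[|//]]] ?] [[|[|[|//]]] ?] [[|[|[|//]]] ?].
Qed.

Lemma perm2P (s t : 'S_2) : (s == t) = (s 0 == t 0).
Proof.
apply/eqP/eqP => [-> //|s0].
have val1 (r : 'S_2) : val (r 1) = (1 - r 0%R)%N.
  have : r 0 != r 1 by rewrite (inj_eq perm_inj).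
  by move: (r 0) (r 1) => [[|[|//]] p] [[|[|//]] q].
apply/permP => i; have [->|->] := I2P i => //.
by apply: val_inj; rewrite !val1 s0.
Qed.

Lemma mem_shuffles11 (s : 'S_(1 + 1)) :
  (s \in shuffles 1 1) = (s \in [:: (1%g : 'S_2); tperm (0 : 'I_2) 1]).
Proof.
rewrite !inE !perm2P !permE /=.
have -> : [forall i : 'I_1, forall j : 'I_1, (i < j)%N ==> (s (rshift 1 i) < s (rshift 1 j))%N].
  by apply/forallP => i; apply/forallP => j; rewrite !ord1.
have -> : [forall i : 'I_1, forall j : 'I_1, (i < j)%N ==> (s (lshift 1 i) < s (lshift 1 j))%N].
  by apply/forallP => i; apply/forallP => j; rewrite !ord1.
by move: (s (0 : 'I_2)) => [[|[|//]] ?].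
Qed.

Lemma mem_shuffles20 (s : 'S_(2 + 0)) : (s \in shuffles 2 0) = (s \in [:: (1%g : 'S_2)]).
Proof.
rewrite !inE !perm2P !permE /=.
have -> : [forall i : 'I_0, forall j : 'I_0, (i < j)%N ==> (s (rshift 2 i) < s (rshift 2 j))%N].
  by apply/forallP => -[].
have -> : [forall i : 'I_2, forall j : 'I_2, (i < j)%N ==> (s (lshift 0 i) < s (lshift 0 j))%N]
    = (s (0%R : 'I_2) < s (1%R : 'I_2))%N.
  apply/forallP/idP => [/(_ 0) /forallP /(_ 1) /=|lt01 i].
    by rewrite lshift0_0 lshift0_1.
  apply/forallP => j; apply/implyP; have [->|->] := I2P i; have [->|->] := I2P j => //.
  by rewrite lshift0_0 lshift0_1.
have n01 : s (0 : 'I_2) != s (1 : 'I_2) by rewrite (inj_eq perm_inj).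
move: n01; move: (s (0 : 'I_2)) (s (1 : 'I_2)) => a b.
by move: a b => [[|[|//]] ?] [[|[|//]] ?].
Qed.

Lemma sum_seq2 (G : nmodType) (I : Type) (a b : I) (F : I -> G) :
  \sum_(i <- [:: a; b]) F i = F a + F b.
Proof. by rewrite !big_cons big_nil addr0. Qed.

Lemma sum_seq3 (G : nmodType) (I : Type) (a b c : I) (F : I -> G) :
  \sum_(i <- [:: a; b; c]) F i = F a + F b + F c.
Proof. by rewrite !big_cons big_nil addr0 addrA. Qed.
End LowShuffles.

Section RestrictedScalars.
Variables (k : fieldType) (H : cocommHopfType k) (Z : lmodType H).

(* [Z] as a vector space over [k], through [k -> H]. *)
Definition restr : Type := Z.
HB.instance Definition _ := GRing.Zmodule.on restr.
Definition restr_scale (a : k) (z : restr) : restr := (a%:A : H) *: (z : Z).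

Lemma restr_scaleA a b z : restr_scale a (restr_scale b z) = restr_scale (a * b) z.
Proof. by rewrite /restr_scale scalerA mulr_algl scalerA. Qed.
Lemma restr_scale1 : left_id 1 restr_scale.
Proof. by move=> z; rewrite /restr_scale scale1r scale1r. Qed.
Lemma restr_scaleDr : right_distributive restr_scale +%R.
Proof. by move=> a y z; rewrite /restr_scale scalerDr. Qed.
Lemma restr_scaleDl z : {morph restr_scale^~ z : a b / a + b}.
Proof. by move=> a b; rewrite /restr_scale !scalerDl. Qed.

HB.instance Definition _ := GRing.Zmodule_isLmodule.Build k restr
  restr_scaleA restr_scale1 restr_scaleDr restr_scaleDl.
End RestrictedScalars.

(** * Tensors with a single factor *)

Section DegreeOne.
Variables (k : fieldType) (H : cocommHopfType k).

Definition only1 (F : tpow H 1) : H := ltextend (fun f : {ffun 'I_1 -> H} => f 0) F.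

Lemma coord_multilin : multilin (fun f : {ffun 'I_1 -> H} => f 0 : H).
Proof. by move=> f i a x y; rewrite !ffunE !ord1 eqxx. Qed.

Lemma only1_pure f : only1 (ltpure f) = f 0.
Proof. exact: ltextend_pure coord_multilin f. Qed.

Lemma only1_linear : linear only1.
Proof. exact: ltextend_linear coord_multilin. Qed.

Section OneModule.
Variable Z : lmodType H.

(** [unit1] and [lower] are the mutually inverse isomorphisms between Z and the tensor product of H
    with Z over H; they identify cochains of degree 0 with H-linear maps. *)
Definition unit1 (z : Z) : htens Z 1 := lhpure (ltpure [ffun=> 1]) z.

Definition lower (w : htens Z 1) : Z := lhextend (fun F z => only1 F *: z : restr Z) w.

Lemma lower_balanced : balanced (fun F z => only1 F *: z : restr Z).
Proof.
split=> [z a F G|F y z|F h z].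
- by rewrite only1_linear scalerDl -[in LHS]mulr_algl -scalerA.
- exact: (@scalerDr H Z (only1 F) y z).
- rewrite scalerA; suff -> : only1 (ltmul F (licomul 1 h)) = only1 F * h by [].
  rewrite -[licomul 1 h]/(ltpure1 h).
  move: F; apply: (@tpow_ext k H 1 H).
  + exact: (linear_comp only1_linear (ltmul_linear_l _)).
  + by move=> a F G; rewrite only1_linear mulrDl scalerAl.
  by move=> f; rewrite ltmul_pure !only1_pure !ffunE.
Qed.

Lemma lower_pure F z : lower (lhpure F z) = only1 F *: z.
Proof. exact: lhextend_pure lower_balanced F z. Qed.

Lemma lowerP a w w' : lower (a *: w + w') = a%:A *: lower w + lower w'.
Proof. exact: lhextend_linear lower_balanced a w w'. Qed.

Lemma lower_unit1 z : lower (unit1 z) = z.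
Proof. by rewrite lower_pure only1_pure ffunE scale1r. Qed.

Lemma unit1P (a : k) z z' : unit1 (a%:A *: z + z') = a *: unit1 z + unit1 z'.
Proof. by rewrite /unit1 lhpureDr (balanced_scalar (@lhpure_balanced k H Z 1)). Qed.

Lemma unit1_0 : unit1 0 = 0.
Proof. by have := unit1P (-1) 0 0; rewrite scaler0 addr0 scaleN1r addNr. Qed.

Lemma unit1_H (f : {ffun 'I_1 -> H}) z : unit1 (f 0 *: z) = lhact (ltpure f) (unit1 z).
Proof.
rewrite /unit1 lhact_pure ltmul_pure -lhpureH ltmul1l; congr (lhpure (ltpure _) _).
by apply/ffunP => i; rewrite !ffunE ord1 mulr1.
Qed.

Lemma unit1_lower w : unit1 (lower w) = w.
Proof.
move: w; apply: (@htens_ext k H Z 1 (htens Z 1)) => // [a w w'|t z].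
  by rewrite lowerP unit1P.
rewrite lower_pure only1_pure unit1_H lhact_pure ltmul_pure; congr (lhpure (ltpure _) _).
by apply/ffunP => i; rewrite !ffunE mulr1.
Qed.

Lemma lower_lhact f w : lower (lhact (ltpure f) w) = f 0 *: lower w.
Proof. by rewrite -[w in LHS]unit1_lower -unit1_H lower_unit1. Qed.
End OneModule.

Lemma lower_lhmap (Y Z : lmodType H) (phi : {linear Y -> Z}) w : lower (lhmap phi w) = phi (lower w).
Proof. by rewrite -[w in LHS]unit1_lower lhmap_pure lower_unit1. Qed.
Lemma unit1_lhmap (Y Z : lmodType H) (phi : {linear Y -> Z}) y : lhmap phi (unit1 y) = unit1 (phi y).
Proof. exact: lhmap_pure. Qed.
End DegreeOne.

(** * Composition of cochains of arbitrary degree *)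

Section NijenhuisRichardsonFormulas.
Variables (k : fieldType) (H : cocommHopfType k) (V : lmodType H).

Definition fcons n (e : V) (y : {ffun 'I_n -> V}) : {ffun 'I_n.+1 -> V} :=
  [ffun i => if unlift ord0 i is Some j then y j else e].

(** Skew-symmetry is left out because the nilpotency argument treats the summands of a shuffle sum
    one at a time, and a single summand need not be skew-symmetric. *)
Record hmultilinear n (P : precochain V n) : Prop := HMultilinear {
  hmultilinear_lin : forall (x : {ffun 'I_n.+1 -> V}) i (a : k) u v,
    P (ffupd x i (a%:A *: u + v)) = a *: P (ffupd x i u) + P (ffupd x i v);
  hmultilinear_H : forall (f : {ffun 'I_n.+1 -> H}) (x : {ffun 'I_n.+1 -> V}),
    P [ffun i => f i *: x i] = lhact (ltpure f) (P x)
}.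

Lemma cochain_hmultilinear n (P : precochain V n) : is_cochain P -> hmultilinear P.
Proof. by case=> c1 c2 c3; split=> // f x; rewrite c2 hactE tpureE. Qed.

Lemma fcons_upd n e e' (y : {ffun 'I_n -> V}) : ffupd (fcons e y) ord0 e' = fcons e' y.
Proof. by apply/ffunP => i; rewrite !ffunE; case: unliftP => [j ->|->]. Qed.

Lemma nr_compE m n (Q : precochain V n) (w : htens V m.+1) y :
  nr_comp Q w y = lhextend (fun F e => linsl F (Q (fcons e y))) w.
Proof.
rewrite /nr_comp hextendE; congr (lhextend _ w).
by apply/funext => F; apply/funext => e; rewrite inslE.
Qed.

Section Balanced.
Variables (m n : nat) (Q : precochain V n) (y : {ffun 'I_n -> V}).
Hypothesis mQ : hmultilinear Q.

Lemma nr_comp_balanced : balanced (fun (F : tpow H m.+1) e => linsl F (Q (fcons e y))).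
Proof.
split=> [e|F e e'|F h e].
- exact: linsl_linear_l.
- have := hmultilinear_lin mQ (fcons 0 y) ord0 1 e e'; rewrite !fcons_upd !scale1r => ->.
  by rewrite (linD (linsl_linear F)).
(* Scaling the first argument by [h] is the action of the tensor with [h] in slot 0 and 1 elsewhere;
   after [linsl_hact] only the factors 1 remain outside. *)
pose f : {ffun 'I_n.+1 -> H} := [ffun i => if unlift ord0 i is Some j then 1 else h].
have -> : fcons (h *: e) y = [ffun i => f i *: fcons e y i].
  by apply/ffunP => i; rewrite !ffunE; case: unliftP => // j; rewrite scale1r.
rewrite (hmultilinear_H mQ) linsl_hact ffunE unlift_none.
set G := ltcat _ _; suff -> : G = ltpure [ffun=> 1] by rewrite lhact1.
rewrite /G ltcat_pure; congr ltpure; apply/esym/catfP => i; rewrite !ffunE //.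
by rewrite liftK.
Qed.

Lemma nr_comp_pure F e : nr_comp Q (lhpure F e : htens V m.+1) y = linsl F (Q (fcons e y)).
Proof. by rewrite nr_compE (lhextend_pure nr_comp_balanced). Qed.

Lemma nr_comp_lhmap (X : lmodType H) (phi : {linear X -> V}) (w : htens X m.+1) :
  nr_comp Q (lhmap phi w) y = lhextend (fun F e => linsl F (Q (fcons (phi e) y))) w.
Proof.
rewrite nr_compE; move: w; apply: (@htens_ext k H X m.+1 (htens V (m.+1 + n))) => [||t x].
- exact: (linear_comp (lhextend_linear nr_comp_balanced) (@lhmap_linear k H X V m.+1 phi)).
- have b := nr_comp_balanced; apply: lhextend_linear; split=> [e|F e e'|F h e].
  + exact: linsl_linear_l.
  + by rewrite linearD (balancedr b).
  + by rewrite linearZ (balancedH b).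
rewrite lhmap_pure (lhextend_pure nr_comp_balanced) lhextend_pure //.
have b := nr_comp_balanced; split=> [e|F e e'|F h e].
+ exact: linsl_linear_l.
+ by rewrite linearD (balancedr b).
+ by rewrite linearZ (balancedH b).
Qed.
End Balanced.

Lemma linsl_unit n (w : htens V n.+1) :
  linsl (ltpure [ffun=> 1] : tpow H 1) w = w :> htens V (1 + n).
Proof.
move: w; apply: (@htens_ext k H V n.+1 (htens V (1 + n))) => //; first exact: linsl_linear.
move=> t z; rewrite linsl_pure ltmul1l; congr lhpure.
rewrite -[licomul 1 _]/(ltpure1 (t ord0)) ltcat_pure; congr ltpure.
apply/esym/catfP => i; rewrite !ffunE; congr (t _); apply: val_inj => //=.
by rewrite ord1.
Qed.
End NijenhuisRichardsonFormulas.

(** * Brackets of cochains of degrees 0 and 1 *)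

Section LowDegreeBrackets.
Variables (k : fieldType) (H : cocommHopfType k) (V : lmodType H).
Implicit Types (A B : V -> V -> htens V 2) (x : V).
Notation sw := (lhreindex (tperm 0 1)).

Definition cochain2 A : precochain V 1 := fun t => A (t 0) (t 1).
Definition cochain1 (b : V -> V) : precochain V 0 := fun t => unit1 (b (t 0)).

Lemma cochain2_hmultilinear A : pseudobilinear A -> hmultilinear (cochain2 A).
Proof.
move=> bA; split=> [t i a u v|f t].
  rewrite /cochain2 !ffunE; have [->|->] := I2P i; rewrite /=.
    exact: (pseudobilinearl bA).
  exact: (pseudobilinearr bA).
rewrite /cochain2 !ffunE pbH //; congr (lhact (ltpure _) _).
by apply/ffunP => i; rewrite !ffunE; have [->|->] := I2P i.
Qed.

Lemma cochain2_cochain A : pseudobilinear A -> (forall x y, A y x = - sw (A x y)) ->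
  is_cochain (cochain2 A).
Proof.
move=> bA sA; have [h1 h2] := cochain2_hmultilinear bA; split=> //.
  by move=> f t; rewrite h2 hactE tpureE.
move=> t i j ij.
have [i0 j1] : i = 0 /\ j = 1.
  by move: ij; have [->|->] := I2P i; have [->|->] := I2P j.
by rewrite hreindexE /cochain2 !ffunE i0 j1 tpermL tpermR; exact: sA.
Qed.

Lemma cochain2D A B : cochain2 A + cochain2 B = cochain2 (fun x y => A x y + B x y).
Proof. by []. Qed.
Lemma cochain2N A : - cochain2 A = cochain2 (fun x y => - A x y).
Proof. by []. Qed.
Lemma cochain2Z a A : a *: cochain2 A = cochain2 (fun x y => a *: A x y).
Proof. by []. Qed.
Lemma eq_cochain2 A B : (forall x y, A x y = B x y) -> cochain2 A = cochain2 B.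
Proof. by move=> e; apply/funext => t; rewrite /cochain2 e. Qed.

Lemma cochain1_cochain (b : {linear V -> V}) : is_cochain (cochain1 b).
Proof.
split=> [t i a u v|f t|t i j].
- by rewrite /cochain1 !ffunE !ord1 /= linearP unit1P.
- by rewrite /cochain1 !ffunE linearZ unit1_H hactE tpureE.
- by rewrite !ord1.
Qed.

Lemma cochain1P (P : precochain V 0) : is_cochain P ->
  exists b : {linear V -> V}, P = cochain1 b.
Proof.
move=> /cochain_hmultilinear[Pl PH].
pose b (v : V) := lower (P [ffun=> v]).
have upd (v : V) : [ffun=> v] = ffupd [ffun=> 0] (0 : 'I_1) v :> {ffun 'I_1 -> V}.
  by apply/ffunP => i; rewrite !ffunE ord1.
have bH h v : b (h *: v) = h *: b v.
  have := PH [ffun=> h] [ffun=> v].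
  have -> : [ffun i => [ffun=> h] i *: [ffun=> v] i] = [ffun=> h *: v] :> {ffun 'I_1 -> V}.
    by apply/ffunP => i; rewrite !ffunE.
  by rewrite /b => ->; rewrite lower_lhact ffunE.
have lb : linear b.
  move=> h u v; rewrite -bH; move: (h *: u) => {}u.
  have := Pl [ffun=> 0] 0 1 u v; rewrite -!upd !scale1r /b => ->.
  by have := lowerP 1 (P [ffun=> u]) (P [ffun=> v]); rewrite !scale1r.
pose c := GRing.isLinear.Build H V V *:%R b lb.
pose b' : {linear V -> V} := HB.pack b c.
exists b'; apply/funext => t; rewrite /cochain1 /= /b unit1_lower; congr P.
by apply/ffunP => i; rewrite ffunE ord1.
Qed.

(** For concrete low degrees the two sums compared by the cast in [nr] are convertible, and equality
    proofs in nat are unique, so the cast is the identity. *)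
Lemma ecast_precochain n (e : n = n) (P : precochain V n) : ecast N (precochain V N) e P = P.
Proof. by rewrite eq_axiomK. Qed.

Lemma nr_ins_cochain2 A B : pseudobilinear B ->
  nr_ins (cochain2 A) (cochain2 B) =
  (fun t => shuffle_comp A B (t 0) (t 1) (t ord_max)) :> precochain V 2.
Proof.
move=> bB; apply/funext => t; rewrite /nr_ins.
have C (w : htens V 2) (y : {ffun 'I_1 -> V}) : nr_comp (cochain2 B) w y = lpcompl B w (y 0).
  rewrite nr_compE; apply: eq_lhextend => F e; congr linsl; rewrite /cochain2 !ffunE.
  rewrite unlift_none; have -> : (1 : 'I_2) = lift ord0 (0 : 'I_1) by exact: val_inj.
  by rewrite liftK.
pose F (s : 'S_3) : htens V 3 := (-1) ^+ s *: lhreindex (s^-1)%g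
  (lpcompl B (A (t (s 0)) (t (s 1))) (t (s ord_max))).
transitivity (\sum_(s in shuffles 2 1) F s).
  apply: eq_bigr => s _; rewrite hreindexE C /cochain2 !ffunE /F.
  rewrite lshift1_0 lshift1_1; congr (_ *: lhreindex _ (lpcompl B _ (t (s _)))).
  exact: val_inj.
rewrite (eq_bigl _ _ mem_shuffles21) -big_uniq /=; last by rewrite !inE !perm3P !permE.
rewrite sum_seq3.
have -> : F 1%g = lpcompl B (A (t 0) (t 1)) (t ord_max).
  by rewrite /F odd_perm1 expr0 scale1r !perm1 invg1 -[RHS]lhreindex_id; apply: eq_lhreindex => i; rewrite perm1.
have -> : F (tperm 1 ord_max) =
    - lhreindex (tperm 1 ord_max) (lpcompl B (A (t 0) (t ord_max)) (t 1)).
  by rewrite /F odd_tperm expr1 scaleN1r tpermV tpermL tpermR tpermD.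
have -> // : F cycle3 = lhreindex (@ord_pred 3) (lpcompl B (A (t 1) (t ord_max)) (t 0)).
rewrite /F odd_cycle3 expr0 scale1r.
have -> : cycle3 0 = 1 by rewrite permE; exact: val_inj.
have -> : cycle3 1 = ord_max by rewrite permE; exact: val_inj.
have -> : cycle3 ord_max = 0 by rewrite permE; exact: val_inj.
by apply: eq_lhreindex => i; apply: (@perm_inj _ cycle3); rewrite permKV permE ord_predK.
Qed.

Section Insertion1.
Variable b : {linear V -> V}.

Lemma nr_ins_cochain1 n (P : precochain V n) : hmultilinear P ->
  nr_ins (cochain1 b) P = (fun t : {ffun 'I_(1 + n) -> V} =>
    \sum_(s in shuffles 1 n) (-1) ^+ s *: lhreindex (s^-1)%g
      (P (fcons (b (t (s (lshift n (0 : 'I_1))))) [ffun j => t (s (rshift 1 j))]) : htens V (1 + n)))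
  :> precochain V n.
Proof.
move=> mP; apply/funext => t; apply: eq_bigr => s _; congr (_ *: _).
by rewrite hreindexE /cochain1 ffunE (nr_comp_pure _ mP) linsl_unit.
Qed.

(** Of the two shuffles the transposition carries a sign and a swap of factors; skew-symmetry of [A]
    turns it into the insertion of [b] in the second slot. *)
Lemma nr_ins_cochain12 A : pseudobilinear A -> (forall x y, A y x = - sw (A x y)) ->
  nr_ins (cochain1 b) (cochain2 A) = cochain2 (fun x y => A (b x) y + A x (b y)) :> precochain V 1.
Proof.
move=> bA sA; rewrite nr_ins_cochain1; last exact: cochain2_hmultilinear.
apply/funext => t.
pose F (s : 'S_2) : htens V 2 := (-1) ^+ s *: lhreindex (s^-1)%g (A (b (t (s 0))) (t (s 1))).
transitivity (\sum_(s in shuffles 1 1) F s).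
  apply: eq_bigr => s _; congr (_ *: lhreindex _ _); rewrite /cochain2 !ffunE unlift_none.
  have -> : (1 : 'I_2) = lift ord0 (0 : 'I_1) by exact: val_inj.
  rewrite liftK ffunE; congr (A (b (t (s _))) (t (s _))); exact: val_inj.
rewrite (eq_bigl _ _ mem_shuffles11) -big_uniq /=; last by rewrite !inE perm2P !permE.
rewrite sum_seq2.
have -> : F 1%g = A (b (t 0)) (t 1).
  by rewrite /F odd_perm1 expr0 scale1r !perm1 invg1 -[RHS]lhreindex_id; apply: eq_lhreindex => i; rewrite perm1.
have -> // : F (tperm 0 1) = A (t 0) (b (t 1)).
by rewrite /F odd_tperm expr1 scaleN1r tpermV tpermL tpermR (sA _ (t 0)).
Qed.

Lemma nr_ins_cochain21 A :
  nr_ins (cochain2 A) (cochain1 b) = cochain2 (fun x y => lhmap b (A x y)) :> precochain V 1.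
Proof.
apply/funext => t.
have C (w : htens V 2) y : nr_comp (cochain1 b) w y = lhmap b w :> htens V 2.
  rewrite nr_compE; apply: eq_lhextend => F e; rewrite /cochain1 ffunE unlift_none.
  rewrite (@linsl_pure k H V 1 0) ffunE licomul1E ltmul1.
  move: F; apply: (@tpow_ext k H 2 (htens V 2)).
  - exact: (linear_comp (@lhpure_linear k H V 2 _) (@ltcat_linear_l k H 2 0 _)).
  - exact: lhpure_linear.
  move=> f; rewrite (@ltcat_pure k H 2 0); congr (lhpure (ltpure _) _).
  by apply/esym/(@catfP k H 2 0) => [i|[]//]; congr (f _); exact: val_inj.
pose F (s : 'S_2) : htens V 2 := (-1) ^+ s *: lhreindex (s^-1)%g (lhmap b (A (t (s 0)) (t (s 1)))).
transitivity (\sum_(s in shuffles 2 0) F s).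
  apply: eq_bigr => s _; rewrite hreindexE C /cochain2 !ffunE /F.
  by rewrite lshift0_0 lshift0_1.
rewrite (eq_bigl _ _ mem_shuffles20) -big_uniq //= big_seq1 /F odd_perm1 expr0 scale1r !perm1.
by rewrite -[RHS]lhreindex_id; apply: eq_lhreindex => i; by rewrite invg1 perm1.
Qed.

(** Minus the natural action of the endomorphism [b] on the operation [A]; by [nr_cochain12] this is
    the bracket with [b]. *)
Definition ad1 A x y : htens V 2 := A (b x) y + A x (b y) - lhmap b (A x y).

Lemma nr_cochain12 A : pseudobilinear A -> (forall x y, A y x = - sw (A x y)) ->
  nr (cochain1 b) (cochain2 A) = cochain2 (ad1 A) :> precochain V 1.
Proof.
move=> bA sA; rewrite /nr muln1 expr0 scale1r nr_ins_cochain12 // nr_ins_cochain21.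
by rewrite (ecast_precochain (n := 1)).
Qed.

Lemma nr_cochain21 A : pseudobilinear A -> (forall x y, A y x = - sw (A x y)) ->
  nr (cochain2 A) (cochain1 b) = - cochain2 (ad1 A) :> precochain V 1.
Proof.
move=> bA sA; rewrite /nr muln0 expr0 scale1r nr_ins_cochain12 // nr_ins_cochain21.
rewrite (ecast_precochain (n := 1)); apply/funext => t.
by rewrite -[LHS]/(lhmap b (A (t 0) (t 1)) - (A (b (t 0)) (t 1) + A (t 0) (b (t 1)))) -[RHS]/(- ad1 A (t 0) (t 1)) /ad1 opprB.
Qed.

End Insertion1.

Lemma nr_cochain22 A B : pseudobilinear A -> pseudobilinear B ->
  nr (cochain2 A) (cochain2 B) =
  (fun t => shuffle_comp A B (t 0) (t 1) (t ord_max) + shuffle_comp B A (t 0) (t 1) (t ord_max))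
  :> precochain V 2.
Proof.
move=> bA bB; rewrite /nr muln1 expr1 scaleN1r opprK !nr_ins_cochain2 //.
by rewrite (ecast_precochain (n := 2)).
Qed.
End LowDegreeBrackets.

(** * Maurer-Cartan elements *)

Section MaurerCartan.
Variables (k : fieldType) (H : cocommHopfType k) (L M : liePseudoalg H).
Local Notation V := (LM L M).
Local Notation iL := (@inL k H L M).
Local Notation iM := (@inM k H L M).
Notation sw := (lhreindex (tperm 0 1)).
Notation hL := (lhmap iL).
Notation hM := (lhmap iM).
Implicit Types (p q : cocycle_data L M).

Lemma rho_lie_sum : @rhoL k H L M + @rhoM k H L M = cochain2 (@lie_sum k H L M).
Proof. by apply/funext => t; rewrite /cochain2 /lie_sum -!hmapE. Qed.

(** The zero pair is a cocycle and its total bracket is [lie_sum], so this is an instance of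
    [total_jacobi]. *)
Lemma lie_sum_jacobi a b c : jacobiator (@lie_sum k H L M) a b c = 0.
Proof.
pose p0 : cocycle_data L M := (fun _ _ => 0, fun _ _ => 0).
have g0 : admissible p0.
  by split=> [|x y|]; [exact: pb_zero| rewrite (lin0 (@swap_linear k H M 0)) oppr0|exact: pb_zero].
have -> : @lie_sum k H L M = total p0.
  apply/funext => u; apply/funext => v; rewrite /total /cochain_of /= !(lin0 (@swap_linear k H M 0)).
  by rewrite subr0 addr0 (lin0 (@lhmap_linear k H M V 2 iM)) addr0.
have r0 (X Y : lmodType H) (x : X) (w : htens Y 2) : @lpcompr k H X Y M (fun _ _ => 0) x w = 0.
  by rewrite -[RHS](@lhextend0 k H Y 2 (htens M 3) w); apply: eq_lhextend => F d; exact: lin0 (linsr_linear F).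
have l0 (X Y : lmodType H) (y : Y) (w : htens X 2) : @lpcompl k H X Y M (fun _ _ => 0) w y = 0.
  by rewrite -[RHS](@lhextend0 k H X 2 (htens M 3) w); apply: eq_lhextend => F d; exact: lin0 (@linsl_linear k H M 1 1 F).
have lsw := @swap_linear k H M 1; have bM := @pbr_bilinear k H M.
apply: (proj1 (total_jacobi g0)); apply/is_nab_cocycleP; split=> //.
- move=> x u v; rewrite /derivation_defect /= r0 (lin0 (lpcompl_linear bM v)).
  by rewrite (lin0 (lpcompr_linear u bM)) (lin0 lsw) subr0 addr0.
- move=> x y u; rewrite /curvature_defect /= !r0 l0 (lin0 (lpcompl_linear bM u)).
  by rewrite (lin0 lsw) subr0 !addr0.
- move=> x y z; rewrite /cocycle_defect /= !r0 (lin0 lsw) !subr0.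
  by rewrite (lin0 (lhreindex_linear (@ordS_inj 3))) !addr0.
Qed.

(** The Jacobiator of [total p] is quadratic in the bracket: the part without [p] vanishes by
    [lie_sum_jacobi], the mixed part is the differential, and the part quadratic in [p] is half of
    the self-bracket, 2 being invertible in characteristic 0. *)
Lemma MC_equation p : [pchar k]%R =i pred0 -> admissible p ->
  (dgla_diff (cochain2 (cochain_of p))
     + 2%:R^-1 *: (nr (cochain2 (cochain_of p)) (cochain2 (cochain_of p)) : precochain V 2) = 0)
  <-> is_nab_cocycle p.
Proof.
move=> char0 gp; apply: iff_trans (iff_sym (total_jacobi gp)).
have bS := @lie_sum_pb k H L M; have bC := cochain_of_pb gp; have bT := total_pb gp.
have n2 : 2%:R != 0 :> k.
  by have := char0 2; rewrite !inE /= => /negbT.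
set E := (X in X = 0 <-> _).
have -> : E = (fun t => jacobiator (total p) (t 0) (t 1) (t ord_max)).
  rewrite /E /dgla_diff rho_lie_sum !nr_cochain22 //; apply/funext => t.
  set x := t 0; set y := t 1; set z := t ord_max; set S := @lie_sum k H L M; set C := cochain_of p.
  rewrite -[LHS]/(shuffle_comp S C x y z + shuffle_comp C S x y z +
    2%:R^-1 *: (shuffle_comp C C x y z + shuffle_comp C C x y z)).
  rewrite -mulr2n -scaler_nat scalerA mulVf // scale1r.
  have -> : jacobiator (total p) x y z = shuffle_comp S S x y z + shuffle_comp S C x y z +
      (shuffle_comp C S x y z + shuffle_comp C C x y z).
    by apply: etrans (shuffle_compDl S C x y z bT) _; congr (_ + _); exact: shuffle_compDr.
  have -> : shuffle_comp S S x y z = 0 by exact: lie_sum_jacobi.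
  by apply: etrans (esym (addrA _ _ _)) _; congr (_ + _); exact: esym (add0r _).
split=> [E0 a b c|J]; last by apply/funext => t; rewrite J.
pose t : {ffun 'I_3 -> V} := [ffun i : 'I_3 => if i == 0 then a else if i == 1 then b else c].
by have := congr1 (fun f => f t) E0; rewrite /= !ffunE.
Qed.

Lemma card_set2 (S : {set 'I_2}) : #|S| = ((0%R \in S) + (1%R \in S))%N.
Proof.
rewrite -sum1_card big_mkcond /= !big_ord_recl big_ord0 /=.
have -> : lift ord0 ord0 = 1%R :> 'I_2 by exact: val_inj.
by have -> : ord0 = 0%R :> 'I_2 by []; case: ifP => _; case: ifP.
Qed.

Let lM := @lhmap_linear k H M V 2 iM.

Lemma cochain_ofD p q a b : cochain_of (fun x y => p.1 x y + q.1 x y, fun x u => p.2 x u + q.2 x u) a b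
  = cochain_of p a b + cochain_of q a b.
Proof.
rewrite /cochain_of /= -(linD lM) (linD (@swap_linear k H M 0)); congr (hM _).
move: (p.1 _ _) (q.1 _ _) (p.2 _ _) (q.2 _ _) (lhreindex _ _) (lhreindex _ _) => c1 d1 c2 d2 c3 d3.
by rewrite opprD (addrACA c1); exact: addrACA.
Qed.

Lemma bidegree_mixed (psi : L -> M -> htens M 2) : pseudobilinear psi ->
  bidegree 1 (cochain2 (cochain_of (fun _ _ => 0, psi)) : precochain V 1).
Proof.
move=> bpsi; have gp : admissible ((fun _ _ => 0, psi) : cocycle_data L M).
  by split=> [|x y|//]; [exact: pb_zero|rewrite (lin0 (@swap_linear k H M 0)) oppr0].
split.
- exact: cochain2_cochain (cochain_of_pb gp) (cochain_of_skew gp).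
- by move=> x; eexists; rewrite hmapE /cochain2 /cochain_of; reflexivity.
move=> S x hx; rewrite card_set2; move: (hx 0) (hx 1).
rewrite /cochain2 /cochain_of /=.
by case: ifP => _ [a ->]; case: ifP => _ [c ->] // _ /=;
  rewrite ?(pb0l bpsi) ?(pb0r bpsi) ?(lin0 (@swap_linear k H M 0)) ?subr0 ?addr0 (lin0 lM).
Qed.

Lemma bidegree_pure (chi : L -> L -> htens M 2) : pseudobilinear chi ->
  (forall x y, chi y x = - sw (chi x y)) ->
  bidegree 2 (cochain2 (cochain_of (chi, fun _ _ => 0)) : precochain V 1).
Proof.
move=> bchi schi; have gp : admissible ((chi, fun _ _ => 0) : cocycle_data L M).
  by split=> //; exact: pb_zero.
split.
- exact: cochain2_cochain (cochain_of_pb gp) (cochain_of_skew gp).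
- by move=> x; eexists; rewrite hmapE /cochain2 /cochain_of; reflexivity.
move=> S x hx; rewrite card_set2; move: (hx 0) (hx 1).
rewrite /cochain2 /cochain_of /= (lin0 (@swap_linear k H M 0)) subr0 addr0.
by case: ifP => _ [a ->]; case: ifP => _ [c ->] // _ /=;
  rewrite ?(pb0l bchi) ?(pb0r bchi) (lin0 lM).
Qed.

Lemma dgla1_cochain_of p : admissible p -> dgla (cochain2 (cochain_of p) : precochain V 1).
Proof.
case=> b1 s1 b2.
(* Bidegree 1 carries psi and bidegree 2 carries chi; the sum runs over no other [m]. *)
exists (fun m => if m == 1%N then cochain2 (cochain_of (fun _ _ => 0, p.2))
  else cochain2 (cochain_of (p.1, fun _ _ => 0))).
  move=> [|[|[|m]]] //= _; first exact: bidegree_mixed.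
  exact: bidegree_pure.
rewrite big_nat_recl // big_nat1 /= cochain2D; apply: eq_cochain2 => a b.
rewrite -cochain_ofD; congr (cochain_of _ a b); case: p {b1 s1 b2} => chi psi /=.
by congr (_, _); apply/funext => x; apply/funext => y; rewrite ?add0r ?addr0.
Qed.

Lemma is_cochainD (W : lmodType H) n (P Q : precochain W n) :
  is_cochain P -> is_cochain Q -> is_cochain (P + Q).
Proof.
move=> [p1 p2 p3] [q1 q2 q3].
have E t : (P + Q) t = P t + Q t by [].
split=> [x i a u v|f x|x i j ij].
- by rewrite !E p1 q1 scalerDr addrACA.
- by rewrite !E p2 q2 hactE (linD (@lhact_linear k H W n.+1 _)).
- rewrite !E (p3 _ _ _ ij) (q3 _ _ _ ij) hreindexE -opprD.
  by rewrite (linD (lhreindex_linear (@perm_inj _ (tperm i j)))).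
Qed.

(** chi and psi are the restrictions to pairs from L, L and from L, M. The restriction to M, L
    follows by skew-symmetry, and the one to M, M is zero because the bidegrees in the sum are
    positive. *)
Lemma dgla1P (c : precochain V 1) : dgla c ->
  exists2 p, admissible p & c = cochain2 (cochain_of p).
Proof.
case=> d dm; rewrite big_nat_recl // big_nat1 => ->.
have := dm 1%N isT; have := dm 2%N isT.
move: (d 1%N) (d 2%N) => P1 P2 [cP2 vP2 zP2] [cP1 vP1 zP1] {d dm c}.
set P := P1 + P2.
have cP : is_cochain P by exact: is_cochainD.
have [lP HP] := cochain_hmultilinear cP.
have vP t : P t = hM (lhmap (@outM k H L M) (P t)).
  have -> : P t = P1 t + P2 t by [].
  by have [w1 ->] := vP1 t; have [w2 ->] := vP2 t; rewrite hmapE -(linD lM) lhmap_outMK.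
pose t2 (a b : V) : {ffun 'I_2 -> V} := [ffun i => if i == 0 then a else b].
have ut0 a b a' : ffupd (t2 a b) 0 a' = t2 a' b.
  by apply/ffunP => i; rewrite !ffunE; case: eqP.
have ut1 a b b' : ffupd (t2 a b) 1 b' = t2 a b'.
  by apply/ffunP => i; rewrite !ffunE; have [->|->] := I2P i.
pose Q a b := P (t2 a b).
have PQ t : P t = Q (t 0) (t 1).
  by congr P; apply/ffunP => i; rewrite ffunE; have [->|->] := I2P i.
have bQ : pseudobilinear Q.
  apply: pseudobilinearP => [a x x' y|a x y y'|f g x y].
  - by have := lP (t2 0 y) 0 a x x'; rewrite !ut0.
  - by have := lP (t2 x 0) 1 a y y'; rewrite !ut1.
  rewrite /Q -HP; congr P; apply/ffunP => i; rewrite !ffunE.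
  by case: eqP.
have sQ x y : Q y x = - sw (Q x y).
  have := cochain_skew cP (t2 x y) (i := 0) (j := 1) erefl; rewrite hreindexE => <-.
  congr P; apply/ffunP => i; rewrite !ffunE; have [->|->] := I2P i; rewrite ?tpermL ?tpermR //.
have zQ u v : Q (iM u) (iM v) = 0.
  have h i : if i \in (finset.set0 : {set 'I_2}) then exists a, t2 (iM u) (iM v) i = iL a
             else exists w, t2 (iM u) (iM v) i = iM w.
    by rewrite inE ffunE; case: ifP; [exists u|exists v].
  have -> : Q (iM u) (iM v) = P1 (t2 (iM u) (iM v)) + P2 (t2 (iM u) (iM v)) by [].
  by rewrite (zP1 _ _ h) ?(zP2 _ _ h) ?cards0 // addr0.
have vQ a b : Q a b = hM (lhmap (@outM k H L M) (Q a b)) by exact: vP.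
exists (fun x y => lhmap (@outM k H L M) (Q (iL x) (iL y)),
        fun x u => lhmap (@outM k H L M) (Q (iL x) (iM u))).
  split=> /=.
  - exact: pb_hmap (pb_comp iL iL bQ).
  - move=> x y; rewrite -lhmap_hreindex; last exact: perm_inj.
    by rewrite -(linN (@lhmap_linear k H V M 2 (@outM k H L M))) -sQ.
  - exact: pb_hmap (pb_comp iL iM bQ).
apply/funext => t; rewrite PQ /cochain2; move: (t 0) (t 1) => a b.
rewrite /cochain_of /= (linB lM) (linD lM) [hM (sw _)]lhmap_hreindex; last exact: perm_inj.
rewrite -!vQ.
rewrite [in LHS](split_LM a) [in LHS](split_LM b) (pbDl bQ) !(pbDr bQ) zQ addr0; congr (_ + _).
exact: sQ.
Qed.
End MaurerCartan.

(** * Gauge transformations *)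

Section Gauge.
Variables (k : fieldType) (H : cocommHopfType k) (L M : liePseudoalg H).
Local Notation V := (LM L M).
Local Notation iL := (@inL k H L M).
Local Notation iM := (@inM k H L M).
Local Notation oL := (@outL k H L M).
Local Notation oM := (@outM k H L M).
Notation sw := (lhreindex (tperm 0 1)).
Notation hL := (lhmap iL).
Notation hM := (lhmap iM).
Implicit Types (p q : cocycle_data L M).

Definition gauge_map (phi : {linear L -> M}) : {linear V -> V} := (iM \o (phi \o oL))%FUN.

Lemma gauge_mapE phi v : gauge_map phi v = iM (phi v.1). Proof. by []. Qed.

Lemma dgla0_gauge_map phi : dgla (cochain1 (gauge_map phi) : precochain V 0).
Proof.
exists (fun _ => cochain1 (gauge_map phi)); last by rewrite big_nat1.
move=> [|[|m]] // _; split; first exact: cochain1_cochain.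
  by move=> x; exists (unit1 (phi (x 0).1)); rewrite hmapE unit1_lhmap.
move=> S x hx; have := hx 0; case: ifP => S0 [a xE]; last first.
  by move=> _; rewrite /cochain1 gauge_mapE xE /= linear0 unit1_0.
have -> : S = [set: 'I_1] by apply/setP => i; rewrite ord1 S0 inE.
by rewrite cardsT card_ord.
Qed.

Lemma dgla0P (b : precochain V 0) : dgla b -> exists phi, b = cochain1 (gauge_map phi).
Proof.
case=> c /(_ 1%N isT) + ; rewrite big_nat1 => /[swap] <- [cb vb zb].
have [beta bE] := cochain1P cb.
pose phi : {linear L -> M} := (oM \o (beta \o iL))%FUN.
have betaE v : beta v = lower (b [ffun=> v]) by rewrite bE /cochain1 lower_unit1 ffunE.
exists phi; rewrite bE; apply/funext => t; rewrite /cochain1; congr unit1; move: (t 0) => v.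
rewrite gauge_mapE [v in LHS]split_LM linearD.
have -> : beta (iM v.2) = 0.
  (* The empty set says that the only argument comes from M, which bidegree 1 excludes. *)
  rewrite betaE (zb finset.set0) ?cards0 //.
    by apply: (addrI (lower (0 : htens V 1))); have := lowerP 1 (0 : htens V 1) 0; rewrite scaler0 !addr0 !scale1r => <-.
  by move=> i; rewrite inE ffunE; exists v.2.
rewrite addr0 betaE; have [w wE] := vb [ffun=> iL v.1].
by rewrite /phi /= betaE wE hmapE lower_lhmap.
Qed.

Section Action.
Variable phi : {linear L -> M}.
Let b := gauge_map phi.
Let lM := @lhmap_linear k H M V 2 iM.
Let lsw := @swap_linear k H M 0.
Let bL := @pbr_bilinear k H L.
Let bM := @pbr_bilinear k H M.

(** The bracket with [gauge_map phi] in terms of pairs. The chi component is lost, since inserting a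
    value in M into chi gives zero, and psi moves to the chi component; two applications therefore
    give zero. *)
Definition ad_pair p : cocycle_data L M :=
  (fun x y => p.2 x (phi y) - sw (p.2 y (phi x)), fun _ _ => 0).

(** The pair encoding the bracket of [gauge_map phi] with rho, that is, minus the differential of
    the element of degree 0, see [dgla_diff_gauge]. *)
Definition ad_lie_sum : cocycle_data L M :=
  (fun x y => - lhmap phi (pbr x y), fun x u => pbr (phi x) u).

Definition gauge_transform p : cocycle_data L M :=
  (fun x y => p.1 x y + (p.2 x (phi y) - sw (p.2 y (phi x)))
     - lhmap phi (pbr x y) + pbr (phi x) (phi y),
   fun x u => p.2 x u + pbr (phi x) u).

Let lhmap_gauge_inM n (w : htens M n) : lhmap b (hM w) = 0.
Proof.
rewrite lhmap_comp -[RHS](@lhmap_zero k H M V n w); apply: eq_lhmap => u.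
by rewrite -[LHS]/(iM (phi 0)) !linear0.
Qed.

Lemma ad1_cochain_of p : admissible p ->
  forall x y, ad1 b (cochain_of p) x y = cochain_of (ad_pair p) x y.
Proof.
case=> b1 s1 b2 x y.
rewrite /ad1 [X in lhmap b X]/cochain_of lhmap_gauge_inM subr0.
rewrite /cochain_of /= (pb0l b1) (pb0r b1) !(pb0l b2) (lin0 lsw) !subr0 !addr0 !add0r.
by rewrite -(linD lM); congr hM; exact: addrC.
Qed.

Lemma ad1_lie_sum x y : ad1 b (@lie_sum k H L M) x y = cochain_of ad_lie_sum x y.
Proof.
rewrite /ad1 [X in lhmap b X]/lie_sum (linD (@lhmap_linear k H V V 2 b)) lhmap_gauge_inM addr0.
rewrite lhmap_comp -(@lhmap_comp k H L M V 2 iM phi).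
rewrite /lie_sum /cochain_of /= (pb0l bL) (pb0r bL) (lin0 (@lhmap_linear k H L V 2 iL)) !add0r.
rewrite (pbr_swap _ x.2) -(linD lM) -(linB lM); congr hM.
exact: etrans (addrC _ _) (addrA _ _ _).
Qed.

Lemma ad_pair_admissible p : admissible p -> admissible (ad_pair p).
Proof.
case=> b1 s1 b2; have bp := pb_comp (@idfun L) phi b2.
split=> [|x y|]; last exact: pb_zero.
  exact: pb_add bp (pb_opp (pb_flip bp)).
by rewrite /= (linB lsw) swapK opprB.
Qed.

Let ad_cochain_of p : admissible p ->
  ad (cochain1 b) (cochain2 (cochain_of p)) = cochain2 (cochain_of (ad_pair p)) :> precochain V 1.
Proof.
move=> gp; rewrite /ad nr_cochain12; [|exact: cochain_of_pb|exact: cochain_of_skew].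
by apply: eq_cochain2 => x y; rewrite ad1_cochain_of.
Qed.

Let zero_pair : cocycle_data L M := (fun _ _ => 0, fun _ _ => 0).

Let zero_admissible : admissible zero_pair.
Proof. by split=> [|x y|]; [exact: pb_zero|rewrite /= (lin0 lsw) oppr0|exact: pb_zero]. Qed.

Let cochain_of_zero : cochain2 (cochain_of zero_pair) = 0 :> precochain V 1.
Proof.
apply/funext => t; rewrite /cochain2 /cochain_of /= (lin0 lsw) subr0 addr0.
exact: lin0 lM.
Qed.

Let ad_pair_0 p : p.2 = (fun _ _ => 0) -> ad_pair p = zero_pair.
Proof.
move=> p2; rewrite /ad_pair p2 /zero_pair; congr (_, _).
by apply/funext => x; apply/funext => y; rewrite (lin0 lsw) subr0.
Qed.

Let ad_zero : ad (cochain1 b) 0 = 0 :> precochain V 1.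
Proof. by rewrite -cochain_of_zero (ad_cochain_of zero_admissible) (@ad_pair_0 zero_pair erefl). Qed.

Let iter_ad p r : admissible p -> (1 < r)%N ->
  iter r (@ad _ _ _ _ (cochain1 b) 1) (cochain2 (cochain_of p)) = 0.
Proof.
move=> gp r1.
have [s ->] : exists s, r = s.+2 by case: r r1 => [|[|s]] // _; exists s.
elim: s => [|s IH]; last by rewrite iterS IH ad_zero.
rewrite -[LHS]/(ad (cochain1 b) (ad (cochain1 b) (cochain2 (cochain_of p)))).
rewrite (ad_cochain_of gp) (ad_cochain_of (ad_pair_admissible gp)).
by rewrite (@ad_pair_0 (ad_pair p) erefl) cochain_of_zero.
Qed.

Let exp_sum (F : nat -> precochain V 1) : (forall r, (1 < r)%N -> F r = 0) ->
  \sum_(r \in [set: nat]) F r = F 0%N + F 1%N.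
Proof.
move=> F0; rewrite (fsbigTE [fset 0%N; 1%N]%fset) => [|r].
  by rewrite big_fsetU1 ?inE //= big_seq_fset1.
rewrite !inE negb_or => r01; apply: F0; move: r01; clear; by case: r => [|[|r]].
Qed.

Lemma dgla_diff_gauge :
  dgla_diff (cochain1 b : precochain V 0) = - cochain2 (cochain_of ad_lie_sum).
Proof.
rewrite /dgla_diff rho_lie_sum nr_cochain21; [|exact: lie_sum_pb|exact: lie_sum_skew].
congr (- _); apply: eq_cochain2; exact: ad1_lie_sum.
Qed.

(** Each series has two surviving terms. With b the element of degree 0 and rho = [lie_sum], the
    gauge term is [b, rho] + 1/2 [b, [b, rho]]: its first summand gives the terms of
    [gauge_transform] that involve brackets and are linear in [phi], its second the quadratic
    one. *)
Lemma gauge_action p : [pchar k]%R =i pred0 -> admissible p ->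
  exp_ad (cochain1 b) (cochain2 (cochain_of p)) + gauge_term (cochain1 b)
  = cochain2 (cochain_of (gauge_transform p)).
Proof.
move=> char0 gp.
have n2 : 2%:R != 0 :> k by have := char0 2; rewrite !inE /= => /negbT.
(* [p'] encodes the differential of b and is the negative of [ad_lie_sum]. *)
pose p' : cocycle_data L M := (fun x y => lhmap phi (pbr x y), fun x u => - pbr (phi x) u).
have gp' : admissible p'.
  split=> [|x y|].
  - exact: (pb_hmap phi bL).
  - rewrite /= (pbr_swap x) (linN (@lhmap_linear k H L M 2 phi)) lhmap_hreindex //; exact: perm_inj.
  - exact: pb_opp (@pb_comp k H M M M L M phi idfun (@pbr k H M) bM).
have dE : dgla_diff (cochain1 b : precochain V 0) = cochain2 (cochain_of p').
  rewrite dgla_diff_gauge cochain2N; apply: eq_cochain2 => x y.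
  rewrite /cochain_of -(linN lM) /= opprB opprD opprK (linN lsw) opprK; congr hM.
  exact: addrC.
have e01 (P Q : precochain V 1) : (0`!%:R^-1 : k) *: P + (1`!%:R^-1 : k) *: Q = P + Q.
  by rewrite fact0 invr1 !scale1r.
have e12 (P Q : precochain V 1) : (1`!%:R^-1 : k) *: P + (2`!%:R^-1 : k) *: Q = P + 2%:R^-1 *: Q.
  by rewrite (_ : 1`! = 1%N) // invr1 scale1r.
have -> : exp_ad (cochain1 b) (cochain2 (cochain_of p)) =
    cochain2 (cochain_of p) + ad (cochain1 b) (cochain2 (cochain_of p)) :> precochain V 1.
  apply: etrans (exp_sum _) _ => [r r1|]; first by rewrite (iter_ad gp r1) scaler0.
  exact: e01.
have -> : gauge_term (cochain1 b) =
    - (cochain2 (cochain_of p') + 2%:R^-1 *: ad (cochain1 b) (cochain2 (cochain_of p'))) :> precochain V 1.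
  rewrite /gauge_term dE; congr (- _).
  apply: etrans (exp_sum _) _ => [r r1|]; first by rewrite (iter_ad gp' r1) scaler0.
  exact: e12.
rewrite (ad_cochain_of gp) (ad_cochain_of gp') cochain2Z !cochain2D cochain2N cochain2D.
apply: eq_cochain2 => x y; rewrite /cochain_of -(linZ lM) -!(linD lM) -(linN lM) -(linD lM) /=.
congr hM.
(* By skew-symmetry the bracket of b with its differential produces -[phi x, phi y] twice, which the
   factor 1/2 compensates. *)
have half (A : htens M 2) : 2%:R^-1 *: (- A - A + 0 - 0) = - A.
  by rewrite addr0 subr0 -mulr2n -scaler_nat scalerA mulVf // scale1r.
have sAA : lhreindex (tperm 0 1) (pbr (phi y.1) (phi x.1)) = - pbr (phi x.1) (phi y.1).
  by rewrite (pbr_swap (phi x.1)) (linN lsw) swapK.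
rewrite (lin0 lsw) !(linN lsw) (linD lsw) sAA.
move: (pbr (phi x.1) (phi y.1)) (p.1 _ _) (p.2 x.1 y.2) (p.2 x.1 (phi y.1)) => A a s g.
move: (lhreindex _ (p.2 y.1 x.2)) (lhreindex _ (p.2 y.1 (phi x.1))) => r h.
move: (pbr _ _) (lhmap _ _) (lhreindex _ _) => m l n.
rewrite !opprK half subr0 addr0 !opprD !opprK !addrA.
by rewrite [LHS](ACl (1*4*5*6*9*2*7*3*8)).
Qed.

End Action.

(** Evaluating on pairs from L, L isolates chi and on pairs from L, M isolates psi. The hypotheses
    only concern values at zero, so that the lemma applies directly to [gauge_transform phi p] in
    [gauge_equiv_nab]. *)
Lemma cochain_of_eq p q : (forall x, p.2 x 0 = 0) -> (forall x, q.2 x 0 = 0) ->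
  (forall u, p.2 0 u = 0) -> (forall u, q.2 0 u = 0) ->
  (forall y, p.1 0 y = 0 /\ p.1 y 0 = 0) -> (forall y, q.1 0 y = 0 /\ q.1 y 0 = 0) ->
  cochain2 (cochain_of p) = cochain2 (cochain_of q) -> p = q.
Proof.
move=> p20 q20 p02 q02 p1 q1 E.
have lsw := @swap_linear k H M 0.
have Eab a b : cochain_of p a b = cochain_of q a b.
  have := congr1 (fun f => f [ffun i : 'I_2 => if i == 0 then a else b]) E.
  by rewrite /cochain2 !ffunE.
case: p q E Eab p20 q20 p02 q02 p1 q1 => [p1 p2] [q1 q2] _ Eab /= p20 q20 p02 q02 p10 q10.
congr (_, _); apply/funext => x; apply/funext => y.
  have := Eab (iL x) (iL y); rewrite /cochain_of /= !p20 !q20 (lin0 lsw) !subr0 !addr0.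
  exact: lhmap_inM_inj.
have := Eab (iL x) (iM y); rewrite /cochain_of /= (p10 x).2 (q10 x).2 p02 q02 (lin0 lsw) !subr0 !add0r.
exact: lhmap_inM_inj.
Qed.

Lemma cochain_of_inj p q : admissible p -> admissible q ->
  cochain2 (cochain_of p) = cochain2 (cochain_of q) -> p = q.
Proof.
case=> b1 _ b2 [b1' _ b2']; apply: cochain_of_eq => *.
- exact: pb0r.
- exact: pb0r.
- exact: pb0l.
- exact: pb0l.
- by rewrite pb0l ?pb0r.
- by rewrite pb0l ?pb0r.
Qed.

Lemma nab_equivP p q : nab_equiv p q <-> exists phi, p = gauge_transform phi q.
Proof.
have eq_sub (G : zmodType) (a c d : G) : a - c = d <-> a = c + d.
  by rewrite (addrC c d); split=> [<-|->]; rewrite ?subrK ?addrK.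
have assoc (G : zmodType) (a c d e f : G) : a + (c - d) - e + f = a + (c - d - e + f).
  by rewrite !addrA.
split=> [[phi [e2 e1]]|[phi pE]]; exists phi.
  case: p e1 e2 => p1 p2 /= e1 e2; congr (_, _); apply/funext => x; apply/funext => u.
    by have /eq_sub -> := e1 x u; rewrite sigma12E hmapE assoc.
  by have /eq_sub -> := e2 x u.
split=> [x u|x y]; apply/eq_sub; rewrite pE //=.
by rewrite sigma12E hmapE assoc.
Qed.

(** The map -phi works. In the equation for chi, psi is now the shifted one and contributes -2
    [phi x, phi y], which together with the quadratic term leaves the required -[phi x, phi y]. *)
Lemma nab_equiv_sym p q : admissible q -> nab_equiv p q -> nab_equiv q p.
Proof.
move=> [b1 s1 b2] /nab_equivP[phi ->].
have bM := @pbr_bilinear k H M; have lsw := @swap_linear k H M 0.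
pose c : {linear L -> M} := (\- phi)%R.
exists c; split=> [x u|x y].
  rewrite [c x]/(- phi x) (pbNl bM) /=.
  by rewrite opprD addrA subrr add0r.
rewrite sigma12E hmapE /=.
have -> : lhmap c (pbr x y) = - lhmap phi (pbr x y).
  rewrite /lhmap (lhextend_comp _ _ (linear_opp (@linear_id k (htens M 2)))).
  apply: eq_lhextend => F z; apply: (addrI (lhpure F (phi z))).
  rewrite subrr -lhpureDr subrr; apply: (addrI (lhpure F (0 : M))).
  by rewrite -lhpureDr !addr0.
rewrite !(pbNr b2) !(pbNr bM) !(pbNl bM) (linD lsw) !(linN lsw).
have -> : lhreindex (tperm 0 1) (pbr (phi y) (phi x)) = - pbr (phi x) (phi y).
  by rewrite (pbr_swap (phi x)) (linN lsw) swapK.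
move: (pbr (phi x) (phi y)) (q.1 x y) (q.2 x (phi y)) => A a g.
move: (lhreindex _ _) (lhmap _ _) => h l.
rewrite !opprK !opprD !opprK !addrA subrr add0r.
by rewrite [RHS](ACl (1*3*5*2*6*4)) /= subrK.
Qed.
End Gauge.

(** * Ad-nilpotency *)

Section AdNilpotent.
Variables (k : fieldType) (H : cocommHopfType k) (L M : liePseudoalg H).
Local Notation V := (LM L M).
Local Notation iM := (@inM k H L M).
Local Notation oM := (@outM k H L M).
Notation hM := (lhmap iM).
Notation hout := (lhmap oM).

Definition zeroL n (t : {ffun 'I_n -> V}) : {set 'I_n} := [set i | (t i).1 == 0].

(* For [d = n + 1] this holds on the dg Lie algebra because of the condition [m >= 1] on
   the bidegree; [ad] of an element of degree 0 lowers [d], and [d = 0] forces [P = 0]. *)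
Record vanishing d n (P : precochain V n) : Prop := Vanishing {
  vanishing_hmultilinear : hmultilinear P;
  vanishing_val : forall t, P t = hM (hout (P t));
  vanishing_zero : forall t, (d <= #|zeroL t|)%N -> P t = 0
}.

Lemma hmultilinear_comb n a (P Q : precochain V n) : hmultilinear P -> hmultilinear Q ->
  hmultilinear (a *: P + Q).
Proof.
move=> [Pl PH] [Ql QH]; have E t : (a *: P + Q) t = a *: P t + Q t by [].
split=> [x i c u v|f x]; rewrite !E.
  rewrite Pl Ql; move: (P (ffupd x i u)) (P (ffupd x i v)) (Q (ffupd x i u)) (Q (ffupd x i v)).
  move=> p1 p2 q1 q2; rewrite scalerDr scalerDr scalerA mulrC -scalerA; exact: addrACA.
by rewrite PH QH (@lhact_linear k H V n.+1 _).
Qed.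

Lemma vanishing_comb d n a (P Q : precochain V n) : vanishing d P -> vanishing d Q ->
  vanishing d (a *: P + Q).
Proof.
move=> [mP vP zP] [mQ vQ zQ]; have E t : (a *: P + Q) t = a *: P t + Q t by [].
split=> [|t|t dt]; first exact: hmultilinear_comb.
  rewrite E {1}vP {1}vQ (@lhmap_linear k H V M n.+1 oM a).
  by rewrite (@lhmap_linear k H M V n.+1 iM a).
by rewrite E zP // zQ // scaler0 addr0.
Qed.

Lemma vanishing0 d n : vanishing d (0 : precochain V n).
Proof.
have E t : (0 : precochain V n) t = 0 by [].
split=> [|t|t _] //.
  split=> [x i c u v|f x]; rewrite !E ?scaler0 ?addr0 //.
  by rewrite (lin0 (@lhact_linear k H V n.+1 _)).
by rewrite E (lin0 (@lhmap_linear k H V M n.+1 oM)) (lin0 (@lhmap_linear k H M V n.+1 iM)).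
Qed.

Lemma vanishing_eq0 n (P : precochain V n) : vanishing 0 P -> P = 0.
Proof. by case=> _ _ zP; apply/funext => t; exact: zP. Qed.

Lemma bidegree_vanishing n m (P : precochain V n) : (0 < m)%N -> bidegree m P -> vanishing n.+1 P.
Proof.
move=> m0 [cP vP zP]; split=> [|t|t nt]; first exact: cochain_hmultilinear.
  by have [w ->] := vP t; rewrite hmapE lhmap_outMK.
apply: (zP finset.set0); last by rewrite cards0 eq_sym -lt0n.
move=> i; rewrite inE; exists (t i).2; apply: injective_projections => //=.
have : i \in zeroL t.
  have /eqP -> : zeroL t == [set: 'I_n.+1] by rewrite eqEcard finset.subsetT cardsT card_ord.
  by rewrite inE.
by rewrite inE => /eqP.
Qed.

Lemma dgla_vanishing n (P : precochain V n) : dgla P -> vanishing n.+1 P.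
Proof.
case=> c bc ->; rewrite big_nat_cond; elim/big_ind: _ => [|Q R vQ vR|m /andP[/andP[m0 mn] _]].
- exact: vanishing0.
- by rewrite -[Q]scale1r; exact: vanishing_comb.
- by apply: (bidegree_vanishing m0); apply: bc; rewrite m0.
Qed.

(** For a cochain [Q] with values in M and [P] vanishing on M the second half of the bracket
    disappears, see [nr_ins_vanishing]. *)
Lemma nr_left (W : lmodType H) m n (P : precochain W m) (Q : precochain W n) :
  nr_ins Q P = 0 -> nr P Q = nr_ins P Q.
Proof.
have e0 a c (e : a = c) : ecast N (precochain W N) e 0 = 0 by case: c / e.
have aux R : R = 0 ->
    nr_ins P Q - (-1) ^+ (m * n) *: ecast N (precochain W N) (addnC n m) R = nr_ins P Q.
  by move=> ->; rewrite e0 scaler0 subr0.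
exact: aux.
Qed.

Section Step.
Variable phi : {linear L -> M}.
Let b := gauge_map phi.

Definition slot_map n (j : 'I_n.+1) : {linear V -> V} := if j == ord0 then b else idfun.

(** The arguments handed to the cochain in the summand of [s] of the bracket with [b], see
    [shuffledE]. *)
Definition shuffled n (s : 'S_n.+1) (t : {ffun 'I_n.+1 -> V}) : {ffun 'I_n.+1 -> V} :=
  [ffun j => slot_map j (t (s j))].

Lemma shuffledE n (s : 'S_(1 + n)) (t : {ffun 'I_(1 + n) -> V}) :
  fcons (b (t (s (lshift n (0 : 'I_1))))) [ffun j => t (s (rshift 1 j))] = @shuffled n s t.
Proof.
apply/ffunP => j; rewrite !ffunE /slot_map; case: unliftP => [i ->|->].
  rewrite eq_sym (negbTE (neq_lift _ _)) ffunE /=; congr (t (s _)); exact: val_inj.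
rewrite eqxx; congr (b (t (s _))); exact: val_inj.
Qed.

Lemma shuffled_upd n (s : 'S_n.+1) t i v :
  shuffled s (ffupd t i v) = ffupd (shuffled s t) (s^-1%g i) (slot_map (s^-1%g i) v).
Proof.
apply/ffunP => j; rewrite !ffunE -(inj_eq (@perm_inj _ s) j) permKV.
by case: eqP => // <-; rewrite permK.
Qed.

(** The values of [P] lie in M, where [gauge_map phi] vanishes. *)
Lemma nr_ins_vanishing n (P : precochain V n) d : vanishing d P ->
  nr_ins P (cochain1 b) = 0 :> precochain V (n + 0).
Proof.
case=> mP vP zP; apply/funext => t; rewrite /nr_ins.
have mb := cochain_hmultilinear (cochain1_cochain b).
apply: big1 => s _; rewrite hreindexE vP (nr_comp_lhmap _ mb).
set G := lhextend _ _; have -> : G = 0.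
  rewrite -[RHS](@lhextend0 k H M n.+1 (htens V (n.+1 + 0)) (hout (P [ffun i => t (s (lshift 0 i))]))).
  apply: eq_lhextend => F e; rewrite /cochain1 ffunE unlift_none.
  have -> : b (iM e) = 0 by rewrite -[LHS]/(iM (phi 0)) !linear0.
  rewrite unit1_0; exact: lin0 (@linsl_linear k H V n 0 F).
by rewrite (lin0 (lhreindex_linear (@perm_inj _ _))) scaler0.
Qed.

(** In each summand [b] is applied to one argument. If that argument is in M, the result is zero;
    otherwise it is moved from L + M into M, so [P] receives one more argument from M than the tuple
    contained. *)
Lemma ad_vanishing d n (P : precochain V n) : vanishing d P -> vanishing d.-1 (ad (cochain1 b) P).
Proof.
move=> vanP; have [mP vP zP] := vanP.
have -> : ad (cochain1 b) P = (fun t : {ffun 'I_n.+1 -> V} =>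
    \sum_(s in shuffles 1 n) (-1) ^+ s *: lhreindex (s^-1)%g (P (@shuffled n s t))) :> precochain V n.
  apply: etrans (nr_left (nr_ins_vanishing vanP)) _; apply: etrans (nr_ins_cochain1 b mP) _.
  by apply/funext => t; apply: eq_bigr => s _; rewrite shuffledE.
have -> : (fun t : {ffun 'I_n.+1 -> V} =>
    \sum_(s in shuffles 1 n) (-1) ^+ s *: lhreindex (s^-1)%g (P (@shuffled n s t))) =
    \sum_(s in shuffles 1 n) (-1) ^+ s *: (fun t => lhreindex (s^-1)%g (P (@shuffled n s t))) :> precochain V n.
  by apply/funext => t; rewrite fct_sumE.
elim/big_ind: _ => [|Q R vQ vR|s _].
- exact: vanishing0.
- by rewrite -[Q]scale1r; exact: vanishing_comb.
rewrite -[_ *: _]addr0; apply: vanishing_comb; last exact: vanishing0.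
have ls := lhreindex_linear (Z := V) (@perm_inj _ (s^-1 : 'S_n.+1)%g).
split=> [|t|t dt].
- split=> [t i a u v|f t].
    by rewrite !shuffled_upd linearP (hmultilinear_lin mP) ls.
  have -> : shuffled s [ffun i => f i *: t i] = [ffun j => [ffun j => f (s j)] j *: shuffled s t j].
    by apply/ffunP => j; rewrite !ffunE linearZ.
  rewrite (hmultilinear_H mP) lhreindex_hact ?ltreindex_pure; try exact: perm_inj.
  by congr (lhact (ltpure _) _); apply/ffunP => i; rewrite !ffunE permKV.
- by rewrite !lhmap_hreindex -?vP //; exact: perm_inj.
suff -> : P (shuffled s t) = 0 by exact: lin0 ls.
have b1 v : (b v).1 = 0 by [].
have [s0|s0] := eqVneq (t (s ord0)).1 0.
  have E : shuffled s t ord0 = 0.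
    by rewrite ffunE /slot_map eqxx /b gauge_mapE s0 !linear0.
  (* A zero argument gives the value zero: multilinearity is applied to 0 written as -1 times 0 plus
     0. *)
  have := hmultilinear_lin mP (shuffled s t) ord0 (-1) 0 0.
  by rewrite scaler0 addr0 scaleN1r addNr -E ffupd_id.
apply: zP; apply: leq_trans (leqSpred d) _; apply: leq_trans (_ : #|zeroL t|.+1 <= _)%N; first by rewrite ltnS.
(* Slot 0 now holds a value of [b], which is in M, and the remaining arguments from M are merely
   permuted by [s]. *)
have <- : #|ord0 |: s @^-1: zeroL t| = #|zeroL t|.+1.
  rewrite cardsU1 !inE s0; congr _.+1.
  have -> : s @^-1: zeroL t = (s^-1)%g @: zeroL t by rewrite -preim_permV invgK.
  by rewrite card_imset //; exact: perm_inj.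
apply/subset_leq_card/fintype.subsetP => j; rewrite !inE ffunE /slot_map.
by case: (j == ord0) => //= _; rewrite b1.
Qed.

(** In degree n the count starts at n + 1 and drops by one with each bracket. The bound K beyond
    which [x] vanishes exceeds every relevant n, so it is an exponent valid in all degrees at
    once. *)
Lemma gauge_map_nilpotent : ad_nilpotent (cochain1 b).
Proof.
move=> x dx [K xK]; exists K => n.
have It r d (P : precochain V n) : vanishing d P -> vanishing (d - r) (iter r (@ad _ _ _ _ (cochain1 b) n) P).
  move=> vP; elim: r => [|r IH]; first by rewrite subn0.
  by rewrite subnS; exact: ad_vanishing.
apply: vanishing_eq0; have [Kn|nK] := leqP K n.
  by rewrite xK // -[0%N](sub0n K); apply: It; exact: vanishing0.
have -> : 0%N = (n.+1 - K)%N by apply/esym/eqP; rewrite subn_eq0.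
by apply: It; exact: dgla_vanishing.
Qed.
End Step.
End AdNilpotent.

(** * Equivalence classes *)

Section Classes.
Variables (k : fieldType) (H : cocommHopfType k) (L M : liePseudoalg H).
Hypothesis char0 : [pchar k]%R =i pred0.
Local Notation V := (LM L M).
Local Open Scope classical_set_scope.
Implicit Types (p q : cocycle_data L M).

Definition MC_of p : precochain V 1 := cochain2 (cochain_of p).

Lemma cocycle_admissible p : is_nab_cocycle p -> admissible p.
Proof. by case/is_nab_cocycleP. Qed.

Lemma MC_of_cocycle p : is_nab_cocycle p -> MC (MC_of p).
Proof.
move=> cp; have gp := cocycle_admissible cp.
by split; [exact: dgla1_cochain_of|apply/(MC_equation char0 gp)].
Qed.

Lemma MC_ofP (c : precochain V 1) : MC c -> exists2 p, is_nab_cocycle p & c = MC_of p.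
Proof.
case=> /dgla1P[p gp ->] mc; exists p => //.
exact/(MC_equation char0 gp).
Qed.

Lemma MC_of_inj p q : is_nab_cocycle p -> is_nab_cocycle q -> MC_of p = MC_of q -> p = q.
Proof. by move=> /cocycle_admissible gp /cocycle_admissible gq; exact: cochain_of_inj. Qed.

(** The order is reversed: a gauge transformation expresses its target through its source, while
    [nab_equiv] expresses its first pair through the second. *)
Lemma gauge_equiv_nab p q : is_nab_cocycle p -> is_nab_cocycle q ->
  gauge_equiv (MC_of p) (MC_of q) <-> nab_equiv q p.
Proof.
move=> /cocycle_admissible gp /cocycle_admissible gq; split=> [[b [db _ E]]|].
  have [phi bE] := dgla0P db; apply/nab_equivP; exists phi.
  have [b1 _ b2] := gp; have [b1' _ b2'] := gq.
  have bL := @pbr_bilinear k H L; have bM := @pbr_bilinear k H M.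
  have lsw := @swap_linear k H M 0.
  apply: cochain_of_eq => [x|x|u|u|y|y|].
  - exact: (pb0r b2').
  - by rewrite /= (pb0r b2) (pb0r bM) addr0.
  - exact: (pb0l b2').
  - by rewrite /= (pb0l b2) linear0 (pb0l bM) addr0.
  - by rewrite (pb0l b1') (pb0r b1').
  - rewrite /= linear0 (pb0l b1) (pb0r b1) (pb0l b2) (pb0r b2).
    rewrite (pb0l bL) (pb0r bL) (pb0l bM) (pb0r bM) (lin0 lsw) (lin0 (@lhmap_linear k H L M 2 phi)).
    by rewrite !subr0 !addr0.
  - by rewrite -(gauge_action phi char0 gp) -bE.
case/nab_equivP => phi ->; exists (cochain1 (gauge_map phi)); split.
- exact: dgla0_gauge_map.
- exact: gauge_map_nilpotent.
- by rewrite /MC_of -(gauge_action phi char0 gp).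
Qed.

(** Every Maurer-Cartan element is some [MC_of q], and [nab_equiv_sym] undoes the reversal of order
    in [gauge_equiv_nab]. *)
Lemma MC_of_class p : is_nab_cocycle p ->
  MC_of @` [set q | is_nab_cocycle q /\ nab_equiv p q] =
  [set c | MC c /\ gauge_equiv (MC_of p) c].
Proof.
move=> cp; apply/seteqP; split=> [c [q [cq pq] <-]|c [/MC_ofP[q cq ->] e]].
  split; first exact: MC_of_cocycle.
  by apply/(gauge_equiv_nab cp cq); exact: nab_equiv_sym (cocycle_admissible cq) pq.
exists q => //; split=> //; apply: nab_equiv_sym (cocycle_admissible cp) _.
exact/(gauge_equiv_nab cp cq).
Qed.
End Classes.

Unset Implicit Arguments.

Theorem theorem3 (k : fieldType) (char0 : [pchar k]%R =i pred0)
    (H : cocommHopfType k) (L M : liePseudoalg H) :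
  exists f, set_bij (H2nab L M) (MCclasses L M) f.
Proof.
(* Classes are sets of representatives, so the map is a direct image and no representative has to be
   chosen. *)
exists (fun C => (@MC_of k H L M @` C)%classic); split.
- by move=> C [p cp ->]; exists (MC_of p); [exact: MC_of_cocycle|exact: MC_of_class].
- move=> C D /set_mem[p cp CE] /set_mem[q cq DE] E.
  (* Injectivity of [MC_of] on cocycles recovers a set of cocycles from its image. *)
  have sub (A B : set (cocycle_data L M)) :
      (forall r, A r -> is_nab_cocycle r) -> (forall r, B r -> is_nab_cocycle r) ->
      (@MC_of k H L M @` A = @MC_of k H L M @` B)%classic -> (A `<=` B)%classic.
    move=> cA cB AB r Ar.
    have : (@MC_of k H L M @` B)%classic (MC_of r) by rewrite -AB; exists r.
    by case=> r' Br' /(MC_of_inj (cB _ Br') (cA _ Ar)) <-.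
  have cC r : C r -> is_nab_cocycle r by rewrite CE => -[].
  have cD r : D r -> is_nab_cocycle r by rewrite DE => -[].
  by apply/seteqP; split; apply: sub.
- move=> D [c /(MC_ofP char0)[p cp ->] ->].
  exists [set q | is_nab_cocycle q /\ nab_equiv p q]%classic; first by exists p.
  exact: MC_of_class.
Qed.
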